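(* Let $(K_i)_{i\in I}$ be an arbitrary (possibly infinite) family of compact subsets of $\mathbb C$ with $\overline{\mathcal O}(K_i)=A_D(K_i)$ for every $i\in I$, and let $K=\prod_{i\in I}K_i$ with the product topology. For each $i\in I$ let $L_i\subset(\mathbb C\cup\{\infty\})\setminus K_i$ contain at least one point of each connected component of $(\mathbb C\cup\{\infty\})\setminus K_i$. Then the finite sums of finite products of rational functions of one variable $z_i$ (for finitely many $i\in I$) with poles in $L_i$ are uniformly dense in $A_D(K)$.
   Context: For a planar compact $K_i$: $\overline{\mathcal O}(K_i)$ is the closure in $C(K_i)$ of restrictions of functions holomorphic on a neighbourhood of $K_i$, and $A_D(K_i)=A(K_i)$ is the algebra of continuous functions on $K_i$ holomorphic on $K_i^\circ$. For $K=\prod_{i\in I}K_i$, $A_D(K)$ is the set of functions $f:K\to\mathbb C$ such that (a) $f$ is continuous for the product topology, and (b) for every $i_0\in I$ and every choice of $w_i\in K_i$ for $i\ne i_0$, the function $z\mapsto f((z_i(z))_{i\in I})$, with $z_{i_0}(z)=z$ and $z_i(z)=w_i$ for $i\ne i_0$, belongs to $A(K_{i_0})$. *)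

(* Defs.v *)
From Stdlib Require Import Reals List ClassicalEpsilon.
Open Scope R_scope.

Definition CC : Type := (R * R)%type.
Definition Cmk (a b : R) : CC := (a, b).
Definition C0 : CC := (0, 0).
Definition C1 : CC := (1, 0).
Definition Cadd (z w : CC) : CC := (fst z + fst w, snd z + snd w).
Definition Copp (z : CC) : CC := (- fst z, - snd z).
Definition Csub (z w : CC) : CC := Cadd z (Copp w).
Definition Cmul (z w : CC) : CC :=
  (fst z * fst w - snd z * snd w, fst z * snd w + snd z * fst w).
Definition Cnorm (z : CC) : R := sqrt (fst z * fst z + snd z * snd z).
Definition Cinv (z : CC) : CC :=
  (fst z / (fst z * fst z + snd z * snd z),
   - snd z / (fst z * fst z + snd z * snd z)).
Definition Cdiv (z w : CC) : CC := Cmul z (Cinv w).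

Definition Copen (U : CC -> Prop) : Prop :=
  forall z, U z -> exists r, 0 < r /\ forall w, Cnorm (Csub w z) < r -> U w.

Definition Ccompact (K : CC -> Prop) : Prop :=
  forall (J : Type) (U : J -> CC -> Prop),
    (forall j, Copen (U j)) ->
    (forall z, K z -> exists j, U j z) ->
    exists js : list J, forall z, K z -> exists j, In j js /\ U j z.

Definition interior (K : CC -> Prop) (z : CC) : Prop :=
  exists r, 0 < r /\ forall w, Cnorm (Csub w z) < r -> K w.

Definition continuous_on (K : CC -> Prop) (f : CC -> CC) : Prop :=
  forall z, K z -> forall eps, 0 < eps -> exists delta, 0 < delta /\
    forall w, K w -> Cnorm (Csub w z) < delta -> Cnorm (Csub (f w) (f z)) < eps.

Definition C_differentiable_at (f : CC -> CC) (z : CC) : Prop :=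
  exists l : CC, forall eps, 0 < eps -> exists delta, 0 < delta /\
    forall h, h <> C0 -> Cnorm h < delta ->
      Cnorm (Csub (Cdiv (Csub (f (Cadd z h)) (f z)) h) l) < eps.

Definition holomorphic_on (U : CC -> Prop) (f : CC -> CC) : Prop :=
  forall z, U z -> C_differentiable_at f z.

(** A(K): continuous on K, holomorphic on the interior of K.
    Functions on K are represented by functions CC -> CC; only values on K matter. *)
Definition A_of (K : CC -> Prop) (f : CC -> CC) : Prop :=
  continuous_on K f /\ holomorphic_on (interior K) f.

Definition Obar (K : CC -> Prop) (f : CC -> CC) : Prop :=
  continuous_on K f /\
  forall eps, 0 < eps -> exists (U : CC -> Prop) (g : CC -> CC),
    Copen U /\ (forall z, K z -> U z) /\ holomorphic_on U g /\
    forall z, K z -> Cnorm (Csub (f z) (g z)) < eps.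

(** * Riemann sphere CC ∪ {∞} = option CC (None = ∞) *)
Definition sphere : Type := option CC.

Definition sphere_open (U : sphere -> Prop) : Prop :=
  Copen (fun z => U (Some z)) /\
  (U None -> exists M, forall z, M < Cnorm z -> U (Some z)).

Definition connected (A : sphere -> Prop) : Prop :=
  forall U V : sphere -> Prop, sphere_open U -> sphere_open V ->
    (forall p, A p -> U p \/ V p) ->
    (forall p, A p -> U p -> V p -> False) ->
    (forall p, A p -> U p) \/ (forall p, A p -> V p).

Definition same_component (S : sphere -> Prop) (p q : sphere) : Prop :=
  exists A : sphere -> Prop,
    (forall x, A x -> S x) /\ connected A /\ A p /\ A q.

Definition sphere_compl (K : CC -> Prop) (p : sphere) : Prop :=
  match p with None => True | Some z => ~ K z end.

Fixpoint peval (p : list CC) (z : CC) : CC :=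
  match p with nil => C0 | a :: p' => Cadd a (Cmul z (peval p' z)) end.

(** r is a rational function p/q whose poles (in CC ∪ {∞}) all lie in L:
    q vanishes only at points of L, and if ∞ ∉ L then p/q has no pole at ∞. *)
Definition rational_poles_in (L : sphere -> Prop) (r : CC -> CC) : Prop :=
  exists p q : list CC,
    (exists a, In a q /\ a <> C0) /\
    (forall z, ~ L (Some z) -> peval q z <> C0) /\
    (~ L None -> exists M B, forall z, M < Cnorm z ->
        Cnorm (peval p z) <= B * Cnorm (peval q z)) /\
    (forall z, ~ L (Some z) -> r z = Cdiv (peval p z) (peval q z)).

Definition in_product {I : Type} (K : I -> CC -> Prop) (x : I -> CC) : Prop :=
  forall i, K i (x i).

Definition update {I : Type} (x : I -> CC) (i0 : I) (z : CC) : I -> CC :=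
  fun j => if excluded_middle_informative (j = i0) then z else x j.

Definition prod_continuous_on {I : Type} (K : I -> CC -> Prop)
    (f : (I -> CC) -> CC) : Prop :=
  forall x, in_product K x -> forall eps, 0 < eps ->
    exists (J : list I) (delta : R), 0 < delta /\
      forall y, in_product K y ->
        (forall j, In j J -> Cnorm (Csub (y j) (x j)) < delta) ->
        Cnorm (Csub (f y) (f x)) < eps.

Definition A_D_prod {I : Type} (K : I -> CC -> Prop) (f : (I -> CC) -> CC) : Prop :=
  prod_continuous_on K f /\
  forall i0 (w : I -> CC), in_product K w ->
    A_of (K i0) (fun z => f (update w i0 z)).

Fixpoint prod_fac {I : Type} (fac : list (I * (CC -> CC))) (x : I -> CC) : CC :=
  match fac with
  | nil => C1
  | (i, r) :: fac' => Cmul (r (x i)) (prod_fac fac' x)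
  end.

Fixpoint sum_terms {I : Type} (s : list (CC * list (I * (CC -> CC)))) (x : I -> CC) : CC :=
  match s with
  | nil => C0
  | (c, fac) :: s' => Cadd (Cmul c (prod_fac fac x)) (sum_terms s' x)
  end.

Definition sum_prod_rational {I : Type} (L : I -> sphere -> Prop)
    (F : (I -> CC) -> CC) : Prop :=
  exists s : list (CC * list (I * (CC -> CC))),
    (forall c fac, In (c, fac) s -> forall i r, In (i, r) fac ->
        rational_poles_in (L i) r) /\
    (forall x, F x = sum_terms s x).

(* Main.v *)
From Coquelicot Require Import Coquelicot.
From mathcomp Require classical_sets.
From Stdlib Require Import Reals List Lra Lia ClassicalEpsilon FunctionalExtensionality.
From Coquelicot Require Import Complex.
Require Import Defs.
Open Scope R_scope.

(** By compactness of the product, f depends, up to a small error, on finitely many coordinates, and one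
    removes them one at a time. Freezing all coordinates but one gives a totally bounded set S of
    functions of A(K_i), so it is enough to find finitely many points x_k of K_i and functions G_k,
    uniform limits of rational functions with poles in L_i, such that f is uniformly close to the
    sum of the f(x_k) G_k for all f in S at once: then each f(x_k) is a function of the remaining
    coordinates which is again of class A_D.

    Such a finite rank approximation is obtained from a discrete form of Vitushkin's localization.
    Extend f to the plane, holomorphically near K_i; this is where A(K_i) = Obar(K_i) is used.
    On a grid of mesh h the sum of phi(Q) times the integral over the boundary of Q of
    (f(w) - f(z)) / (w - z), for a tent function phi of width delta, splits f into local pieces
    of size O(osc f), holomorphic near K_i and off the support of phi. If three moments of f
    against phi vanish, the piece decays like (delta / dist)^4, so that the sum of all pieces is
    O(osc f). The three moments are killed by subtracting finitely many fixed functions with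
    coefficients that are bounded functionals of f (a variant of Auerbach's lemma), whose pieces
    are the G_k. Finally, uniform limits of rational functions with poles in L_i contain all
    1 / (z - a) with a outside K_i, by connectedness and the geometric series. *)

(** The order of the choices is the obstacle. A function of A(K_i) is approximated by functions
    holomorphic only on a neighbourhood of uncontrolled size, and the mesh must be finer than that
    neighbourhood. Hence the mesh is chosen last, and every constant (size of the pieces, norms of
    the functionals, number of pieces) must be independent of it. A second conflict: an extension
    that is linear in finitely many values of f is merely continuous, whereas vanishing boundary
    integrals need holomorphy near K_i. Both kinds of extension are therefore used. The functionals
    are bounded on all continuous functions and act on the linear extension, while the subtracted
    functions are holomorphic near K_i; the two extensions are so close that their difference stays
    small after multiplication by the large constants. Three moments are removed because decay of
    order four in the sup distance is dominated by a product of inverse squares, so that the sum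
    over the pieces factors. *)

Lemma Cnorm_Cmod (z : CC) : Cnorm z = Cmod z.
Proof. unfold Cnorm, Cmod. f_equal. ring. Qed.

Lemma Cinv_Complex (z : CC) : Cinv z = Complex.Cinv z.
Proof. unfold Cinv, Complex.Cinv. destruct z; simpl. f_equal; f_equal; ring. Qed.

Lemma C_ext (z w : C) : fst z = fst w -> snd z = snd w -> z = w.
Proof. destruct z, w; simpl; congruence. Qed.

(** * Finite sums and summation by parts *)

Fixpoint Sum {A : Type} (l : list A) (f : A -> C) : C :=
  match l with nil => RtoC 0 | a :: l' => (f a + Sum l' f)%C end.

Fixpoint RSum {A : Type} (l : list A) (f : A -> R) : R :=
  match l with nil => 0 | a :: l' => f a + RSum l' f end.

Lemma Sum_ext {A} (l : list A) (f g : A -> C) :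
  (forall a, In a l -> f a = g a) -> Sum l f = Sum l g.
Proof.
  induction l as [|a l IH]; simpl; intros H; [easy|].
  rewrite H, IH; auto.
Qed.

Lemma Sum_plus {A} (l : list A) (f g : A -> C) :
  Sum l (fun a => f a + g a)%C = (Sum l f + Sum l g)%C.
Proof. induction l as [|a l IH]; simpl; [|rewrite IH]; ring. Qed.

Lemma Sum_scal {A} (l : list A) (c : C) (f : A -> C) :
  Sum l (fun a => c * f a)%C = (c * Sum l f)%C.
Proof. induction l as [|a l IH]; simpl; [|rewrite IH]; ring. Qed.

Lemma Sum_scal_r {A} (l : list A) (c : C) (f : A -> C) :
  Sum l (fun a => f a * c)%C = (Sum l f * c)%C.
Proof. induction l as [|a l IH]; simpl; [|rewrite IH]; ring. Qed.

Lemma Sum_minus {A} (l : list A) (f g : A -> C) :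
  Sum l (fun a => f a - g a)%C = (Sum l f - Sum l g)%C.
Proof. induction l as [|a l IH]; simpl; [|rewrite IH]; ring. Qed.

Lemma Sum_zero {A} (l : list A) (f : A -> C) :
  (forall a, In a l -> f a = RtoC 0) -> Sum l f = RtoC 0.
Proof.
  induction l as [|a l IH]; simpl; intros H; [easy|].
  rewrite H, IH by auto. ring.
Qed.

Lemma Sum_app {A} (l1 l2 : list A) (f : A -> C) :
  Sum (l1 ++ l2) f = (Sum l1 f + Sum l2 f)%C.
Proof. induction l1 as [|a l IH]; simpl; [|rewrite IH]; ring. Qed.

Lemma Sum_map {A B} (l : list A) (g : A -> B) (f : B -> C) :
  Sum (map g l) f = Sum l (fun a => f (g a)).
Proof. induction l as [|a l IH]; simpl; [|rewrite IH]; reflexivity. Qed.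

Lemma Sum_flat_map {A B} (l : list A) (g : A -> list B) (f : B -> C) :
  Sum (flat_map g l) f = Sum l (fun a => Sum (g a) f).
Proof.
  induction l as [|a l IH]; simpl; [easy|]. rewrite Sum_app, IH. reflexivity.
Qed.

Lemma Sum_swap {A B} (l : list A) (k : list B) (f : A -> B -> C) :
  Sum l (fun a => Sum k (f a)) = Sum k (fun b => Sum l (fun a => f a b)).
Proof.
  induction l as [|a l IH]; simpl.
  - symmetry. apply Sum_zero. auto.
  - rewrite IH, Sum_plus. reflexivity.
Qed.

Lemma RSum_le {A} (l : list A) (f g : A -> R) :
  (forall a, In a l -> f a <= g a) -> RSum l f <= RSum l g.
Proof.
  induction l as [|a l IH]; simpl; intros H; [lra|].
  apply Rplus_le_compat; auto.
Qed.

Lemma RSum_ext {A} (l : list A) (f g : A -> R) :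
  (forall a, In a l -> f a = g a) -> RSum l f = RSum l g.
Proof.
  induction l as [|a l IH]; simpl; intros H; [easy|].
  rewrite H, IH; auto.
Qed.

Lemma RSum_const {A} (l : list A) (c : R) :
  RSum l (fun _ => c) = INR (length l) * c.
Proof.
  induction l as [|a l IH]; simpl length; simpl RSum; [simpl; ring|].
  rewrite IH, S_INR. ring.
Qed.

Lemma RSum_scal {A} (l : list A) (c : R) (f : A -> R) :
  RSum l (fun a => c * f a) = c * RSum l f.
Proof. induction l as [|a l IH]; simpl; [|rewrite IH]; ring. Qed.

Lemma RSum_plus {A} (l : list A) (f g : A -> R) :
  RSum l (fun a => f a + g a) = RSum l f + RSum l g.
Proof. induction l as [|a l IH]; simpl; [|rewrite IH]; ring. Qed.

Lemma RSum_nonneg {A} (l : list A) (f : A -> R) :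
  (forall a, In a l -> 0 <= f a) -> 0 <= RSum l f.
Proof.
  intros H. replace 0 with (RSum l (fun _ => 0)) by (rewrite RSum_const; ring).
  now apply RSum_le.
Qed.

Lemma RSum_app {A} (l1 l2 : list A) (f : A -> R) :
  RSum (l1 ++ l2) f = RSum l1 f + RSum l2 f.
Proof. induction l1 as [|a l IH]; simpl; [|rewrite IH]; ring. Qed.

Lemma Sum_mod {A} (l : list A) (f : A -> C) :
  Cmod (Sum l f) <= RSum l (fun a => Cmod (f a)).
Proof.
  induction l as [|a l IH]; simpl.
  - rewrite Cmod_0. lra.
  - eapply Rle_trans; [apply Cmod_triangle|]. lra.
Qed.

Lemma Sum_RtoC {A} (l : list A) (f : A -> R) :
  Sum l (fun a => RtoC (f a)) = RtoC (RSum l f).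
Proof.
  induction l as [|a l IH]; simpl; [easy|]. rewrite IH, RtoC_plus. reflexivity.
Qed.

Lemma Sum_seq_S (n : nat) (f : nat -> C) :
  Sum (seq 0 (S n)) f = (Sum (seq 0 n) f + f n)%C.
Proof. rewrite seq_S, Sum_app. simpl. ring. Qed.

Lemma RSum_seq_S (n : nat) (f : nat -> R) :
  RSum (seq 0 (S n)) f = RSum (seq 0 n) f + f n.
Proof. rewrite seq_S, RSum_app. simpl. ring. Qed.

Lemma Sum_telescope (n : nat) (b : nat -> C) :
  Sum (seq 0 n) (fun k => b (S k) - b k)%C = (b n - b 0%nat)%C.
Proof.
  induction n as [|n IH]; [simpl; ring|]. rewrite Sum_seq_S, IH. ring.
Qed.

Lemma RSum_telescope (n : nat) (b : nat -> R) :
  RSum (seq 0 n) (fun k => b (S k) - b k) = b n - b 0%nat.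
Proof.
  induction n as [|n IH]; [simpl; ring|]. rewrite RSum_seq_S, IH. ring.
Qed.

(** The two summands differ by a k * b k - a (S k) * b (S k), which telescopes to the vanishing end
    terms. On the grid this moves a difference from the edge integrals to the weights. *)
Lemma Sum_Abel (n : nat) (a b : nat -> C) :
  a 0%nat = RtoC 0 -> a n = RtoC 0 ->
  Sum (seq 0 n) (fun k => a k * (b k - b (S k)))%C
  = Sum (seq 0 n) (fun k => (a (S k) - a k) * b (S k))%C.
Proof.
  intros H0 Hn.
  assert (E : Sum (seq 0 n) (fun k => a k * (b k - b (S k)))%C
   = (Sum (seq 0 n) (fun k => (a (S k) - a k) * b (S k)) -
      (a n * b n - a 0%nat * b 0%nat))%C).
  { rewrite <- (Sum_telescope n (fun k => a k * b k)%C), <- Sum_minus.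
    apply Sum_ext. intros. ring. }
  rewrite E, H0, Hn. ring.
Qed.

Lemma Cmod_minus_sym (a b : C) : Cmod (a - b) = Cmod (b - a).
Proof. rewrite <- Cmod_opp. f_equal. ring. Qed.

Lemma Cmod_dist_triangle (a b c : C) : Cmod (a - c) <= Cmod (a - b) + Cmod (b - c).
Proof. replace (a - c)%C with ((a - b) + (b - c))%C by ring. apply Cmod_triangle. Qed.

Lemma Cmod_le_add (a b : C) : Cmod a <= Cmod (a - b) + Cmod b.
Proof. replace a with ((a - b) + b)%C at 1 by ring. apply Cmod_triangle. Qed.

Lemma Re_le_Cmod (z : C) : Rabs (fst z) <= Cmod z.
Proof. eapply Rle_trans; [apply Rmax_l|apply Rmax_Cmod]. Qed.

Lemma Im_le_Cmod (z : C) : Rabs (snd z) <= Cmod z.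
Proof. eapply Rle_trans; [apply Rmax_r|apply Rmax_Cmod]. Qed.

Lemma Cmod_le_parts (z : C) (r : R) :
  Rabs (fst z) <= r -> Rabs (snd z) <= r -> Cmod z <= 2 * r.
Proof.
  intros H1 H2. apply Rle_trans with (Cmod (RtoC (fst z)) + Cmod (Ci * RtoC (snd z))).
  - rewrite <- Cmod_triangle. right. f_equal. apply C_ext; simpl; ring.
  - rewrite Cmod_mult, Cmod_Ci, !Cmod_R. lra.
Qed.

Lemma Cmod_sqr (z : C) : Cmod z * Cmod z = fst z * fst z + snd z * snd z.
Proof.
  unfold Cmod. rewrite sqrt_sqrt; [ring|].
  apply Rplus_le_le_0_compat; apply pow2_ge_0.
Qed.

Lemma Cminus_neq_0 (a b : C) : a <> b -> (a - b)%C <> RtoC 0.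
Proof.
  intros H E. apply H. replace a with ((a - b) + b)%C by ring. rewrite E. ring.
Qed.

Lemma Cmod_pow' (z : C) (n : nat) : Cmod (z ^ n)%C = Cmod z ^ n.
Proof.
  induction n as [|n IH]; simpl; [apply Cmod_1|]. rewrite Cmod_mult, IH. ring.
Qed.

(** * Continuity *)

(** Continuity in the plane, not relative to a set as in [continuous_on]: the functions to be
    integrated are extended to the whole plane. *)
Definition ccont (g : C -> C) (z : C) : Prop :=
  forall eps, 0 < eps -> exists d, 0 < d /\
    forall w, Cmod (w - z) < d -> Cmod (g w - g z) < eps.

Lemma ccont_const c z : ccont (fun _ => c) z.
Proof.
  intros e He. exists 1. split; [lra|]. intros.
  replace (c - c)%C with (RtoC 0) by ring. now rewrite Cmod_0.
Qed.

Lemma ccont_id z : ccont (fun w => w) z.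
Proof. intros e He. exists e. auto. Qed.

Lemma ccont_ext f g z r :
  0 < r -> (forall w, Cmod (w - z) < r -> f w = g w) -> ccont f z -> ccont g z.
Proof.
  intros Hr E Hf e He. destruct (Hf e He) as [d [Hd H]].
  exists (Rmin d r). split; [now apply Rmin_glb_lt|]. intros w Hw.
  rewrite <- !E.
  - apply H. eapply Rlt_le_trans; [exact Hw|apply Rmin_l].
  - replace (z - z)%C with (RtoC 0) by ring. now rewrite Cmod_0.
  - eapply Rlt_le_trans; [exact Hw|apply Rmin_r].
Qed.

Lemma ccont_plus f g z : ccont f z -> ccont g z -> ccont (fun w => f w + g w)%C z.
Proof.
  intros Hf Hg e He.
  destruct (Hf (e / 2)) as [d1 [Hd1 H1]]; [lra|].
  destruct (Hg (e / 2)) as [d2 [Hd2 H2]]; [lra|].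
  exists (Rmin d1 d2). split; [now apply Rmin_glb_lt|]. intros w Hw.
  replace (f w + g w - (f z + g z))%C with ((f w - f z) + (g w - g z))%C by ring.
  eapply Rle_lt_trans; [apply Cmod_triangle|].
  assert (Cmod (w - z) < d1) by (eapply Rlt_le_trans; [exact Hw|apply Rmin_l]).
  assert (Cmod (w - z) < d2) by (eapply Rlt_le_trans; [exact Hw|apply Rmin_r]).
  specialize (H1 w H). specialize (H2 w H0). lra.
Qed.

Lemma ccont_mult f g z : ccont f z -> ccont g z -> ccont (fun w => f w * g w)%C z.
Proof.
  intros Hf Hg e He.
  pose proof (Cmod_ge_0 (f z)) as Pf. pose proof (Cmod_ge_0 (g z)) as Pg.
  set (K := Cmod (f z) + Cmod (g z) + 1).
  assert (HK : 1 <= K) by (unfold K; lra).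
  assert (He' : 0 < Rmin 1 (e / (2 * K))).
  { apply Rmin_glb_lt; [lra|]. apply Rdiv_lt_0_compat; lra. }
  destruct (Hf _ He') as [d1 [Hd1 H1]]. destruct (Hg _ He') as [d2 [Hd2 H2]].
  exists (Rmin d1 d2). split; [now apply Rmin_glb_lt|]. intros w Hw.
  assert (A1 : Cmod (w - z) < d1) by (eapply Rlt_le_trans; [exact Hw|apply Rmin_l]).
  assert (A2 : Cmod (w - z) < d2) by (eapply Rlt_le_trans; [exact Hw|apply Rmin_r]).
  specialize (H1 w A1). specialize (H2 w A2).
  replace (f w * g w - f z * g z)%C
    with ((f w - f z) * (g w - g z) + f z * (g w - g z) + (f w - f z) * g z)%C by ring.
  eapply Rle_lt_trans; [apply Cmod_triangle|].
  eapply Rle_lt_trans; [apply Rplus_le_compat_r, Cmod_triangle|].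
  rewrite !Cmod_mult.
  pose proof (Cmod_ge_0 (f w - f z)) as Q1. pose proof (Cmod_ge_0 (g w - g z)) as Q2.
  set (m := Rmin 1 (e / (2 * K))) in *.
  assert (m <= 1) by apply Rmin_l. assert (Hm : m <= e / (2 * K)) by apply Rmin_r.
  assert (m * (2 * K) <= e).
  { apply Rle_trans with (e / (2 * K) * (2 * K)).
    - apply Rmult_le_compat_r; lra.
    - right. field. lra. }
  assert (Cmod (f w - f z) * Cmod (g w - g z) <= 1 * m).
  { apply Rmult_le_compat; lra. }
  assert (Cmod (f z) * Cmod (g w - g z) <= Cmod (f z) * m).
  { apply Rmult_le_compat_l; lra. }
  assert (Cmod (f w - f z) * Cmod (g z) <= m * Cmod (g z)).
  { apply Rmult_le_compat_r; lra. }
  unfold K in *. nra.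
Qed.

Lemma ccont_opp f z : ccont f z -> ccont (fun w => - f w)%C z.
Proof.
  intros H. apply ccont_ext with (f := (fun w => RtoC (-1) * f w)%C) (r := 1); [lra| |].
  - intros. apply C_ext; simpl; ring.
  - apply ccont_mult; [apply ccont_const|exact H].
Qed.

Lemma ccont_minus f g z : ccont f z -> ccont g z -> ccont (fun w => f w - g w)%C z.
Proof. intros. unfold Cminus. apply ccont_plus; [|apply ccont_opp]; auto. Qed.

Lemma Cmod_inv_diff (a b : C) : a <> RtoC 0 -> b <> RtoC 0 ->
  Cmod (/ a - / b) = Cmod (a - b) / (Cmod a * Cmod b).
Proof.
  intros Ha Hb. replace (/ a - / b)%C with ((b - a) / (a * b))%C by (field; auto).
  rewrite Cmod_div, Cmod_mult, (Cmod_minus_sym b a); [easy|].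
  now apply Cmult_neq_0.
Qed.

Lemma ccont_inv f z : f z <> RtoC 0 -> ccont f z -> ccont (fun w => / f w)%C z.
Proof.
  intros Hz Hf e He. assert (Pz : 0 < Cmod (f z)) by now apply Cmod_gt_0.
  set (r := Cmod (f z)) in *.
  destruct (Hf (Rmin (r / 2) (e * (r * r) / 2))) as [d [Hd H]].
  { apply Rmin_glb_lt; [lra|]. assert (0 < r * r) by nra. nra. }
  exists d. split; [easy|]. intros w Hw. specialize (H w Hw).
  assert (H1 : Cmod (f w - f z) < r / 2) by (eapply Rlt_le_trans; [exact H|apply Rmin_l]).
  assert (H2 : Cmod (f w - f z) < e * (r * r) / 2) by (eapply Rlt_le_trans; [exact H|apply Rmin_r]).
  assert (Hw2 : r / 2 < Cmod (f w)).
  { pose proof (Cmod_le_add (f z) (f w)). rewrite Cmod_minus_sym in H0. fold r in H0. lra. }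
  rewrite Cmod_inv_diff; auto.
  2: { intros E. rewrite E, Cmod_0 in Hw2. lra. }
  fold r. apply Rlt_div_l; [nra|].
  eapply Rlt_le_trans; [exact H2|].
  assert (r * r / 2 <= Cmod (f w) * r) by nra. nra.
Qed.

Lemma ccont_R (K : R) (f : C -> R) z : 0 < K ->
  (forall w w', Rabs (f w - f w') <= K * Cmod (w - w')) -> ccont (fun w => RtoC (f w)) z.
Proof.
  intros HK H e He. exists (e / K). split; [now apply Rdiv_lt_0_compat|]. intros w Hw.
  rewrite <- RtoC_minus, Cmod_R. eapply Rle_lt_trans; [apply H|].
  apply Rlt_div_r in Hw; lra.
Qed.

Lemma ccont_Sum {A} (l : list A) (f : A -> C -> C) z :
  (forall a, In a l -> ccont (f a) z) -> ccont (fun w => Sum l (fun a => f a w)) z.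
Proof.
  induction l as [|a l IH]; simpl; intros H; [apply ccont_const|].
  apply ccont_plus; auto.
Qed.

Lemma C_differentiable_ccont (f : C -> C) z : C_differentiable_at f z -> ccont f z.
Proof.
  intros [l Hl] e He.
  destruct (Hl 1) as [d [Hd H]]; [lra|].
  pose proof (Cmod_ge_0 l) as Pl.
  exists (Rmin d (e / (Cmod l + 2))).
  split; [apply Rmin_glb_lt; [easy|apply Rdiv_lt_0_compat; lra]|].
  intros w Hw.
  destruct (classic (w = z)) as [->|Hn].
  { replace (f z - f z)%C with (RtoC 0) by ring. now rewrite Cmod_0. }
  assert (Hh : (w - z)%C <> C0) by (now apply Cminus_neq_0).
  assert (Hw1 : Cmod (w - z) < d) by (eapply Rlt_le_trans; [exact Hw|apply Rmin_l]).
  assert (Hw2 : Cmod (w - z) < e / (Cmod l + 2)) by (eapply Rlt_le_trans; [exact Hw|apply Rmin_r]).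
  specialize (H (w - z)%C Hh). rewrite !Cnorm_Cmod in H. specialize (H Hw1).
  unfold Cdiv in H. rewrite Cinv_Complex in H.
  change (Cmod ((f (z + (w - z)) - f z) * / (w - z) - l)%C < 1) in H.
  replace (z + (w - z))%C with w in H by ring.
  replace (f w - f z)%C with (((f w - f z) * / (w - z) - l) * (w - z) + l * (w - z))%C
    by (field; exact Hh).
  eapply Rle_lt_trans; [apply Cmod_triangle|]. rewrite !Cmod_mult.
  pose proof (Cmod_ge_0 (w - z)).
  apply Rlt_div_r in Hw2; [|lra].
  nra.
Qed.

Lemma C_differentiable_expand (f : C -> C) z : C_differentiable_at f z ->
  exists l : C, forall eps, 0 < eps -> exists d, 0 < d /\
    forall w, Cmod (w - z) < d ->
      Cmod (f w - f z - l * (w - z)) <= eps * Cmod (w - z).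
Proof.
  intros [l Hl]. exists l. intros e He. destruct (Hl e He) as [d [Hd H]].
  exists d. split; [easy|]. intros w Hw1.
  destruct (classic (w = z)) as [->|Hn].
  { replace (f z - f z - l * (z - z))%C with (RtoC 0) by ring. rewrite Cmod_0.
    pose proof (Cmod_ge_0 (z - z)). nra. }
  assert (Hh : (w - z)%C <> C0) by (now apply Cminus_neq_0).
  specialize (H (w - z)%C Hh). rewrite !Cnorm_Cmod in H. specialize (H Hw1).
  unfold Cdiv in H. rewrite Cinv_Complex in H.
  change (Cmod ((f (z + (w - z)) - f z) * / (w - z) - l)%C < e) in H.
  replace (z + (w - z))%C with w in H by ring.
  replace (f w - f z - l * (w - z))%C with (((f w - f z) * / (w - z) - l) * (w - z))%C
    by (field; exact Hh).
  rewrite Cmod_mult. apply Rmult_le_compat_r; [apply Cmod_ge_0|lra].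
Qed.

(** * Compact sets *)

(** The cover is indexed by the subset type of good pairs (center, radius), so each ball of the
    finite subcover keeps its certificate [Q]. *)
Lemma compact_balls (X : C -> Prop) (Q : C -> R -> Prop) :
  Ccompact X -> (forall z, X z -> exists r, 0 < r /\ Q z r) ->
  exists l : list (C * R),
    (forall z r, In (z, r) l -> X z /\ 0 < r /\ Q z r) /\
    (forall w, X w -> exists z r, In (z, r) l /\ Cmod (w - z) < r).
Proof.
  intros HX HQ.
  set (ok := fun p : C * R => X (fst p) /\ 0 < snd p /\ Q (fst p) (snd p)).
  destruct (HX {p | ok p} (fun p w => Cmod (w - fst (proj1_sig p)) < snd (proj1_sig p)))
    as [js Hjs].
  - intros [[z0 r0] [H1 [H2 H3]]] z Hz. simpl in *.
    exists (r0 - Cmod (z - z0)). split; [lra|]. intros w Hw. rewrite Cnorm_Cmod in Hw.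
    change (Cmod (w - z)%C < r0 - Cmod (z - z0)) in Hw.
    pose proof (Cmod_dist_triangle w z z0). lra.
  - intros z Hz. destruct (HQ z Hz) as [r [Hr Hq]].
    assert (Hok : ok (z, r)) by (repeat split; auto).
    exists (exist ok (z, r) Hok). simpl. replace (z - z)%C with (RtoC 0) by ring.
    now rewrite Cmod_0.
  - exists (map (@proj1_sig _ _) js). split.
    + intros z r H. apply in_map_iff in H. destruct H as [[p Hp] [E _]]. simpl in E.
      subst p. exact Hp.
    + intros w Hw. destruct (Hjs w Hw) as [[[z r] Hp] [Hin Hlt]]. exists z, r.
      split; [|exact Hlt]. apply in_map_iff. exists (exist ok (z, r) Hp). auto.
Qed.

Lemma list_min_pos {A} (l : list A) (f : A -> R) :
  (forall a, In a l -> 0 < f a) -> exists m, 0 < m /\ forall a, In a l -> m <= f a.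
Proof.
  induction l as [|a l IH]; intros H.
  - exists 1. split; [lra|]. intros a [].
  - destruct IH as [m [Hm H1]]; [intros; apply H; now right|].
    exists (Rmin m (f a)). split.
    + apply Rmin_glb_lt; [easy|]. apply H. now left.
    + intros b [<-|Hb]; [apply Rmin_r|]. eapply Rle_trans; [apply Rmin_l|auto].
Qed.

Lemma list_max {A} (l : list A) (f : A -> R) :
  exists m, 0 < m /\ forall a, In a l -> f a <= m.
Proof.
  induction l as [|a l [m [Hm H]]].
  - exists 1. split; [lra|]. intros a [].
  - exists (Rmax m (f a)). split.
    + eapply Rlt_le_trans; [exact Hm|apply Rmax_l].
    + intros b [<-|Hb]; [apply Rmax_r|]. eapply Rle_trans; [now apply H|apply Rmax_l].
Qed.

Lemma compact_net (X : C -> Prop) (r : R) : Ccompact X -> 0 < r ->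
  exists l : list C, (forall z, In z l -> X z) /\
    forall w, X w -> exists z, In z l /\ Cmod (w - z) < r.
Proof.
  intros HX Hr. destruct (compact_balls X (fun _ s => s = r) HX) as [l [H1 H2]].
  { intros z _. exists r. auto. }
  exists (map fst l). split.
  - intros z Hz. apply in_map_iff in Hz. destruct Hz as [[z' s] [<- Hin]].
    now apply (H1 z' s).
  - intros w Hw. destruct (H2 w Hw) as [z [s [Hin Hlt]]]. exists z. split.
    + apply in_map_iff. exists (z, s). auto.
    + destruct (H1 z s Hin) as [_ [_ ->]]. exact Hlt.
Qed.

Lemma compact_bounded (X : C -> Prop) : Ccompact X ->
  exists B, 0 < B /\ forall z, X z -> Cmod z <= B.
Proof.
  intros HX. destruct (compact_net X 1 HX) as [l [_ H]]; [lra|].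
  destruct (list_max l Cmod) as [m [Hm Hl]]. exists (m + 1). split; [lra|].
  intros z Hz. destruct (H z Hz) as [w [Hw Hd]]. specialize (Hl w Hw).
  pose proof (Cmod_le_add z w). lra.
Qed.

(** Lebesgue number: balls of half the good radius cover [X], and the smallest of finitely many half
    radii serves every point. *)
Lemma compact_nbhd (X : C -> Prop) (P : C -> Prop) : Ccompact X ->
  (forall z, X z -> exists r, 0 < r /\ forall w, Cmod (w - z) < r -> P w) ->
  exists r, 0 < r /\ forall z w, X z -> Cmod (w - z) < r -> P w.
Proof.
  intros HX HP.
  destruct (compact_balls X (fun z r => forall w, Cmod (w - z) < 2 * r -> P w) HX)
    as [l [H1 H2]].
  { intros z Hz. destruct (HP z Hz) as [r [Hr H]]. exists (r / 2). split; [lra|].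
    intros w Hw. apply H. lra. }
  destruct (list_min_pos l snd) as [m [Hm Hl]].
  { intros [z r] Hin. now apply (H1 z r). }
  exists m. split; [easy|]. intros z w Hz Hw.
  destruct (H2 z Hz) as [z0 [r0 [Hin Hlt]]].
  destruct (H1 z0 r0 Hin) as [_ [_ HQ]]. apply HQ.
  specialize (Hl _ Hin). simpl in Hl. pose proof (Cmod_dist_triangle w z z0). lra.
Qed.

Lemma compact_dist (X : C -> Prop) (a : C) : Ccompact X -> ~ X a ->
  exists r, 0 < r /\ forall z, X z -> r <= Cmod (z - a).
Proof.
  intros HX Ha.
  destruct (compact_nbhd X (fun w => w <> a) HX) as [r [Hr H]].
  - intros z Hz. assert (Hn : z <> a) by congruence.
    exists (Cmod (a - z)). split.
    + apply Cmod_gt_0, Cminus_neq_0. congruence.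
    + intros w Hw E. subst w. lra.
  - exists r. split; [easy|]. intros z Hz. apply Rnot_lt_le. intros Hlt.
    apply (H z a Hz); [|easy]. now rewrite Cmod_minus_sym.
Qed.

Lemma compact_unif_cont (X : C -> Prop) (f : C -> C) : Ccompact X -> continuous_on X f ->
  forall eps, 0 < eps -> exists d, 0 < d /\
    forall z w, X z -> X w -> Cmod (w - z) < d -> Cmod (f w - f z) < eps.
Proof.
  intros HX Hf e He.
  destruct (compact_balls X (fun z r => forall w, X w -> Cmod (w - z) < 2 * r ->
     Cmod (f w - f z) < e / 2) HX) as [l [H1 H2]].
  { intros z Hz. destruct (Hf z Hz (e / 2)) as [d [Hd H]]; [lra|].
    exists (d / 2). split; [lra|]. intros w Hw Hlt.
    specialize (H w Hw). rewrite !Cnorm_Cmod in H. apply H.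
    change (Cmod (w - z)%C < d). lra. }
  destruct (list_min_pos l snd) as [m [Hm Hl]].
  { intros [z r] Hin. now apply (H1 z r). }
  exists m. split; [easy|]. intros z w Hz Hw Hlt.
  destruct (H2 z Hz) as [z0 [r0 [Hin Hd]]].
  destruct (H1 z0 r0 Hin) as [_ [_ HQ]]. specialize (Hl _ Hin). simpl in Hl.
  pose proof (Cmod_dist_triangle w z z0).
  assert (A1 : Cmod (f w - f z0) < e / 2) by (apply HQ; auto; lra).
  assert (A2 : Cmod (f z - f z0) < e / 2) by (apply HQ; auto; lra).
  pose proof (Cmod_dist_triangle (f w) (f z0) (f z)).
  rewrite (Cmod_minus_sym (f z0)) in H0. lra.
Qed.

(** * Line integrals and Goursat's theorem *)

Definition rcont (g : R -> C) (t : R) : Prop :=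
  forall eps, 0 < eps -> exists d, 0 < d /\
    forall s, Rabs (s - t) < d -> Cmod (g s - g t) < eps.

Definition cint (g : R -> C) (a b : R) : C :=
  (RInt (fun t => fst (g t)) a b, RInt (fun t => snd (g t)) a b).

Definition Hint (g : C -> C) (y a b : R) : C := cint (fun t => g (t, y)) a b.
Definition Vint (g : C -> C) (x c d : R) : C := (Ci * cint (fun t => g (x, t)) c d)%C.

(** Counterclockwise boundary integral; the factor [Ci] in [Vint] is dw = i dt on vertical sides. *)
Definition Rint (g : C -> C) (a b c d : R) : C :=
  (Hint g c a b + Vint g b c d - Hint g d a b - Vint g a c d)%C.

Lemma rcont_fst g t : rcont g t -> continuous (fun s => fst (g s)) t.
Proof.
  intros H. apply filterlim_locally. intros e. destruct (H e (cond_pos e)) as [d [Hd Hs]].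
  exists (mkposreal d Hd). intros s Hb. apply Rle_lt_trans with (Cmod (g s - g t)).
  - apply (Re_le_Cmod (g s - g t)).
  - apply Hs. exact Hb.
Qed.

Lemma rcont_snd g t : rcont g t -> continuous (fun s => snd (g s)) t.
Proof.
  intros H. apply filterlim_locally. intros e. destruct (H e (cond_pos e)) as [d [Hd Hs]].
  exists (mkposreal d Hd). intros s Hb. apply Rle_lt_trans with (Cmod (g s - g t)).
  - apply (Im_le_Cmod (g s - g t)).
  - apply Hs. exact Hb.
Qed.

Lemma rcont_H g t y : ccont g (t, y) -> rcont (fun s => g (s, y)) t.
Proof.
  intros H e He. destruct (H e He) as [d [Hd Hs]]. exists d. split; [easy|].
  intros s Hst. apply Hs. replace ((s, y) - (t, y))%C with (RtoC (s - t)).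
  - now rewrite Cmod_R.
  - apply C_ext; simpl; ring.
Qed.

Lemma rcont_V g x t : ccont g (x, t) -> rcont (fun s => g (x, s)) t.
Proof.
  intros H e He. destruct (H e He) as [d [Hd Hs]]. exists d. split; [easy|].
  intros s Hst. apply Hs. replace ((x, s) - (x, t))%C with (Ci * RtoC (s - t))%C.
  - now rewrite Cmod_mult, Cmod_Ci, Cmod_R, Rmult_1_l.
  - apply C_ext; simpl; ring.
Qed.

Lemma RInt_lin (f g : R -> R) u v a b : ex_RInt f a b -> ex_RInt g a b ->
  RInt (fun t => u * f t + v * g t) a b = u * RInt f a b + v * RInt g a b.
Proof.
  intros Hf Hg. apply is_RInt_unique.
  apply (is_RInt_plus (V := R_NormedModule) (fun t => u * f t) (fun t => v * g t)).
  - apply (is_RInt_scal (V := R_NormedModule)). now apply (RInt_correct (V := R_CompleteNormedModule)).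
  - apply (is_RInt_scal (V := R_NormedModule)). now apply (RInt_correct (V := R_CompleteNormedModule)).
Qed.

Section Cint.
Variables (a b : R) (Hab : a <= b).

Lemma ex_fst g : (forall t, a <= t <= b -> rcont g t) -> ex_RInt (fun t => fst (g t)) a b.
Proof.
  intros H. apply (ex_RInt_continuous (V := R_CompleteNormedModule)). intros t Ht.
  rewrite Rmin_left, Rmax_right in Ht by easy. apply rcont_fst. auto.
Qed.

Lemma ex_snd g : (forall t, a <= t <= b -> rcont g t) -> ex_RInt (fun t => snd (g t)) a b.
Proof.
  intros H. apply (ex_RInt_continuous (V := R_CompleteNormedModule)). intros t Ht.
  rewrite Rmin_left, Rmax_right in Ht by easy. apply rcont_snd. auto.
Qed.

Lemma cint_ext g k : (forall t, a <= t <= b -> g t = k t) -> cint g a b = cint k a b.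
Proof.
  intros H. unfold cint. f_equal; apply RInt_ext; intros t Ht;
  rewrite Rmin_left, Rmax_right in Ht by easy; rewrite H by lra; reflexivity.
Qed.

Lemma cint_plus g k :
  (forall t, a <= t <= b -> rcont g t) -> (forall t, a <= t <= b -> rcont k t) ->
  cint (fun t => g t + k t)%C a b = (cint g a b + cint k a b)%C.
Proof.
  intros Hg Hk. unfold cint. apply C_ext; simpl.
  - rewrite <- (RInt_plus (V := R_CompleteNormedModule)) by (apply ex_fst; auto). reflexivity.
  - rewrite <- (RInt_plus (V := R_CompleteNormedModule)) by (apply ex_snd; auto). reflexivity.
Qed.

Lemma cint_scal c g : (forall t, a <= t <= b -> rcont g t) ->
  cint (fun t => c * g t)%C a b = (c * cint g a b)%C.
Proof.
  intros Hg. pose proof (ex_fst g Hg) as E1. pose proof (ex_snd g Hg) as E2.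
  destruct c as [c1 c2]. unfold cint. apply C_ext; simpl.
  - transitivity (RInt (fun t => c1 * fst (g t) + (- c2) * snd (g t)) a b); [apply RInt_ext; intros; simpl; ring|].
    rewrite RInt_lin; auto. ring.
  - transitivity (RInt (fun t => c1 * snd (g t) + c2 * fst (g t)) a b); [apply RInt_ext; intros; simpl; ring|].
    rewrite RInt_lin; auto.
Qed.

(** The factor 2 is the price of bounding real and imaginary parts separately ([Cmod_le_parts]). *)
Lemma cint_bound g M :
  (forall t, a <= t <= b -> rcont g t) -> (forall t, a <= t <= b -> Cmod (g t) <= M) ->
  Cmod (cint g a b) <= 2 * (M * (b - a)).
Proof.
  intros Hg HM. apply Cmod_le_parts; simpl.
  - rewrite Rmult_comm. apply (abs_RInt_le_const (fun t => fst (g t))); auto.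
    + now apply ex_fst.
    + intros t Ht. eapply Rle_trans; [apply Re_le_Cmod|auto].
  - rewrite Rmult_comm. apply (abs_RInt_le_const (fun t => snd (g t))); auto.
    + now apply ex_snd.
    + intros t Ht. eapply Rle_trans; [apply Im_le_Cmod|auto].
Qed.

End Cint.

Lemma cint_Chasles g a b c : a <= b -> b <= c ->
  (forall t, a <= t <= c -> rcont g t) -> (cint g a b + cint g b c)%C = cint g a c.
Proof.
  intros Hab Hbc H. unfold cint. apply C_ext; simpl.
  - apply (RInt_Chasles (V := R_CompleteNormedModule)); apply ex_fst; auto; intros; apply H; lra.
  - apply (RInt_Chasles (V := R_CompleteNormedModule)); apply ex_snd; auto; intros; apply H; lra.
Qed.

Lemma RInt_affine u v a b :
  RInt (fun t => u + t * v) a b = u * (b - a) + v * (b * b - a * a) / 2.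
Proof.
  apply is_RInt_unique.
  replace (u * (b - a) + v * (b * b - a * a) / 2)
    with (minus (u * b + v * (b * b) / 2) (u * a + v * (a * a) / 2))
    by (unfold minus, plus, opp; simpl; field).
  apply (is_RInt_derive (fun t => u * t + v * (t * t) / 2) (fun t => u + t * v)).
  - intros t _. auto_derive; [easy|]. field.
  - intros t _. apply (continuous_plus (fun _ => u) (fun t => t * v)).
    + apply continuous_const.
    + apply (continuous_mult (fun t => t) (fun _ => v)).
      * apply continuous_id.
      * apply continuous_const.
Qed.

(** Affine functions are what differentiability subtracts in the local step of Goursat's theorem, so
    their integrals are computed explicitly. *)
Lemma Rint_affine (al be : C) (a b c d : R) :
  Rint (fun z => al + be * z)%C a b c d = RtoC 0.
Proof.
  unfold Rint, Hint, Vint, cint.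
  assert (EH1 : forall y, RInt (fun t => fst (al + be * (t, y))%C) a b
    = (fst al - snd be * y) * (b - a) + fst be * (b * b - a * a) / 2).
  { intros. rewrite <- RInt_affine. apply RInt_ext. intros. simpl. ring. }
  assert (EH2 : forall y, RInt (fun t => snd (al + be * (t, y))%C) a b
    = (snd al + fst be * y) * (b - a) + snd be * (b * b - a * a) / 2).
  { intros. rewrite <- RInt_affine. apply RInt_ext. intros. simpl. ring. }
  assert (EV1 : forall x, RInt (fun t => fst (al + be * (x, t))%C) c d
    = (fst al + fst be * x) * (d - c) + (- snd be) * (d * d - c * c) / 2).
  { intros. rewrite <- RInt_affine. apply RInt_ext. intros. simpl. ring. }
  assert (EV2 : forall x, RInt (fun t => snd (al + be * (x, t))%C) c d
    = (snd al + snd be * x) * (d - c) + fst be * (d * d - c * c) / 2).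
  { intros. rewrite <- RInt_affine. apply RInt_ext. intros. simpl. ring. }
  rewrite !EH1, !EH2, !EV1, !EV2. apply C_ext; simpl; field.
Qed.

Definition in_rect (a b c d : R) (z : C) : Prop := a <= fst z <= b /\ c <= snd z <= d.

Lemma Rint_plus g k a b c d : a <= b -> c <= d ->
  (forall z, in_rect a b c d z -> ccont g z) ->
  (forall z, in_rect a b c d z -> ccont k z) ->
  Rint (fun z => g z + k z)%C a b c d = (Rint g a b c d + Rint k a b c d)%C.
Proof.
  intros Hab Hcd Hg Hk. unfold Rint, Hint, Vint.
  rewrite !(cint_plus a b Hab), !(cint_plus c d Hcd); [ring|..];
  intros t Ht; (apply rcont_H || apply rcont_V); (apply Hg || apply Hk); split; simpl; lra.
Qed.

Lemma Rint_scal m g a b c d : a <= b -> c <= d ->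
  (forall z, in_rect a b c d z -> ccont g z) ->
  Rint (fun z => m * g z)%C a b c d = (m * Rint g a b c d)%C.
Proof.
  intros Hab Hcd Hg. unfold Rint, Hint, Vint.
  rewrite !(cint_scal a b Hab), !(cint_scal c d Hcd); [ring|..];
  intros t Ht; (apply rcont_H || apply rcont_V); apply Hg; split; simpl; lra.
Qed.

Lemma Rint_ext g k a b c d : a <= b -> c <= d ->
  (forall z, in_rect a b c d z -> g z = k z) -> Rint g a b c d = Rint k a b c d.
Proof.
  intros Hab Hcd H. unfold Rint, Hint, Vint.
  rewrite (cint_ext a b Hab (fun t => g (t, c)) (fun t => k (t, c))),
    (cint_ext a b Hab (fun t => g (t, d)) (fun t => k (t, d))),
    (cint_ext c d Hcd (fun t => g (a, t)) (fun t => k (a, t))),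
    (cint_ext c d Hcd (fun t => g (b, t)) (fun t => k (b, t))); [easy|..];
  intros t Ht; apply H; split; simpl; lra.
Qed.

Lemma Hint_bound g y a b M : a <= b ->
  (forall t, a <= t <= b -> ccont g (t, y)) ->
  (forall t, a <= t <= b -> Cmod (g (t, y)) <= M) ->
  Cmod (Hint g y a b) <= 2 * (M * (b - a)).
Proof. intros Hab Hc HM. apply cint_bound; auto. intros. apply rcont_H. auto. Qed.

Lemma Vint_bound g x c d M : c <= d ->
  (forall t, c <= t <= d -> ccont g (x, t)) ->
  (forall t, c <= t <= d -> Cmod (g (x, t)) <= M) ->
  Cmod (Vint g x c d) <= 2 * (M * (d - c)).
Proof.
  intros Hab Hc HM. unfold Vint. rewrite Cmod_mult, Cmod_Ci, Rmult_1_l.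
  apply cint_bound; auto. intros. apply rcont_V. auto.
Qed.

Lemma Rint_bound g a c s M : 0 <= s ->
  (forall z, in_rect a (a + s) c (c + s) z -> ccont g z) ->
  (forall z, in_rect a (a + s) c (c + s) z -> Cmod (g z) <= M) ->
  Cmod (Rint g a (a + s) c (c + s)) <= 8 * M * s.
Proof.
  intros Hs Hc HM. unfold Rint, Cminus.
  eapply Rle_trans; [apply Cmod_triangle|]. rewrite Cmod_opp.
  eapply Rle_trans; [apply Rplus_le_compat_r, Cmod_triangle|]. rewrite Cmod_opp.
  eapply Rle_trans; [apply Rplus_le_compat_r, Rplus_le_compat_r, Cmod_triangle|].
  assert (Cmod (Hint g c a (a + s)) <= 2 * (M * (a + s - a))).
  { apply Hint_bound; [lra| |]; intros; (apply Hc || apply HM); split; simpl; lra. }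
  assert (Cmod (Hint g (c + s) a (a + s)) <= 2 * (M * (a + s - a))).
  { apply Hint_bound; [lra| |]; intros; (apply Hc || apply HM); split; simpl; lra. }
  assert (Cmod (Vint g (a + s) c (c + s)) <= 2 * (M * (c + s - c))).
  { apply Vint_bound; [lra| |]; intros; (apply Hc || apply HM); split; simpl; lra. }
  assert (Cmod (Vint g a c (c + s)) <= 2 * (M * (c + s - c))).
  { apply Vint_bound; [lra| |]; intros; (apply Hc || apply HM); split; simpl; lra. }
  lra.
Qed.

Lemma Rint_split_x g a m b c d : a <= m -> m <= b -> c <= d ->
  (forall z, in_rect a b c d z -> ccont g z) ->
  Rint g a b c d = (Rint g a m c d + Rint g m b c d)%C.
Proof.
  intros H1 H2 H3 Hc. unfold Rint, Hint.
  rewrite <- (cint_Chasles _ a m b), <- (cint_Chasles _ a m b); [ring|..]; auto;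
  intros t Ht; apply rcont_H, Hc; split; simpl; lra.
Qed.

Lemma Rint_split_y g a b c m d : a <= b -> c <= m -> m <= d ->
  (forall z, in_rect a b c d z -> ccont g z) ->
  Rint g a b c d = (Rint g a b c m + Rint g a b m d)%C.
Proof.
  intros H1 H2 H3 Hc. unfold Rint, Vint.
  rewrite <- (cint_Chasles _ c m d), <- (cint_Chasles _ c m d); [ring|..]; auto;
  intros t Ht; apply rcont_V, Hc; split; simpl; lra.
Qed.

Lemma nested_halving (P : R -> R -> R -> Prop) (a0 c0 s0 : R) : 0 < s0 ->
  (forall a c s, 0 < s -> ~ P a c s ->
     ~ P a c (s / 2) \/ ~ P (a + s / 2) c (s / 2) \/ ~ P a (c + s / 2) (s / 2)
     \/ ~ P (a + s / 2) (c + s / 2) (s / 2)) ->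
  ~ P a0 c0 s0 ->
  exists u : nat -> R * R, forall n,
    ~ P (fst (u n)) (snd (u n)) (s0 / 2 ^ n) /\
    (u 0%nat = (a0, c0)) /\
    (fst (u n) <= fst (u (S n)) <= fst (u n) + s0 / 2 ^ (S n)) /\
    (snd (u n) <= snd (u (S n)) <= snd (u n) + s0 / 2 ^ (S n)).
Proof.
  intros Hs Hstep H0.
  (* The hypotheses come after the choice of [q], so that the selection function [nx] below is
     total. *)
  assert (Hnext : forall (p : R * R) s, exists q : R * R, 0 < s -> ~ P (fst p) (snd p) s ->
    ~ P (fst q) (snd q) (s / 2) /\ (fst p <= fst q <= fst p + s / 2) /\
    (snd p <= snd q <= snd p + s / 2)).
  { intros [a c] s. destruct (classic (0 < s /\ ~ P a c s)) as [[H1 H2]|H].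
    - destruct (Hstep a c s H1 H2) as [H|[H|[H|H]]].
      + exists (a, c). intros _ _. simpl. repeat split; auto; lra.
      + exists (a + s / 2, c). intros _ _. simpl. repeat split; auto; lra.
      + exists (a, c + s / 2). intros _ _. simpl. repeat split; auto; lra.
      + exists (a + s / 2, c + s / 2). intros _ _. simpl. repeat split; auto; lra.
    - exists (a, c). intros H1 H2. exfalso. apply H. auto. }
  set (nx := fun p s => proj1_sig (constructive_indefinite_description _ (Hnext p s))).
  assert (Hnx : forall p s, 0 < s -> ~ P (fst p) (snd p) s ->
    ~ P (fst (nx p s)) (snd (nx p s)) (s / 2) /\ (fst p <= fst (nx p s) <= fst p + s / 2) /\
    (snd p <= snd (nx p s) <= snd p + s / 2)).
  { intros p s. unfold nx. destruct constructive_indefinite_description. auto. }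
  exists (fix u n := match n with O => (a0, c0) | S m => nx (u m) (s0 / 2 ^ m) end).
  match goal with |- forall n, ~ P (fst (?f n)) _ _ /\ _ => set (u := f) end.
  assert (Hpos : forall n, 0 < s0 / 2 ^ n).
  { intros n. apply Rdiv_lt_0_compat; [easy|]. apply pow_lt. lra. }
  assert (HP : forall n, ~ P (fst (u n)) (snd (u n)) (s0 / 2 ^ n)).
  { induction n as [|n IH].
    - simpl. now replace (s0 / 1) with s0 by field.
    - replace (s0 / 2 ^ S n) with (s0 / 2 ^ n / 2).
      + apply (proj1 (Hnx (u n) _ (Hpos n) IH)).
      + simpl. field. apply pow_nonzero. lra. }
  intros n. split; [apply HP|]. split; [easy|].
  replace (s0 / 2 ^ S n) with (s0 / 2 ^ n / 2).
  - apply (proj2 (Hnx (u n) _ (Hpos n) (HP n))).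
  - simpl. field. apply pow_nonzero. lra.
Qed.

Lemma nested_limit (u : nat -> R) (s : R) : 0 <= s ->
  (forall n, u n <= u (S n) <= u n + s / 2 ^ (S n)) ->
  exists q, forall n, u n <= q <= u n + s / 2 ^ n.
Proof.
  intros Hs H.
  assert (Hpos : forall n, 0 < 2 ^ n) by (intros; apply pow_lt; lra).
  assert (Hup : forall n k, u n <= u (n + k)%nat).
  { intros n k. induction k as [|k IH]; [rewrite Nat.add_0_r; lra|].
    rewrite Nat.add_succ_r. destruct (H (n + k)%nat). lra. }
  assert (Hdn : forall n k, u (n + k)%nat + s / 2 ^ (n + k) <= u n + s / 2 ^ n).
  { intros n k. induction k as [|k IH]; [rewrite Nat.add_0_r; lra|].
    rewrite Nat.add_succ_r. destruct (H (n + k)%nat) as [_ H2].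
    replace (s / 2 ^ (n + k)) with (2 * (s / 2 ^ S (n + k))) in IH; [lra|].
    simpl. specialize (Hpos (n + k)%nat). field. lra. }
  assert (Hq : forall n, 0 <= s / 2 ^ n).
  { intros n. apply Rdiv_le_0_compat; auto. }
  assert (Hall : forall n m, u m <= u n + s / 2 ^ n).
  { intros n m. destruct (Nat.le_ge_cases n m) as [Hnm|Hnm].
    - replace m with (n + (m - n))%nat by lia. specialize (Hdn n (m - n)%nat).
      specialize (Hq (n + (m - n))%nat). lra.
    - replace n with (m + (n - m))%nat by lia. specialize (Hup m (n - m)%nat).
      specialize (Hq (m + (n - m))%nat). lra. }
  destruct (completeness (fun x => exists n, x = u n)) as [q [Hub Hlub]].
  - exists (u 0%nat + s / 2 ^ 0). intros x [n ->]. apply Hall.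
  - exists (u 0%nat), 0%nat. reflexivity.
  - exists q. intros n. split.
    + apply Hub. now exists n.
    + apply Hlub. intros x [m ->]. apply Hall.
Qed.

(** Cousin's lemma for squares: otherwise repeated halving gives failing squares that shrink to a
    point [q], against the local hypothesis at [q]. It serves Goursat's theorem and, with an idle
    second coordinate, integrals depending on a parameter ([RL_cint]). *)
Lemma square_cousin (P : R -> R -> R -> Prop) (a0 c0 s0 : R) : 0 < s0 ->
  (forall a c s, 0 < s -> a0 <= a -> a + s <= a0 + s0 -> c0 <= c -> c + s <= c0 + s0 ->
     P a c (s / 2) -> P (a + s / 2) c (s / 2) -> P a (c + s / 2) (s / 2) ->
     P (a + s / 2) (c + s / 2) (s / 2) -> P a c s) ->
  (forall q, in_rect a0 (a0 + s0) c0 (c0 + s0) q -> exists d, 0 < d /\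
     forall a c s, 0 < s < d -> a0 <= a -> a + s <= a0 + s0 -> c0 <= c -> c + s <= c0 + s0 ->
       in_rect a (a + s) c (c + s) q -> P a c s) ->
  P a0 c0 s0.
Proof.
  intros Hs Hadd Hloc. apply NNPP. intros HnP.
  set (ok := fun a c s => a0 <= a /\ a + s <= a0 + s0 /\ c0 <= c /\ c + s <= c0 + s0).
  (* Vacuous outside the initial square, so the halving need not record inclusions. *)
  set (P' := fun a c s => ok a c s -> P a c s).
  destruct (nested_halving P' a0 c0 s0 Hs) as [u Hu].
  - intros a c s Hs1 H. apply NNPP. intros Hno. apply H. intros Hok.
    destruct Hok as [K1 [K2 [K3 K4]]].
    apply Hadd; auto; apply NNPP; intros Hn; apply Hno.
    + left. intros F. apply Hn, F. unfold ok. lra.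
    + right; left. intros F. apply Hn, F. unfold ok. lra.
    + right; right; left. intros F. apply Hn, F. unfold ok. lra.
    + right; right; right. intros F. apply Hn, F. unfold ok. lra.
  - intros F. apply HnP, F. unfold ok. lra.
  - destruct (nested_limit (fun n => fst (u n)) s0) as [q1 Hq1]; [lra|intros; apply Hu|].
    destruct (nested_limit (fun n => snd (u n)) s0) as [q2 Hq2]; [lra|intros; apply Hu|].
    assert (E0 : u 0%nat = (a0, c0)) by apply (Hu 0%nat).
    destruct (Hloc (q1, q2)) as [d [Hd HP]].
    { specialize (Hq1 0%nat). specialize (Hq2 0%nat). rewrite E0 in Hq1, Hq2.
      simpl in Hq1, Hq2. replace (s0 / 1) with s0 in * by field. split; simpl; lra. }
    destruct (pow_lt_1_zero (/ 2)) with (y := d / s0) as [n Hn].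
    { rewrite Rabs_pos_eq; lra. }
    { apply Rdiv_lt_0_compat; lra. }
    specialize (Hn n (le_n n)).
    assert (Hp : 0 < s0 / 2 ^ n < d).
    { assert (0 < 2 ^ n) by (apply pow_lt; lra). split; [apply Rdiv_lt_0_compat; lra|].
      rewrite pow_inv, Rabs_pos_eq in Hn by (left; apply Rinv_0_lt_compat; lra).
      apply (Rmult_lt_compat_l s0) in Hn; [|easy].
      replace (s0 * (d / s0)) with d in Hn by (field; lra). exact Hn. }
    destruct (Hu n) as [HN _]. apply HN. intros [K1 [K2 [K3 K4]]].
    apply HP; auto. split; simpl; auto.
Qed.

(** The signed square root of t - p, a primitive of 1 / (2 sqrt |t - p|). It is increasing, and so
    steep at [p] that an interval containing [p] receives at least the square root of its length
    ([sroot_gap]). *)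
Definition sroot (p t : R) : R := if Rle_dec p t then sqrt (t - p) else - sqrt (p - t).

Lemma sroot_mono p a b : a <= b -> sroot p a <= sroot p b.
Proof.
  intros H. unfold sroot. destruct (Rle_dec p a), (Rle_dec p b); try lra.
  - apply sqrt_le_1_alt. lra.
  - pose proof (sqrt_pos (p - a)). pose proof (sqrt_pos (b - p)). lra.
  - apply Ropp_le_contravar, sqrt_le_1_alt. lra.
Qed.

Lemma sroot_gap p a b : a <= p <= b -> sqrt (b - a) <= sroot p b - sroot p a.
Proof.
  intros H. assert (E : sqrt (b - a) <= sqrt (b - p) + sqrt (p - a)).
  { pose proof (sqrt_pos (b - p)). pose proof (sqrt_pos (p - a)).
    rewrite <- (sqrt_square (sqrt (b - p) + sqrt (p - a))) by lra.
    apply sqrt_le_1_alt.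
    pose proof (sqrt_sqrt (b - p)). pose proof (sqrt_sqrt (p - a)). nra. }
  unfold sroot. destruct (Rle_dec p b); [|lra]. destruct (Rle_dec p a).
  - replace a with p in * by lra. replace (p - p) with 0 in * by ring. rewrite sqrt_0 in *. lra.
  - lra.
Qed.

Lemma in_rect_Cmod a c s z q : in_rect a (a + s) c (c + s) z ->
  in_rect a (a + s) c (c + s) q -> Cmod (z - q) <= 2 * s.
Proof.
  intros [H1 H2] [H3 H4]. apply Cmod_le_parts; apply Rabs_le; simpl; lra.
Qed.

(* The bound |Rint| <= eps * (area + nu) is additive under bisection; nu is the product measure
   d(sroot) x d(sroot), which charges every square of side s containing p with at least s, so
   that mere continuity at p is enough there. *)
Lemma Goursat (g : C -> C) (p : C) (a c s : R) : 0 < s ->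
  (forall z, in_rect a (a + s) c (c + s) z -> ccont g z) ->
  (forall z, in_rect a (a + s) c (c + s) z -> z <> p -> C_differentiable_at g z) ->
  Rint g a (a + s) c (c + s) = RtoC 0.
Proof.
  intros Hs Hc Hd.
  set (nu := fun a c s => (sroot (fst p) (a + s) - sroot (fst p) a) *
                          (sroot (snd p) (c + s) - sroot (snd p) c)).
  assert (nu_pos : forall a c s, 0 <= s -> 0 <= nu a c s).
  { intros a' c' s' H. unfold nu. apply Rmult_le_pos.
    - pose proof (sroot_mono (fst p) a' (a' + s')). lra.
    - pose proof (sroot_mono (snd p) c' (c' + s')). lra. }
  assert (Main : forall eps, 0 < eps ->
    Cmod (Rint g a (a + s) c (c + s)) <= eps * (s * s + nu a c s)).
  { intros eps He.
    apply (square_cousin (fun a c s => Cmod (Rint g a (a + s) c (c + s)) <= eps * (s * s + nu a c s))); auto.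
    - intros a' c' s' Hs' A1 A2 A3 A4 H1 H2 H3 H4.
      assert (Hc' : forall z, in_rect a' (a' + s') c' (c' + s') z -> ccont g z).
      { intros z [B1 B2]. apply Hc. split; lra. }
      rewrite (Rint_split_x g a' (a' + s' / 2) (a' + s')) by (auto; lra).
      rewrite (Rint_split_y g a' (a' + s' / 2) c' (c' + s' / 2) (c' + s'));
        [|lra..|intros z [B1 B2]; apply Hc'; split; lra].
      rewrite (Rint_split_y g (a' + s' / 2) (a' + s') c' (c' + s' / 2) (c' + s'));
        [|lra..|intros z [B1 B2]; apply Hc'; split; lra].
      replace (a' + s' / 2 + s' / 2) with (a' + s') in * by field.
      replace (c' + s' / 2 + s' / 2) with (c' + s') in * by field.
      eapply Rle_trans; [apply Cmod_triangle|].
      eapply Rle_trans; [apply Rplus_le_compat; apply Cmod_triangle|].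
      eapply Rle_trans; [apply Rplus_le_compat; apply Rplus_le_compat; eassumption|].
      right. unfold nu.
      replace (a' + s' / 2 + s' / 2) with (a' + s') in * by field.
      replace (c' + s' / 2 + s' / 2) with (c' + s') in * by field. field.
    - intros q Hq. destruct (classic (q = p)) as [->|Hqp].
      + destruct (Hc p Hq (eps / 8)) as [d [Hd1 H1]]; [lra|].
        exists (d / 4). split; [lra|]. intros a' c' s' Hs' A1 A2 A3 A4 Hin.
        assert (Hc' : forall z, in_rect a' (a' + s') c' (c' + s') z -> ccont g z).
        { intros z [B1 B2]. apply Hc. split; lra. }
        rewrite (Rint_ext g (fun z => g z - g p + (g p + RtoC 0 * z))%C); [|lra|lra|intros; ring].
        rewrite Rint_plus; [|lra|lra| |].
        2: { intros. apply ccont_minus; [auto|apply ccont_const]. }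
        2: { intros. apply ccont_plus; [apply ccont_const|].
             apply ccont_mult; [apply ccont_const|apply ccont_id]. }
        rewrite Rint_affine, Cplus_0_r.
        eapply Rle_trans; [apply Rint_bound with (M := eps / 8)|].
        * lra.
        * intros. apply ccont_minus; [auto|apply ccont_const].
        * intros z Hz. left. apply H1. pose proof (in_rect_Cmod _ _ _ _ _ Hz Hin). lra.
        * assert (s' <= nu a' c' s').
          { unfold nu. destruct Hin as [B1 B2].
            rewrite <- (sqrt_sqrt s') at 1 by lra.
            apply Rmult_le_compat; try apply sqrt_pos.
            - replace s' with (a' + s' - a') at 1 by ring. apply sroot_gap; lra.
            - replace s' with (c' + s' - c') at 1 by ring. apply sroot_gap; lra. }
          assert (0 <= s' * s') by nra. nra.
      + destruct (C_differentiable_expand g q (Hd q Hq Hqp)) as [l Hl].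
        destruct (Hl (eps / 16)) as [d [Hd1 H1]]; [lra|].
        exists (d / 4). split; [lra|]. intros a' c' s' Hs' A1 A2 A3 A4 Hin.
        assert (Hc' : forall z, in_rect a' (a' + s') c' (c' + s') z -> ccont g z).
        { intros z [B1 B2]. apply Hc. split; lra. }
        rewrite (Rint_ext g (fun z => (g z - g q - l * (z - q)) + ((g q - l * q) + l * z))%C);
          [|lra|lra|intros; ring].
        rewrite Rint_plus; [|lra|lra| |].
        2: { intros. apply ccont_minus; [apply ccont_minus; [auto|apply ccont_const]|].
             apply ccont_mult; [apply ccont_const|].
             apply ccont_minus; [apply ccont_id|apply ccont_const]. }
        2: { intros. apply ccont_plus; [apply ccont_const|].
             apply ccont_mult; [apply ccont_const|apply ccont_id]. }
        rewrite Rint_affine, Cplus_0_r.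
        (* The remainder is at most eps / 16 times |z - q| <= 2 s', and 8 * (eps / 16 * 2 s') * s'
           is eps * s'^2, the area term. *)
        eapply Rle_trans; [apply Rint_bound with (M := eps / 16 * (2 * s'))|].
        * lra.
        * intros. apply ccont_minus; [apply ccont_minus; [auto|apply ccont_const]|].
          apply ccont_mult; [apply ccont_const|].
          apply ccont_minus; [apply ccont_id|apply ccont_const].
        * intros z Hz. pose proof (in_rect_Cmod _ _ _ _ _ Hz Hin).
          eapply Rle_trans; [apply H1; lra|]. apply Rmult_le_compat_l; lra.
        * specialize (nu_pos a' c' s'). nra. }
  apply Cmod_eq_0. apply Rle_antisym; [|apply Cmod_ge_0].
  apply Rnot_lt_le. intros Hlt. set (B := s * s + nu a c s) in *.
  assert (HB : 0 < B). { unfold B. specialize (nu_pos a c s). nra. }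
  (* This value of eps turns the bound into |Rint| <= |Rint| / 2. *)
  specialize (Main (Cmod (Rint g a (a + s) c (c + s)) / (2 * B))).
  assert (E : Cmod (Rint g a (a + s) c (c + s)) / (2 * B) * B
     = Cmod (Rint g a (a + s) c (c + s)) / 2) by (field; lra).
  rewrite E in Main.
  assert (0 < Cmod (Rint g a (a + s) c (c + s)) / (2 * B)) by (apply Rdiv_lt_0_compat; lra).
  lra.
Qed.

(** * Complex derivatives in division-free form *)

Definition cderiv (f : C -> C) (z l : C) : Prop :=
  forall eps, 0 < eps -> exists d, 0 < d /\
    forall w, Cmod (w - z) < d ->
      Cmod (f w - f z - l * (w - z)) <= eps * Cmod (w - z).

Lemma cderiv_differentiable f z l : cderiv f z l -> C_differentiable_at f z.
Proof.
  intros H. exists l. intros e He. destruct (H (e / 2)) as [d [Hd Hw]]; [lra|].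
  exists d. split; [easy|].
  enough (G : forall h : C, h <> RtoC 0 -> Cmod h < d ->
    Cmod ((f (z + h)%C - f z) * / h - l)%C < e).
  { intros h Hh Hlt. rewrite Cnorm_Cmod in *. unfold Cdiv. rewrite Cinv_Complex. now apply G. }
  intros h Hh Hlt.
  specialize (Hw (z + h)%C). replace (z + h - z)%C with h in Hw by ring.
  specialize (Hw Hlt).
  assert (P : 0 < Cmod h) by now apply Cmod_gt_0.
  apply Rmult_lt_reg_r with (Cmod h); [easy|]. rewrite <- Cmod_mult.
  replace (((f (z + h) - f z) * / h - l) * h)%C with (f (z + h) - f z - l * h)%C
    by (field; exact Hh).
  nra.
Qed.

Lemma cderiv_ccont f z l : cderiv f z l -> ccont f z.
Proof. intros H. eapply C_differentiable_ccont, cderiv_differentiable, H. Qed.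

Lemma cderiv_minus_const f z l c : cderiv f z l -> cderiv (fun w => f w - c)%C z l.
Proof.
  intros H e He. destruct (H e He) as [d [Hd Hw]]. exists d. split; [easy|].
  intros w Hlt. replace (f w - c - (f z - c) - l * (w - z))%C
    with (f w - f z - l * (w - z))%C by ring. auto.
Qed.

Lemma cderiv_mult f g z l m : cderiv f z l -> cderiv g z m ->
  cderiv (fun w => f w * g w)%C z (l * g z + f z * m)%C.
Proof.
  intros Hf Hg e He. pose proof (cderiv_ccont _ _ _ Hg) as Hc.
  pose proof (Cmod_ge_0 l) as Pl. pose proof (Cmod_ge_0 (g z)) as Pg.
  pose proof (Cmod_ge_0 (f z)) as Pf.
  set (K := Cmod l + Cmod (g z) + Cmod (f z) + 1).
  assert (HK : 0 < e / K) by (apply Rdiv_lt_0_compat; unfold K; lra).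
  destruct (Hf (e / K) HK) as [d1 [Hd1 H1]]. destruct (Hg (e / K) HK) as [d2 [Hd2 H2]].
  destruct (Hc (Rmin 1 (e / K))) as [d3 [Hd3 H3]]; [apply Rmin_glb_lt; lra|].
  exists (Rmin d1 (Rmin d2 d3)). split; [repeat apply Rmin_glb_lt; auto|].
  intros w Hw.
  assert (A1 : Cmod (w - z) < d1) by (eapply Rlt_le_trans; [exact Hw|apply Rmin_l]).
  assert (A2 : Cmod (w - z) < d2).
  { eapply Rlt_le_trans; [exact Hw|]. eapply Rle_trans; [apply Rmin_r|apply Rmin_l]. }
  assert (A3 : Cmod (w - z) < d3).
  { eapply Rlt_le_trans; [exact Hw|]. eapply Rle_trans; [apply Rmin_r|apply Rmin_r]. }
  specialize (H1 w A1). specialize (H2 w A2). specialize (H3 w A3).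
  assert (B1 : Cmod (g w - g z) < 1) by (eapply Rlt_le_trans; [exact H3|apply Rmin_l]).
  assert (B2 : Cmod (g w - g z) < e / K) by (eapply Rlt_le_trans; [exact H3|apply Rmin_r]).
  assert (B3 : Cmod (g w) <= Cmod (g z) + 1) by (pose proof (Cmod_le_add (g w) (g z)); lra).
  replace (f w * g w - f z * g z - (l * g z + f z * m) * (w - z))%C
    with ((f w - f z - l * (w - z)) * g w + l * (w - z) * (g w - g z)
          + f z * (g w - g z - m * (w - z)))%C by ring.
  eapply Rle_trans; [apply Cmod_triangle|].
  eapply Rle_trans; [apply Rplus_le_compat_r, Cmod_triangle|].
  rewrite !Cmod_mult. pose proof (Cmod_ge_0 (w - z)) as Pw.
  assert (E : e = e / K * K) by (field; unfold K; lra).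
  set (x := Cmod (w - z)) in *. set (k := e / K) in *.
  pose proof (Cmod_ge_0 (g w)). pose proof (Cmod_ge_0 (g w - g z)).
  assert (Cmod (f w - f z - l * (w - z)) * Cmod (g w) <= k * x * (Cmod (g z) + 1)).
  { apply Rmult_le_compat; auto. apply Cmod_ge_0. }
  assert (Cmod l * x * Cmod (g w - g z) <= Cmod l * x * k).
  { apply Rmult_le_compat_l; [nra|lra]. }
  assert (Cmod (f z) * Cmod (g w - g z - m * (w - z)) <= Cmod (f z) * (k * x)).
  { apply Rmult_le_compat_l; lra. }
  rewrite E. unfold K. lra.
Qed.

Lemma cderiv_inv_sub (a z : C) : z <> a ->
  cderiv (fun w => / (w - a))%C z (- (/ (z - a) * / (z - a)))%C.
Proof.
  intros Hz e He. assert (Hn : (z - a)%C <> RtoC 0) by now apply Cminus_neq_0.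
  assert (P : 0 < Cmod (z - a)) by now apply Cmod_gt_0.
  set (r := Cmod (z - a)) in *.
  exists (Rmin (r / 2) (e * (r * r * r) / 2)). split.
  { apply Rmin_glb_lt; [lra|]. assert (0 < r * r * r) by (apply Rmult_lt_0_compat; nra). nra. }
  intros w Hw.
  assert (A1 : Cmod (w - z) < r / 2) by (eapply Rlt_le_trans; [exact Hw|apply Rmin_l]).
  assert (A2 : Cmod (w - z) < e * (r * r * r) / 2) by (eapply Rlt_le_trans; [exact Hw|apply Rmin_r]).
  assert (Pw : r / 2 < Cmod (w - a)).
  { pose proof (Cmod_dist_triangle z w a). rewrite (Cmod_minus_sym z w) in H. fold r in H. lra. }
  assert (Hwn : (w - a)%C <> RtoC 0).
  { intros E. rewrite E, Cmod_0 in Pw. lra. }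
  replace (/ (w - a) - / (z - a) - - (/ (z - a) * / (z - a)) * (w - z))%C
    with ((w - z) * (w - z) / ((w - a) * ((z - a) * (z - a))))%C by (field; auto).
  rewrite Cmod_div by (repeat apply Cmult_neq_0; auto).
  rewrite !Cmod_mult. fold r. pose proof (Cmod_ge_0 (w - z)) as Q.
  set (x := Cmod (w - z)) in *.
  assert (D : 0 < Cmod (w - a) * (r * r)) by (apply Rmult_lt_0_compat; nra).
  apply Rle_div_l; [easy|].
  assert (x * x <= e * (r * r * r) / 2 * x) by nra.
  assert (r / 2 * (r * r) <= Cmod (w - a) * (r * r)) by (apply Rmult_le_compat_r; nra).
  assert (e * x * (r / 2 * (r * r)) <= e * x * (Cmod (w - a) * (r * r))).
  { apply Rmult_le_compat_l; [nra|easy]. }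
  nra.
Qed.

Lemma cderiv_local f g z l r : 0 < r -> (forall w, Cmod (w - z) < r -> f w = g w) ->
  cderiv f z l -> cderiv g z l.
Proof.
  intros Hr E H e He. destruct (H e He) as [d [Hd Hw]].
  exists (Rmin d r). split; [now apply Rmin_glb_lt|]. intros w Hlt.
  rewrite <- !E; auto.
  - apply Hw. eapply Rlt_le_trans; [exact Hlt|apply Rmin_l].
  - replace (z - z)%C with (RtoC 0) by ring. now rewrite Cmod_0.
  - eapply Rlt_le_trans; [exact Hlt|apply Rmin_r].
Qed.

Lemma differentiable_cderiv f z : C_differentiable_at f z -> exists l, cderiv f z l.
Proof. exact (C_differentiable_expand f z). Qed.

(** * The winding number of a rectangle *)

Lemma RInt_FTC (F f : R -> R) (a b : R) :
  (forall t, is_derive F t (f t)) -> (forall t, continuous f t) ->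
  RInt f a b = F b - F a.
Proof.
  intros H1 H2. apply is_RInt_unique.
  apply (is_RInt_derive (V := R_CompleteNormedModule) F f); auto.
Qed.

Lemma sumsq_pos (x q : R) : q <> 0 -> 0 < x ^ 2 + q ^ 2.
Proof. intros H. assert (0 < q * q) by nra. nra. Qed.

Lemma RInt_ln_kernel (x q a b : R) : q <> 0 ->
  RInt (fun t => (t - x) / ((t - x) ^ 2 + q ^ 2)) a b =
  ln ((b - x) ^ 2 + q ^ 2) / 2 - ln ((a - x) ^ 2 + q ^ 2) / 2.
Proof.
  intros Hq. apply (RInt_FTC (fun t => ln ((t - x) ^ 2 + q ^ 2) / 2)).
  - intros t. pose proof (sumsq_pos (t - x) q Hq). auto_derive; [lra|]. field. lra.
  - intros t. pose proof (sumsq_pos (t - x) q Hq).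
    apply (ex_derive_continuous (V := R_NormedModule)). auto_derive. lra.
Qed.

Lemma is_derive_atan_kernel (x q t D : R) : q <> 0 -> D = (t - x) ^ 2 + q ^ 2 ->
  is_derive (fun s => atan ((s - x) / q)) t (q / D).
Proof.
  intros Hq ->. pose proof (sumsq_pos (t - x) q Hq).
  auto_derive; auto. field. repeat split; auto; unfold Rsqr; try nra; lra.
Qed.

Lemma RInt_atan_kernel (x q a b : R) : q <> 0 ->
  RInt (fun t => - q / ((t - x) ^ 2 + q ^ 2)) a b = atan ((a - x) / q) - atan ((b - x) / q).
Proof.
  intros Hq. assert (E : forall u, u / q = - (u / - q)) by (intros; field; lra).
  rewrite (E (a - x)), (E (b - x)), !atan_opp.
  transitivity (atan ((b - x) / - q) - atan ((a - x) / - q)); [|match goal with |- @eq _ ?u ?v => change (@eq R u v) end; ring].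
  apply (RInt_FTC (fun t => atan ((t - x) / - q))).
  - intros t. apply is_derive_atan_kernel; [lra|ring].
  - intros t. pose proof (sumsq_pos (t - x) q Hq).
    apply (ex_derive_continuous (V := R_NormedModule)). auto_derive. lra.
Qed.

Lemma RInt_ln_kernel_swap (x q a b : R) : q <> 0 ->
  RInt (fun t => - (t - x) / (q ^ 2 + (t - x) ^ 2)) a b =
  - (ln ((b - x) ^ 2 + q ^ 2) / 2 - ln ((a - x) ^ 2 + q ^ 2) / 2).
Proof.
  intros Hq. transitivity (- (ln ((b - x) ^ 2 + q ^ 2) / 2) - - (ln ((a - x) ^ 2 + q ^ 2) / 2)); [|match goal with |- @eq _ ?u ?v => change (@eq R u v) end; ring].
  apply (RInt_FTC (fun t => - (ln ((t - x) ^ 2 + q ^ 2) / 2))).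
  - intros t. pose proof (sumsq_pos (t - x) q Hq). auto_derive; [lra|]. field. lra.
  - intros t. pose proof (sumsq_pos (t - x) q Hq).
    apply (ex_derive_continuous (V := R_NormedModule)). auto_derive. lra.
Qed.

Lemma RInt_atan_kernel_swap (x q a b : R) : q <> 0 ->
  RInt (fun t => q / (q ^ 2 + (t - x) ^ 2)) a b = atan ((b - x) / q) - atan ((a - x) / q).
Proof.
  intros Hq. apply (RInt_FTC (fun t => atan ((t - x) / q))).
  - intros t. pose proof (sumsq_pos (t - x) q Hq). apply is_derive_atan_kernel; auto; lra.
  - intros t. pose proof (sumsq_pos (t - x) q Hq).
    apply (ex_derive_continuous (V := R_NormedModule)). auto_derive. lra.
Qed.

Lemma atan_complement u v : 0 < u -> 0 < v -> atan (u / v) + atan (v / u) = PI / 2.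
Proof.
  intros Hu Hv. replace (v / u) with (/ (u / v)) by (field; lra).
  rewrite atan_inv by (apply Rdiv_lt_0_compat; lra). ring.
Qed.

(** Real and imaginary parts of 1 / (w - z) on a side have a logarithm and an arctangent as
    primitives. The logarithms cancel at the corners; the eight arctangents pair up, one pair per
    corner, into four right angles. *)
Lemma Rint_winding (z : C) (a b c d : R) : a < fst z < b -> c < snd z < d ->
  Rint (fun w => / (w - z))%C a b c d = (RtoC (2 * PI) * Ci)%C.
Proof.
  destruct z as [x y]. simpl. intros Hx Hy. unfold Rint, Hint, Vint, cint.
  assert (E1 : forall q, q - y <> 0 -> RInt (fun t => fst (/ ((t, q) - (x, y)))%C) a b
     = ln ((b - x) ^ 2 + (q - y) ^ 2) / 2 - ln ((a - x) ^ 2 + (q - y) ^ 2) / 2).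
  { intros q Hq. rewrite <- RInt_ln_kernel by easy. reflexivity. }
  assert (E2 : forall q, q - y <> 0 -> RInt (fun t => snd (/ ((t, q) - (x, y)))%C) a b
     = atan ((a - x) / (q - y)) - atan ((b - x) / (q - y))).
  { intros q Hq. rewrite <- RInt_atan_kernel by easy. reflexivity. }
  assert (E3 : forall q, q - x <> 0 -> RInt (fun t => fst (/ ((q, t) - (x, y)))%C) c d
     = atan ((d - y) / (q - x)) - atan ((c - y) / (q - x))).
  { intros q Hq. rewrite <- RInt_atan_kernel_swap by easy. reflexivity. }
  assert (E4 : forall q, q - x <> 0 -> RInt (fun t => snd (/ ((q, t) - (x, y)))%C) c d
     = - (ln ((d - y) ^ 2 + (q - x) ^ 2) / 2 - ln ((c - y) ^ 2 + (q - x) ^ 2) / 2)).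
  { intros q Hq. rewrite <- RInt_ln_kernel_swap by easy. reflexivity. }
  rewrite !E1, !E2, !E3, !E4 by lra.
  rewrite !(Rplus_comm ((d - y) ^ 2)), !(Rplus_comm ((c - y) ^ 2)).
  assert (S1 : (b - x) / (c - y) = - ((b - x) / (y - c))) by (field; lra).
  assert (S2 : (a - x) / (c - y) = (x - a) / (y - c)) by (field; lra).
  assert (S3 : (a - x) / (d - y) = - ((x - a) / (d - y))) by (field; lra).
  assert (S4 : (c - y) / (b - x) = - ((y - c) / (b - x))) by (field; lra).
  assert (S5 : (d - y) / (a - x) = - ((d - y) / (x - a))) by (field; lra).
  assert (S6 : (c - y) / (a - x) = (y - c) / (x - a)) by (field; lra).
  rewrite S1, S2, S3, S4, S5, S6, !atan_opp.
  pose proof (atan_complement (b - x) (y - c)). pose proof (atan_complement (x - a) (y - c)).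
  pose proof (atan_complement (b - x) (d - y)). pose proof (atan_complement (x - a) (d - y)).
  apply C_ext; simpl.
  - field.
  - lra.
Qed.

(** * Weighted sums of boundary integrals over a square grid *)

Section Grid.
Variables (o : C) (h : R) (M : nat).
Hypothesis Hh : 0 < h.

Definition gx (m : nat) : R := fst o + INR m * h.
Definition gy (n : nat) : R := snd o + INR n * h.

Lemma gx_S m : gx (S m) = gx m + h.
Proof. unfold gx. rewrite S_INR. ring. Qed.

Lemma gy_S m : gy (S m) = gy m + h.
Proof. unfold gy. rewrite S_INR. ring. Qed.

Definition hh (g : C -> C) (m n : nat) : C := Hint g (gy n) (gx m) (gx (S m)).
Definition vv (g : C -> C) (m n : nat) : C := Vint g (gx m) (gy n) (gy (S n)).
Definition Sq (g : C -> C) (m n : nat) : C := Rint g (gx m) (gx (S m)) (gy n) (gy (S n)).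

Definition hedge (m n : nat) (z : C) : Prop := gx m <= fst z <= gx (S m) /\ snd z = gy n.
Definition vedge (m n : nat) (z : C) : Prop := fst z = gx m /\ gy n <= snd z <= gy (S n).
Definition square (m n : nat) (z : C) : Prop :=
  in_rect (gx m) (gx (S m)) (gy n) (gy (S n)) z.

Definition AA (phi : nat -> nat -> R) (g : C -> C) : C :=
  Sum (seq 0 M) (fun m => Sum (seq 0 M) (fun n => RtoC (phi m n) * Sq g m n))%C.

(** Up to a constant factor, a discrete form of the area integral of [g] times the dbar derivative
    of the weight: an edge is counted with the jump of [phi] across it. *)
Definition EE (phi : nat -> nat -> R) (g : C -> C) : C :=
  Sum (seq 0 M) (fun m => Sum (seq 0 M) (fun n =>
    RtoC (phi m (S n) - phi m n) * hh g m (S n)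
    - RtoC (phi (S m) n - phi m n) * vv g (S m) n))%C.

Definition border (phi : nat -> nat -> R) : Prop :=
  forall k, phi 0%nat k = 0 /\ phi M k = 0 /\ phi k 0%nat = 0 /\ phi k M = 0.

(** The edges that [EE] reads. Elsewhere [g] may be singular, and the linearity and bound of [EE]
    ask for continuity of [g] here only. *)
Definition active (phi : nat -> nat -> R) (z : C) : Prop :=
  exists m n, (m < M)%nat /\ (n < M)%nat /\
    ((phi m (S n) <> phi m n /\ hedge m (S n) z) \/
     (phi (S m) n <> phi m n /\ vedge (S m) n z)).

(** An inner edge belongs to two squares with opposite orientations, hence is counted with the jump
    of the weight; since the weight vanishes along the border, no outer edge survives. Formally this
    is [Sum_Abel] in each variable. *)
Lemma AA_EE phi g : border phi -> AA phi g = EE phi g.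
Proof.
  intros Hb. unfold AA, EE.
  transitivity (Sum (seq 0 M) (fun m => Sum (seq 0 M) (fun n =>
      RtoC (phi m n) * (hh g m n - hh g m (S n)))) -
    Sum (seq 0 M) (fun n => Sum (seq 0 M) (fun m =>
      RtoC (phi m n) * (vv g m n - vv g (S m) n))))%C.
  { rewrite (Sum_swap (seq 0 M) (seq 0 M) (fun n m => RtoC (phi m n) * _)%C).
    rewrite <- Sum_minus. apply Sum_ext. intros m _. rewrite <- Sum_minus.
    apply Sum_ext. intros n _. unfold Sq, Rint, hh, vv. ring. }
  transitivity (Sum (seq 0 M) (fun m => Sum (seq 0 M) (fun n =>
      RtoC (phi m (S n) - phi m n) * hh g m (S n))) -
    Sum (seq 0 M) (fun n => Sum (seq 0 M) (fun m =>
      RtoC (phi (S m) n - phi m n) * vv g (S m) n)))%C.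
  - apply (f_equal2 Cminus); apply Sum_ext; intros k _.
    + rewrite (Sum_Abel M (fun n => RtoC (phi k n)) (fun n => hh g k n)).
      * apply Sum_ext. intros n _. now rewrite RtoC_minus.
      * f_equal. apply Hb.
      * f_equal. apply Hb.
    + rewrite (Sum_Abel M (fun n => RtoC (phi n k)) (fun n => vv g n k)).
      * apply Sum_ext. intros n _. now rewrite RtoC_minus.
      * f_equal. apply Hb.
      * f_equal. apply Hb.
  - rewrite (Sum_swap (seq 0 M) (seq 0 M) (fun n m => RtoC (phi (S m) n - phi m n) * _)%C).
    rewrite <- Sum_minus. apply Sum_ext. intros m _. now rewrite <- Sum_minus.
Qed.

Lemma edge_le : forall m, gx m <= gx (S m) /\ gy m <= gy (S m).
Proof. intros m. rewrite gx_S, gy_S. lra. Qed.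

Lemma hedge_pt m n t : gx m <= t <= gx (S m) -> hedge m n (t, gy n).
Proof. split; simpl; auto. Qed.

Lemma vedge_pt m n t : gy n <= t <= gy (S n) -> vedge m n (gx m, t).
Proof. split; simpl; auto. Qed.

Lemma EE_edgewise (phi : nat -> nat -> R) (g k : C -> C) :
  (forall m n, (m < M)%nat -> (n < M)%nat -> phi m (S n) <> phi m n -> hh g m (S n) = hh k m (S n)) ->
  (forall m n, (m < M)%nat -> (n < M)%nat -> phi (S m) n <> phi m n -> vv g (S m) n = vv k (S m) n) ->
  EE phi g = EE phi k.
Proof.
  intros H1 H2. unfold EE. apply Sum_ext. intros m Hm. apply Sum_ext. intros n Hn.
  apply in_seq in Hm. apply in_seq in Hn. apply (f_equal2 Cminus).
  - destruct (classic (phi m (S n) = phi m n)) as [->|E].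
    + replace (phi m n - phi m n) with 0 by ring. ring.
    + rewrite H1; auto; lia.
  - destruct (classic (phi (S m) n = phi m n)) as [->|E].
    + replace (phi m n - phi m n) with 0 by ring. ring.
    + rewrite H2; auto; lia.
Qed.

Lemma EE_ext phi g k : (forall z, active phi z -> g z = k z) -> EE phi g = EE phi k.
Proof.
  intros H. apply EE_edgewise.
  - intros m n Hm Hn E. apply cint_ext; [apply edge_le|]. intros t Ht. apply H.
    exists m, n. repeat split; auto. left. split; [auto|apply hedge_pt; exact Ht].
  - intros m n Hm Hn E. unfold vv, Vint. f_equal. apply cint_ext; [apply edge_le|].
    intros t Ht. apply H. exists m, n. repeat split; auto. right. split; [auto|apply vedge_pt; exact Ht].
Qed.

Lemma EE_lin phi g k (c : C) :
  (forall z, active phi z -> ccont g z) -> (forall z, active phi z -> ccont k z) ->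
  EE phi (fun z => g z + c * k z)%C = (EE phi g + c * EE phi k)%C.
Proof.
  intros Hg Hk. unfold EE. rewrite <- Sum_scal, <- Sum_plus. apply Sum_ext. intros m Hm.
  rewrite <- Sum_scal, <- Sum_plus. apply Sum_ext. intros n Hn.
  apply in_seq in Hm. apply in_seq in Hn.
  assert (A : (RtoC (phi m (S n) - phi m n) * hh (fun z => g z + c * k z) m (S n)
     = RtoC (phi m (S n) - phi m n) * (hh g m (S n) + c * hh k m (S n)))%C).
  { destruct (classic (phi m (S n) = phi m n)) as [->|E].
    - replace (phi m n - phi m n) with 0 by ring. ring.
    - f_equal. unfold hh, Hint.
      assert (HA : forall t, gx m <= t <= gx (S m) -> active phi (t, gy (S n))).
      { intros t Ht. exists m, n. repeat split; try lia. left. split; auto. apply hedge_pt; exact Ht. }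
      rewrite (cint_plus _ _ (proj1 (edge_le m)) (fun t => g (t, gy (S n))) (fun t => c * k (t, gy (S n)))%C).
      + f_equal. apply (cint_scal _ _ (proj1 (edge_le m)) c (fun t => k (t, gy (S n)))).
        intros. apply rcont_H. auto.
      + intros. apply rcont_H. auto.
      + intros. apply (rcont_H (fun z => c * k z)%C). apply ccont_mult; [apply ccont_const|auto]. }
  assert (B : (RtoC (phi (S m) n - phi m n) * vv (fun z => g z + c * k z) (S m) n
     = RtoC (phi (S m) n - phi m n) * (vv g (S m) n + c * vv k (S m) n))%C).
  { destruct (classic (phi (S m) n = phi m n)) as [->|E].
    - replace (phi m n - phi m n) with 0 by ring. ring.
    - f_equal. unfold vv, Vint.
      assert (HA : forall t, gy n <= t <= gy (S n) -> active phi (gx (S m), t)).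
      { intros t Ht. exists m, n. repeat split; try lia. right. split; auto. apply vedge_pt; exact Ht. }
      rewrite (cint_plus _ _ (proj2 (edge_le n)) (fun t => g (gx (S m), t)) (fun t => c * k (gx (S m), t))%C).
      + rewrite (cint_scal _ _ (proj2 (edge_le n)) c (fun t => k (gx (S m), t))); [ring|].
        intros. apply rcont_V. auto.
      + intros. apply rcont_V. auto.
      + intros. apply (rcont_V (fun z => c * k z)%C). apply ccont_mult; [apply ccont_const|auto]. }
  rewrite A, B. ring.
Qed.

(** [D] bounds jump times value edge by edge, so a kernel can be summed according to its distance
    from the singularity. Each index pair accounts for two edges, each with the factor 2 h of
    [Hint_bound] and [Vint_bound]. *)
Lemma EE_bound phi g (D : nat -> nat -> R) :
  (forall z, active phi z -> ccont g z) ->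
  (forall m n, (m < M)%nat -> (n < M)%nat -> 0 <= D m n) ->
  (forall m n z, (m < M)%nat -> (n < M)%nat -> phi m (S n) <> phi m n -> hedge m (S n) z ->
     Rabs (phi m (S n) - phi m n) * Cmod (g z) <= D m n) ->
  (forall m n z, (m < M)%nat -> (n < M)%nat -> phi (S m) n <> phi m n -> vedge (S m) n z ->
     Rabs (phi (S m) n - phi m n) * Cmod (g z) <= D m n) ->
  Cmod (EE phi g) <= 4 * h * RSum (seq 0 M) (fun m => RSum (seq 0 M) (D m)).
Proof.
  intros Hg HD H1 H2. unfold EE.
  eapply Rle_trans; [apply Sum_mod|]. rewrite <- RSum_scal. apply RSum_le. intros m Hm.
  eapply Rle_trans; [apply Sum_mod|]. rewrite <- RSum_scal. apply RSum_le. intros n Hn.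
  apply in_seq in Hm. apply in_seq in Hn.
  assert (Hm' : (m < M)%nat) by lia. assert (Hn' : (n < M)%nat) by lia.
  specialize (HD m n Hm' Hn').
  assert (A : Cmod (RtoC (phi m (S n) - phi m n) * hh g m (S n)) <= 2 * h * D m n).
  { rewrite Cmod_mult, Cmod_R.
    destruct (classic (phi m (S n) = phi m n)) as [->|E].
    { replace (phi m n - phi m n) with 0 by ring. rewrite Rabs_R0. nra. }
    assert (P : 0 < Rabs (phi m (S n) - phi m n)) by (apply Rabs_pos_lt; lra).
    assert (Q : Cmod (hh g m (S n)) <= 2 * (D m n / Rabs (phi m (S n) - phi m n) * (gx (S m) - gx m))).
    { apply (Hint_bound g (gy (S n)) (gx m) (gx (S m)) (D m n / Rabs (phi m (S n) - phi m n))); [apply edge_le| |].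
      - intros t Ht. apply Hg. exists m, n. repeat split; try lia. left. split; auto. apply hedge_pt; exact Ht.
      - intros t Ht. apply (proj1 (Rle_div_r _ _ _ P)). rewrite (Rmult_comm (Cmod _)). apply H1; auto. apply hedge_pt; exact Ht. }
    eapply Rle_trans; [apply Rmult_le_compat_l; [lra|exact Q]|].
    right. rewrite gx_S. field. lra. }
  assert (B : Cmod (RtoC (phi (S m) n - phi m n) * vv g (S m) n) <= 2 * h * D m n).
  { rewrite Cmod_mult, Cmod_R.
    destruct (classic (phi (S m) n = phi m n)) as [->|E].
    { replace (phi m n - phi m n) with 0 by ring. rewrite Rabs_R0. nra. }
    assert (P : 0 < Rabs (phi (S m) n - phi m n)) by (apply Rabs_pos_lt; lra).
    assert (Q : Cmod (vv g (S m) n) <= 2 * (D m n / Rabs (phi (S m) n - phi m n) * (gy (S n) - gy n))).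
    { apply (Vint_bound g (gx (S m)) (gy n) (gy (S n)) (D m n / Rabs (phi (S m) n - phi m n))); [apply edge_le| |].
      - intros t Ht. apply Hg. exists m, n. repeat split; try lia. right. split; auto. apply vedge_pt; exact Ht.
      - intros t Ht. apply (proj1 (Rle_div_r _ _ _ P)). rewrite (Rmult_comm (Cmod _)). apply H2; auto. apply vedge_pt; exact Ht. }
    eapply Rle_trans; [apply Rmult_le_compat_l; [lra|exact Q]|].
    right. rewrite gy_S. field. lra. }
  unfold Cminus. eapply Rle_trans; [apply Cmod_triangle|]. rewrite Cmod_opp. lra.
Qed.

Lemma EE_zero phi : EE phi (fun _ => RtoC 0) = RtoC 0.
Proof.
  assert (E : EE phi (fun _ => 0 + RtoC (-1) * 0)%C
     = (EE phi (fun _ => RtoC 0) + RtoC (-1) * EE phi (fun _ => RtoC 0))%C).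
  { apply EE_lin; intros; apply ccont_const. }
  replace (fun _ : C => 0 + RtoC (-1) * 0)%C with (fun _ : C => RtoC 0) in E
    by (apply functional_extensionality; intros; ring).
  rewrite E. apply C_ext; simpl; ring.
Qed.

Lemma EE_Sum {A} phi (l : list A) (c : A -> C) (g : A -> C -> C) :
  (forall a z, In a l -> active phi z -> ccont (g a) z) ->
  EE phi (fun z => Sum l (fun a => c a * g a z))%C = Sum l (fun a => c a * EE phi (g a))%C.
Proof.
  induction l as [|a l IH]; simpl; intros H; [apply EE_zero|].
  rewrite <- IH by auto.
  rewrite (EE_ext phi (fun z => c a * g a z + Sum l (fun b => c b * g b z))%C
     (fun z => Sum l (fun b => c b * g b z) + c a * g a z)%C) by (intros; ring).
  rewrite EE_lin; [ring| |auto].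
  intros z Hz. apply (ccont_Sum l (fun b w => c b * g b w)%C). intros b Hb.
  apply ccont_mult; [apply ccont_const|auto].
Qed.

Lemma EE_Sum_weights {A} (l : list A) (phi : A -> nat -> nat -> R) g :
  EE (fun m n => RSum l (fun j => phi j m n)) g = Sum l (fun j => EE (phi j) g).
Proof.
  induction l as [|a l IH]; simpl.
  - unfold EE. apply Sum_zero. intros. apply Sum_zero. intros. rewrite Rminus_diag. ring.
  - rewrite <- IH. unfold EE. rewrite <- Sum_plus. apply Sum_ext. intros m _.
    rewrite <- Sum_plus. apply Sum_ext. intros n _.
    rewrite !RtoC_minus, !RtoC_plus. ring.
Qed.

(** Weights are free on squares whose boundary integral vanishes. Combined with [AA_EE], this pushes
    the active edges away from a singular point. *)
Lemma AA_ext_weights phi phi' g :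
  (forall m n, (m < M)%nat -> (n < M)%nat -> phi m n <> phi' m n -> Sq g m n = RtoC 0) ->
  AA phi g = AA phi' g.
Proof.
  intros H. unfold AA. apply Sum_ext. intros m Hm. apply Sum_ext. intros n Hn.
  apply in_seq in Hm. apply in_seq in Hn.
  destruct (classic (phi m n = phi' m n)) as [->|E]; [easy|].
  rewrite H by (auto; lia). ring.
Qed.

Lemma AA_one g : (forall z, ccont g z) ->
  AA (fun _ _ => 1) g = Rint g (gx 0) (gx M) (gy 0) (gy M).
Proof.
  intros Hg. unfold AA.
  assert (mono : forall k, gx 0 <= gx k /\ gy 0 <= gy k).
  { intros k. unfold gx, gy. pose proof (pos_INR k). simpl. split; nra. }
  assert (Hrow : forall m k, Sum (seq 0 k) (fun n => RtoC 1 * Sq g m n)%C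
     = Rint g (gx m) (gx (S m)) (gy 0) (gy k)).
  { intros m. induction k as [|k IH].
    - simpl. unfold Rint, Vint, cint. rewrite !RInt_point.
      apply C_ext; simpl; unfold zero; simpl; ring.
    - rewrite Sum_seq_S, IH. rewrite (Rint_split_y g _ _ (gy 0) (gy k) (gy (S k))); auto.
      + unfold Sq. ring.
      + apply edge_le.
      + apply mono.
      + apply edge_le. }
  rewrite (Sum_ext _ _ (fun m => Rint g (gx m) (gx (S m)) (gy 0) (gy M))) by (intros; apply Hrow).
  assert (Hcol : forall k, Sum (seq 0 k) (fun m => Rint g (gx m) (gx (S m)) (gy 0) (gy M))
     = Rint g (gx 0) (gx k) (gy 0) (gy M)); [|apply Hcol].
  induction k as [|k IH].
  - simpl. unfold Rint, Hint, cint. rewrite !RInt_point.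
    apply C_ext; simpl; unfold zero; simpl; ring.
  - rewrite Sum_seq_S, IH. symmetry. apply Rint_split_x; auto; try apply mono. apply edge_le.
Qed.

Lemma Sq_Goursat g p m n :
  (forall z, square m n z -> ccont g z) ->
  (forall z, square m n z -> z <> p -> C_differentiable_at g z) ->
  Sq g m n = RtoC 0.
Proof.
  unfold Sq, square. rewrite gx_S, gy_S. apply Goursat. exact Hh.
Qed.

Lemma Sq_plus g k m n :
  (forall z, square m n z -> ccont g z) -> (forall z, square m n z -> ccont k z) ->
  Sq (fun z => g z + k z)%C m n = (Sq g m n + Sq k m n)%C.
Proof.
  intros Hg Hk. exact (Rint_plus g k _ _ _ _ (proj1 (edge_le m)) (proj2 (edge_le n)) Hg Hk).
Qed.

Lemma Sq_scal c g m n : (forall z, square m n z -> ccont g z) ->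
  Sq (fun z => c * g z)%C m n = (c * Sq g m n)%C.
Proof.
  intros Hg. exact (Rint_scal c g _ _ _ _ (proj1 (edge_le m)) (proj2 (edge_le n)) Hg).
Qed.

Lemma Sq_ext g k m n : (forall z, square m n z -> g z = k z) -> Sq g m n = Sq k m n.
Proof.
  intros H. exact (Rint_ext g k _ _ _ _ (proj1 (edge_le m)) (proj2 (edge_le n)) H).
Qed.

End Grid.

(** * Uniform closure of the rational functions with poles in a given set *)

(** Given by generators so that only 1 / (z - a) and z have to be compared with [rational_poles_in];
    sums and products are then absorbed by sums of products. *)
Inductive ralg (L : sphere -> Prop) : (C -> C) -> Prop :=
| ralg_const c : ralg L (fun _ => c)
| ralg_pole a : L (Some a) -> ralg L (fun z => / (z - a))%C
| ralg_id : L None -> ralg L (fun z => z)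
| ralg_plus f g : ralg L f -> ralg L g -> ralg L (fun z => f z + g z)%C
| ralg_mult f g : ralg L f -> ralg L g -> ralg L (fun z => f z * g z)%C.

Definition RL (X : C -> Prop) (L : sphere -> Prop) (G : C -> C) : Prop :=
  forall eps, 0 < eps -> exists g, ralg L g /\ forall z, X z -> Cmod (G z - g z) < eps.

Section RationalClosure.
Variables (X : C -> Prop) (L : sphere -> Prop).
Hypothesis HX : Ccompact X.
Hypothesis HLsub : forall p, L p -> sphere_compl X p.

Let RX := RL X L.

Lemma RL_ralg g : ralg L g -> RX g.
Proof.
  intros H e He. exists g. split; [easy|]. intros z _.
  replace (g z - g z)%C with (RtoC 0) by ring. now rewrite Cmod_0.
Qed.

Lemma ralg_bounded g : ralg L g -> exists B, 0 < B /\ forall z, X z -> Cmod (g z) <= B.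
Proof.
  intros H. induction H as [c|a Ha|Ha|f g Hf [B1 [P1 IH1]] Hg [B2 [P2 IH2]]
    |f g Hf [B1 [P1 IH1]] Hg [B2 [P2 IH2]]].
  - exists (Cmod c + 1). pose proof (Cmod_ge_0 c). split; [lra|]. intros; lra.
  - destruct (compact_dist X a HX (HLsub _ Ha)) as [r [Hr H]]. exists (/ r).
    split; [now apply Rinv_0_lt_compat|]. intros z Hz. specialize (H z Hz).
    rewrite Cmod_inv by (apply Cmod_gt_0; lra). now apply Rinv_le_contravar.
  - apply compact_bounded; auto.
  - exists (B1 + B2). split; [lra|]. intros z Hz. eapply Rle_trans; [apply Cmod_triangle|].
    apply Rplus_le_compat; auto.
  - exists (B1 * B2). split; [nra|]. intros z Hz. rewrite Cmod_mult.
    apply Rmult_le_compat; auto using Cmod_ge_0.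
Qed.

Lemma RL_lim G : (forall eps, 0 < eps -> exists G', RX G' /\
  forall z, X z -> Cmod (G z - G' z) <= eps) -> RX G.
Proof.
  intros H e He. destruct (H (e / 2)) as [G' [H1 H2]]; [lra|].
  destruct (H1 (e / 2)) as [g [Hg H3]]; [lra|]. exists g. split; [easy|].
  intros z Hz. specialize (H2 z Hz). specialize (H3 z Hz).
  pose proof (Cmod_dist_triangle (G z) (G' z) (g z)). lra.
Qed.

Lemma RL_ext G G' : (forall z, X z -> G z = G' z) -> RX G -> RX G'.
Proof.
  intros E H e He. destruct (H e He) as [g [Hg Hd]]. exists g. split; [easy|].
  intros z Hz. rewrite <- E; auto.
Qed.

Lemma RL_const c : RX (fun _ => c).
Proof. apply RL_ralg. constructor. Qed.

Lemma RL_plus F G : RX F -> RX G -> RX (fun z => F z + G z)%C.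
Proof.
  intros HF HG e He. destruct (HF (e / 2)) as [f [Hf Df]]; [lra|].
  destruct (HG (e / 2)) as [g [Hg Dg]]; [lra|].
  exists (fun z => f z + g z)%C. split; [now constructor|]. intros z Hz.
  specialize (Df z Hz). specialize (Dg z Hz).
  replace (F z + G z - (f z + g z))%C with ((F z - f z) + (G z - g z))%C by ring.
  eapply Rle_lt_trans; [apply Cmod_triangle|]. lra.
Qed.

Lemma RL_bounded G : RX G -> exists B, 0 < B /\ forall z, X z -> Cmod (G z) <= B.
Proof.
  intros HG. destruct (HG 1) as [g [Hg Dg]]; [lra|].
  destruct (ralg_bounded g Hg) as [B [HB Hb]]. exists (B + 1). split; [lra|].
  intros z Hz. specialize (Dg z Hz). specialize (Hb z Hz).
  pose proof (Cmod_le_add (G z) (g z)). lra.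
Qed.

Lemma RL_mult F G : RX F -> RX G -> RX (fun z => F z * G z)%C.
Proof.
  intros HF HG e He.
  destruct (RL_bounded F HF) as [BF [PF HBF]].
  destruct (HG (e / (2 * BF))) as [g [Hg Dg]]; [apply Rdiv_lt_0_compat; lra|].
  destruct (ralg_bounded g Hg) as [B [HB Hb]].
  destruct (HF (e / (2 * B))) as [f [Hf Df]]; [apply Rdiv_lt_0_compat; lra|].
  exists (fun z => f z * g z)%C. split; [now constructor|]. intros z Hz.
  specialize (Df z Hz). specialize (Dg z Hz). specialize (HBF z Hz). specialize (Hb z Hz).
  replace (F z * G z - f z * g z)%C with ((F z) * (G z - g z) + (F z - f z) * g z)%C by ring.
  eapply Rle_lt_trans; [apply Cmod_triangle|]. rewrite !Cmod_mult.
  pose proof (Cmod_ge_0 (F z)). pose proof (Cmod_ge_0 (G z - g z)).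
  pose proof (Cmod_ge_0 (F z - f z)). pose proof (Cmod_ge_0 (g z)).
  assert (A1 : Cmod (F z) * Cmod (G z - g z) <= BF * Cmod (G z - g z)) by nra.
  assert (A2 : Cmod (F z - f z) * Cmod (g z) <= Cmod (F z - f z) * B) by nra.
  assert (A3 : BF * Cmod (G z - g z) < BF * (e / (2 * BF))) by (apply Rmult_lt_compat_l; lra).
  assert (A4 : Cmod (F z - f z) * B < e / (2 * B) * B) by (apply Rmult_lt_compat_r; lra).
  replace (BF * (e / (2 * BF))) with (e / 2) in A3 by (field; lra).
  replace (e / (2 * B) * B) with (e / 2) in A4 by (field; lra). lra.
Qed.

Lemma RL_scal c G : RX G -> RX (fun z => c * G z)%C.
Proof. intros H. apply RL_mult; [apply RL_const|easy]. Qed.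

Lemma RL_Sum {A} (l : list A) (G : A -> C -> C) :
  (forall a, In a l -> RX (G a)) -> RX (fun z => Sum l (fun a => G a z)).
Proof.
  induction l as [|a l IH]; simpl; intros H; [apply RL_const|].
  apply RL_plus; auto.
Qed.

Lemma geometric_sum (w : C) (n : nat) :
  ((1 - w) * Sum (seq 0 n) (fun k => w ^ k))%C = (1 - w ^ n)%C.
Proof.
  induction n as [|n IH]; [simpl; ring|]. rewrite Sum_seq_S, Cmult_plus_distr_l, IH. simpl. ring.
Qed.

(** The partial sums of the geometric series stay in the closure; the tail is G^n / (1 - G), at most
    2 * (1/2)^n. *)
Lemma RL_geometric G : RX G -> (forall z, X z -> Cmod (G z) <= / 2) ->
  RX (fun z => / (1 - G z))%C.
Proof.
  intros HG Hb. apply RL_lim. intros e He.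
  destruct (pow_lt_1_zero (/ 2)) with (y := e / 2) as [n Hn].
  { rewrite Rabs_pos_eq; lra. } { lra. }
  specialize (Hn n (le_n n)).
  exists (fun z => Sum (seq 0 n) (fun k => G z ^ k)%C). split.
  - apply (RL_Sum (seq 0 n) (fun k z => G z ^ k)%C). intros k _.
    induction k as [|k IH]; simpl; [apply RL_const|]. now apply RL_mult.
  - intros z Hz. specialize (Hb z Hz).
    assert (P : / 2 <= Cmod (1 - G z)).
    { pose proof (Cmod_le_add (RtoC 1) (G z)). rewrite Cmod_1 in H. lra. }
    assert (Hn0 : (1 - G z)%C <> RtoC 0).
    { intros E. rewrite E, Cmod_0 in P. lra. }
    replace (/ (1 - G z) - Sum (seq 0 n) (fun k => G z ^ k))%C
      with (G z ^ n / (1 - G z))%C.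
    2: { pose proof (geometric_sum (G z) n) as E. set (s := Sum _ _) in *.
         replace s with (/ (1 - G z) * ((1 - G z) * s))%C at 1 by (field; exact Hn0).
         rewrite E. field. exact Hn0. }
    rewrite Cmod_div, Cmod_pow' by easy.
    rewrite Rabs_pos_eq in Hn by (apply pow_le; lra).
    assert (Cmod (G z) ^ n <= (/ 2) ^ n) by (apply pow_incr; split; [apply Cmod_ge_0|easy]).
    apply (proj2 (Rle_div_l _ _ (Cmod (1 - G z)) ltac:(lra))). nra.
Qed.

Let kern (p : sphere) : C -> C :=
  match p with None => fun z => z | Some a => fun z => (/ (z - a))%C end.

(** The kernel at [b] is expanded in powers of (b - a) / (z - a), of modulus at most 1/2 on [X]. *)
Lemma RL_move_pole a b : ~ X a -> ~ X b ->
  (forall z, X z -> 2 * Cmod (b - a) <= Cmod (z - a)) ->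
  RX (kern (Some a)) -> RX (kern (Some b)).
Proof.
  intros Ha Hb Hd H. simpl in *.
  apply RL_ext with (G := (fun z => / (z - a) * / (1 - (b - a) * / (z - a)))%C).
  - intros z Hz. assert (z - a <> 0)%C by (apply Cminus_neq_0; congruence).
    assert (z - b <> 0)%C by (apply Cminus_neq_0; congruence).
    field. auto.
  - apply RL_mult; [exact H|]. apply (RL_geometric (fun z => (b - a) * / (z - a))%C).
    + now apply RL_scal.
    + intros z Hz. assert (z - a <> 0)%C by (apply Cminus_neq_0; congruence).
      rewrite Cmod_mult, Cmod_inv by easy.
      specialize (Hd z Hz). assert (0 < Cmod (z - a)) by now apply Cmod_gt_0.
      apply (proj2 (Rle_div_l (Cmod (b - a)) (/ 2) _ H1)). lra.
Qed.

Lemma RL_kern_nbhd a : ~ X a -> exists r, 0 < r /\ forall b, Cmod (b - a) < r ->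
  ~ X b /\ (RX (kern (Some a)) <-> RX (kern (Some b))).
Proof.
  intros Ha. destruct (compact_dist X a HX Ha) as [r [Hr H]].
  (* With a third of the distance, [a] and [b] may exchange their roles in [RL_move_pole]. *)
  exists (r / 3). split; [lra|]. intros b Hb.
  assert (Hd : forall z, X z -> 2 * (r / 3) <= Cmod (z - b)).
  { intros z Hz. specialize (H z Hz). pose proof (Cmod_dist_triangle z b a). lra. }
  assert (HnX : ~ X b).
  { intros Hx. specialize (Hd b Hx). replace (b - b)%C with (RtoC 0) in Hd by ring.
    rewrite Cmod_0 in Hd. lra. }
  split; [easy|]. split; apply RL_move_pole; auto; intros z Hz.
  - specialize (H z Hz). lra.
  - rewrite (Cmod_minus_sym a). specialize (Hd z Hz). lra.
Qed.

(** With |z| <= B and |a| > 3 B both directions are geometric series: 1 / (z - a) is - (1/a) / (1 -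
    z / a), and z is a - a / (1 - z / (z - a)), where |z / (z - a)| <= 1/2. *)
Lemma RL_kern_infinity : exists M, forall a, M < Cmod a ->
  ~ X a /\ (RX (kern None) <-> RX (kern (Some a))).
Proof.
  destruct (compact_bounded X HX) as [B [HB Hb]]. exists (3 * B). intros a Ha.
  assert (HnX : ~ X a). { intros H. specialize (Hb a H). lra. }
  assert (Ha0 : a <> RtoC 0). { intros E. rewrite E, Cmod_0 in Ha. lra. }
  assert (Hza : forall z, X z -> (z - a)%C <> RtoC 0) by (intros; apply Cminus_neq_0; congruence).
  split; [easy|]. split; intros H; simpl in *.
  - apply RL_ext with (G := (fun z => - / a * / (1 - / a * z))%C).
    + intros z Hz. specialize (Hza z Hz). field. repeat split; auto.
      intros E. apply Hza. replace (z - a)%C with (- (a - z))%C by ring. rewrite E. ring.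
    + apply RL_scal, (RL_geometric (fun z => / a * z)%C).
      * now apply RL_scal.
      * intros z Hz. rewrite Cmod_mult, Cmod_inv by easy. specialize (Hb z Hz).
        rewrite Rmult_comm. apply (proj2 (Rle_div_l (Cmod z) (/ 2) (Cmod a) ltac:(lra))). lra.
  - apply RL_ext with (G := (fun z => a + - a * / (1 - (1 + a * / (z - a))))%C).
    + intros z Hz. specialize (Hza z Hz). field. repeat split; auto.
      replace (z - a - (z - a + a))%C with (- a)%C by ring.
      intros E. apply Ha0. replace a with (- - a)%C by ring. rewrite E. ring.
    + apply RL_plus; [apply RL_const|]. apply RL_scal.
      apply (RL_geometric (fun z => 1 + a * / (z - a))%C).
      * apply RL_plus; [apply RL_const|now apply RL_scal].
      * intros z Hz. specialize (Hza z Hz).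
        replace (1 + a * / (z - a))%C with (z / (z - a))%C by (field; auto).
        specialize (Hb z Hz).
        assert (2 * B <= Cmod (z - a)).
        { pose proof (Cmod_le_add a z). rewrite Cmod_minus_sym in H0. lra. }
        rewrite Cmod_div by easy.
        apply (proj2 (Rle_div_l (Cmod z) (/ 2) (Cmod (z - a)) ltac:(lra))). lra.
Qed.

Hypothesis HLcomp : forall p, sphere_compl X p ->
  exists l, L l /\ same_component (sphere_compl X) p l.

(** The points off [X] whose kernel lies in the closure and those whose kernel does not form two
    open sets. A connected set joining [a] to a point of [L] stays in one of them, and at a point of
    [L] the kernel is a generator. *)
Lemma RL_pole a : ~ X a -> RX (fun z => / (z - a))%C.
Proof.
  intros Ha. destruct (HLcomp (Some a) Ha) as [l [Hl [A [HAS [Hcon [HAa HAl]]]]]].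
  (* [U True] and [U False] are the two classes; the parameter [b] lets one proof of openness serve
     both. *)
  set (U := fun (b : Prop) p => sphere_compl X p /\ (RX (kern p) <-> b)).
  assert (Hopen : forall b, sphere_open (U b)).
  { intros b. split.
    - intros z [Hz1 Hz2]. destruct (RL_kern_nbhd z Hz1) as [r [Hr H]].
      exists r. split; [easy|]. intros w Hw. rewrite Cnorm_Cmod in Hw.
      destruct (H w Hw) as [H1 H2]. split; [exact H1|]. rewrite <- H2. exact Hz2.
    - intros [_ H0]. destruct RL_kern_infinity as [M HM]. exists M.
      intros z Hz. rewrite Cnorm_Cmod in Hz. destruct (HM z Hz) as [H1 H2].
      split; [exact H1|]. rewrite <- H2. exact H0. }
  assert (Hll : RX (kern l)).
  { apply RL_ralg. destruct l; now constructor. }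
  destruct (Hcon (U True) (U False) (Hopen True) (Hopen False)) as [H|H].
  - intros p Hp. destruct (classic (RX (kern p))); [left|right]; split; auto; tauto.
  - intros p Hp [_ H1] [_ H2]. tauto.
  - destruct (H _ HAa) as [_ H1]. apply H1. exact Logic.I.
  - destruct (H _ HAl) as [_ H1]. exfalso. tauto.
Qed.

(** * Cauchy integrals off the compact set as limits of rational functions *)

Lemma cint_const (c : C) a b : cint (fun _ => c) a b = (RtoC (b - a) * c)%C.
Proof. unfold cint. rewrite !RInt_const. apply C_ext; simpl; unfold scal; simpl; unfold mult; simpl; ring. Qed.

(** The integral is a limit of Riemann sums, uniformly on [X]: on a short interval at [q] the
    integrand is frozen at [q], and [square_cousin] glues the intervals. *)
Lemma RL_cint (u : R -> C -> C) a b : a < b ->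
  (forall t, a <= t <= b -> RX (u t)) ->
  (forall t z, a <= t <= b -> X z -> rcont (fun s => u s z) t) ->
  (forall t, a <= t <= b -> forall eps, 0 < eps -> exists d, 0 < d /\
     forall s z, Rabs (s - t) < d -> X z -> Cmod (u s z - u t z) <= eps) ->
  RX (fun z => cint (fun t => u t z) a b).
Proof.
  intros Hab Hu Hr Hloc. apply RL_lim. intros e He.
  enough (HP : exists G, RX G /\ forall z, X z ->
    Cmod (cint (fun t => u t z) a (a + (b - a)) - G z) <= e / (b - a) * (b - a)).
  { destruct HP as [G [H1 H2]]. exists G. split; [easy|]. intros z Hz. specialize (H2 z Hz).
    replace (a + (b - a)) with b in H2 by ring.
    replace (e / (b - a) * (b - a)) with e in H2 by (field; lra). exact H2. }
  assert (He' : 0 < e / (b - a)) by (apply Rdiv_lt_0_compat; lra).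
  set (e' := e / (b - a)) in *.
  (* Only the horizontal side [a', a' + s] of the squares is used; the second coordinate is a
     dummy. *)
  apply (square_cousin (fun a' c' s => exists G, RX G /\ forall z, X z ->
    Cmod (cint (fun t => u t z) a' (a' + s) - G z) <= e' * s) a 0 (b - a)); [lra| |].
  - intros a' c' s Hs A1 A2 _ _ [G1 [K1 H1]] [G2 [K2 H2]] _ _.
    exists (fun z => G1 z + G2 z)%C. split; [now apply RL_plus|]. intros z Hz.
    specialize (H1 z Hz). specialize (H2 z Hz).
    rewrite <- (cint_Chasles _ a' (a' + s / 2) (a' + s)); [|lra|lra|].
    2: { intros. apply Hr; [lra|easy]. }
    replace (a' + s / 2 + s / 2) with (a' + s) in H2 by field.
    match goal with |- Cmod ?x <= _ => replace x with
      ((cint (fun t => u t z) a' (a' + s / 2) - G1 z) +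
       (cint (fun t => u t z) (a' + s / 2) (a' + s) - G2 z))%C by ring end.
    eapply Rle_trans; [apply Cmod_triangle|]. lra.
  - intros q Hq. destruct Hq as [Hq _]. replace (a + (b - a)) with b in Hq by ring.
    destruct (Hloc (fst q) Hq (e' / 2)) as [d [Hd H]]; [lra|].
    exists d. split; [easy|]. intros a' c' s Hs A1 A2 _ _ [Hin _].
    exists (fun z => RtoC s * u (fst q) z)%C. split; [apply RL_scal; auto|].
    intros z Hz.
    replace (RtoC s * u (fst q) z)%C with (cint (fun _ => u (fst q) z) a' (a' + s))
      by (rewrite cint_const; do 2 f_equal; ring).
    replace (cint (fun t => u t z) a' (a' + s) - cint (fun _ => u (fst q) z) a' (a' + s))%C
      with (cint (fun t => u t z + RtoC (-1) * u (fst q) z)%C a' (a' + s)).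
    2: { rewrite (cint_plus _ _ (ltac:(lra) : a' <= a' + s) (fun t => u t z) (fun t => RtoC (-1) * u (fst q) z)%C).
         - rewrite !cint_const. apply C_ext; simpl; ring.
         - intros. apply Hr; [lra|easy].
         - intros t _ e0 He0. exists 1. split; [lra|]. intros. unfold Cminus.
           rewrite Cplus_opp_r, Cmod_0. easy. }
    eapply Rle_trans; [apply cint_bound with (M := e' / 2)|].
    + lra.
    + intros t Ht e0 He0. destruct (Hr t z ltac:(lra) Hz e0 He0) as [d0 [Hd0 Hs0]].
      exists d0. split; [easy|]. intros s0 H0.
      replace (u s0 z + RtoC (-1) * u (fst q) z - (u t z + RtoC (-1) * u (fst q) z))%C
        with (u s0 z - u t z)%C by ring. auto.
    + intros t Ht. replace (u t z + RtoC (-1) * u (fst q) z)%C with (u t z - u (fst q) z)%C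
        by (apply C_ext; simpl; ring).
      apply H; auto. apply Rabs_def1; lra.
    + right. field.
Qed.

Lemma kernel_uniform (v : C -> C) (p : C) : ~ X p -> ccont v p ->
  forall eps, 0 < eps -> exists d, 0 < d /\ forall w z, Cmod (w - p) < d -> X z ->
    Cmod (v w * / (w - z) - v p * / (p - z)) <= eps.
Proof.
  intros Hp Hv e He. destruct (compact_dist X p HX Hp) as [r [Hr H]].
  pose proof (Cmod_ge_0 (v p)) as Pv.
  destruct (Hv (e * r / 4)) as [d1 [Hd1 H1]]; [nra|].
  assert (P2 : 0 < e * (r * r) / (4 * (Cmod (v p) + 1))).
  { apply Rdiv_lt_0_compat; [|lra]. apply Rmult_lt_0_compat; nra. }
  exists (Rmin d1 (Rmin (r / 2) (e * (r * r) / (4 * (Cmod (v p) + 1))))).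
  split; [repeat apply Rmin_glb_lt; auto; lra|].
  intros w z Hw Hz.
  assert (A1 : Cmod (w - p) < d1) by (eapply Rlt_le_trans; [exact Hw|apply Rmin_l]).
  assert (A2 : Cmod (w - p) < r / 2).
  { eapply Rlt_le_trans; [exact Hw|]. eapply Rle_trans; [apply Rmin_r|apply Rmin_l]. }
  assert (A3 : Cmod (w - p) < e * (r * r) / (4 * (Cmod (v p) + 1))).
  { eapply Rlt_le_trans; [exact Hw|]. eapply Rle_trans; [apply Rmin_r|apply Rmin_r]. }
  specialize (H1 w A1). specialize (H z Hz).
  assert (Q1 : r <= Cmod (p - z)) by (rewrite Cmod_minus_sym; exact H).
  assert (Q2 : r / 2 <= Cmod (w - z)).
  { pose proof (Cmod_dist_triangle p w z). rewrite (Cmod_minus_sym p w) in H0. lra. }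
  assert (N1 : (p - z)%C <> RtoC 0). { intros E. rewrite E, Cmod_0 in Q1. lra. }
  assert (N2 : (w - z)%C <> RtoC 0). { intros E. rewrite E, Cmod_0 in Q2. lra. }
  replace (v w * / (w - z) - v p * / (p - z))%C
    with ((v w - v p) * / (w - z) + v p * (/ (w - z) - / (p - z)))%C by ring.
  eapply Rle_trans; [apply Cmod_triangle|].
  rewrite !Cmod_mult, Cmod_inv_diff, Cmod_inv by auto.
  replace (w - z - (p - z))%C with (w - p)%C by ring.
  assert (I1 : / Cmod (w - z) <= 2 / r).
  { replace (2 / r) with (/ (r / 2)) by (field; lra). apply Rinv_le_contravar; lra. }
  assert (E1 : Cmod (v w - v p) * / Cmod (w - z) <= e * r / 4 * (2 / r)).
  { apply Rmult_le_compat; try lra; try apply Cmod_ge_0.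
    left. apply Rinv_0_lt_compat. lra. }
  replace (e * r / 4 * (2 / r)) with (e / 2) in E1 by (field; lra).
  assert (E2 : Cmod (v p) * (Cmod (w - p) / (Cmod (w - z) * Cmod (p - z))) <= e / 2).
  { assert (F1 : r * r / 2 <= Cmod (w - z) * Cmod (p - z)).
    { replace (r * r / 2) with (r / 2 * r) by field. apply Rmult_le_compat; lra. }
    assert (F2 : Cmod (w - p) * (4 * (Cmod (v p) + 1)) <= e * (r * r)).
    { left. apply (Rmult_lt_compat_r (4 * (Cmod (v p) + 1))) in A3; [|lra].
      replace (e * (r * r) / (4 * (Cmod (v p) + 1)) * (4 * (Cmod (v p) + 1)))
        with (e * (r * r)) in A3 by (field; lra). exact A3. }
    unfold Rdiv at 1. rewrite <- Rmult_assoc.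
    assert (F3 : 0 < Cmod (w - z) * Cmod (p - z)) by nra.
    apply (proj2 (Rle_div_l _ (e / 2) _ F3)).
    pose proof (Cmod_ge_0 (w - p)). nra. }
  lra.
Qed.

Lemma kernel_ccont (v : C -> C) (p z : C) : p <> z -> ccont v p ->
  ccont (fun w => v w * / (w - z))%C p.
Proof.
  intros Hp Hv. apply ccont_mult; [easy|]. apply (ccont_inv (fun w => w - z)%C).
  - now apply Cminus_neq_0.
  - apply ccont_minus; [apply ccont_id|apply ccont_const].
Qed.

Lemma RL_kernel_const c p : ~ X p -> RX (fun z => c * / (p - z))%C.
Proof.
  intros Hp. apply RL_ext with (G := (fun z => - c * / (z - p))%C).
  - intros z Hz. assert (z - p <> 0)%C by (apply Cminus_neq_0; congruence).
    assert (p - z <> 0)%C by (apply Cminus_neq_0; congruence). field. auto.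
  - apply RL_scal, RL_pole, Hp.
Qed.

Lemma RL_Hint v y a b : a < b -> (forall t, a <= t <= b -> ~ X (t, y) /\ ccont v (t, y)) ->
  RX (fun z => Hint (fun w => v w * / (w - z))%C y a b).
Proof.
  intros Hab H. apply (RL_cint (fun t z => v (t, y) * / ((t, y) - z))%C); auto.
  - intros t Ht. apply RL_kernel_const. now apply H.
  - intros t z Ht Hz. apply (rcont_H (fun w => v w * / (w - z))%C).
    destruct (H t Ht). apply kernel_ccont; [congruence|auto].
  - intros t Ht e He. destruct (H t Ht) as [H1 H2].
    destruct (kernel_uniform v (t, y) H1 H2 e He) as [d [Hd Hk]].
    exists d. split; [easy|]. intros s z Hs Hz. apply (Hk (s, y) z); [|easy].
    replace ((s, y) - (t, y))%C with (RtoC (s - t)) by (apply C_ext; simpl; ring).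
    now rewrite Cmod_R.
Qed.

Lemma RL_Vint v x a b : a < b -> (forall t, a <= t <= b -> ~ X (x, t) /\ ccont v (x, t)) ->
  RX (fun z => Vint (fun w => v w * / (w - z))%C x a b).
Proof.
  intros Hab H. apply RL_scal. apply (RL_cint (fun t z => v (x, t) * / ((x, t) - z))%C); auto.
  - intros t Ht. apply RL_kernel_const. now apply H.
  - intros t z Ht Hz. apply (rcont_V (fun w => v w * / (w - z))%C).
    destruct (H t Ht). apply kernel_ccont; [congruence|auto].
  - intros t Ht e He. destruct (H t Ht) as [H1 H2].
    destruct (kernel_uniform v (x, t) H1 H2 e He) as [d [Hd Hk]].
    exists d. split; [easy|]. intros s z Hs Hz. apply (Hk (x, s) z); [|easy].
    replace ((x, s) - (x, t))%C with (Ci * RtoC (s - t))%C by (apply C_ext; simpl; ring).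
    now rewrite Cmod_mult, Cmod_Ci, Cmod_R, Rmult_1_l.
Qed.

(** Edges without a jump carry the factor 0, so they may cross [X]; on the others the integrand is a
    combination of kernels with poles off [X]. *)
Lemma RL_EE o h M phi v : 0 < h ->
  (forall w, active o h M phi w -> ~ X w /\ ccont v w) ->
  RX (fun z => EE o h M phi (fun w => v w * / (w - z))%C).
Proof.
  intros Hh H. unfold EE.
  apply (RL_Sum (seq 0 M) (fun m z => Sum (seq 0 M) (fun n =>
    RtoC (phi m (S n) - phi m n) * hh o h (fun w => v w * / (w - z)) m (S n)
    - RtoC (phi (S m) n - phi m n) * vv o h (fun w => v w * / (w - z)) (S m) n))%C).
  intros m Hm. apply (RL_Sum (seq 0 M) (fun n z =>
    RtoC (phi m (S n) - phi m n) * hh o h (fun w => v w * / (w - z)) m (S n)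
    - RtoC (phi (S m) n - phi m n) * vv o h (fun w => v w * / (w - z)) (S m) n)%C).
  intros n Hn. apply in_seq in Hm. apply in_seq in Hn.
  apply RL_ext with (G := (fun z =>
    RtoC (phi m (S n) - phi m n) * hh o h (fun w => v w * / (w - z)) m (S n)
    + RtoC (- (phi (S m) n - phi m n)) * vv o h (fun w => v w * / (w - z)) (S m) n)%C).
  { intros z _. rewrite RtoC_opp. ring. }
  apply RL_plus.
  - destruct (classic (phi m (S n) = phi m n)) as [E|E].
    + apply RL_ext with (G := fun _ => RtoC 0); [|apply RL_const].
      intros z _. rewrite E, Rminus_diag. ring.
    + apply RL_scal, RL_Hint; [rewrite gx_S; lra|]. intros t Ht. apply H.
      exists m, n. repeat split; try lia. left. split; [auto|]. split; simpl; auto.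
  - destruct (classic (phi (S m) n = phi m n)) as [E|E].
    + apply RL_ext with (G := fun _ => RtoC 0); [|apply RL_const].
      intros z _. rewrite E, Rminus_diag, Ropp_0. ring.
    + apply RL_scal, RL_Vint; [rewrite gy_S; lra|]. intros t Ht. apply H.
      exists m, n. repeat split; try lia. right. split; [auto|]. split; simpl; auto.
Qed.

Lemma RL_Sq o h m n v : 0 < h ->
  (forall w, square o h m n w -> ~ X w /\ ccont v w) ->
  RX (fun z => Sq o h (fun w => v w * / (w - z))%C m n).
Proof.
  intros Hh H. unfold Sq, Rint, Cminus.
  assert (Hx : gx o h m < gx o h (S m)) by (rewrite gx_S; lra).
  assert (Hy : gy o h n < gy o h (S n)) by (rewrite gy_S; lra).
  repeat apply RL_plus.
  - apply RL_Hint; [easy|]. intros t Ht. apply H. split; simpl; lra.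
  - apply RL_Vint; [easy|]. intros t Ht. apply H. split; simpl; lra.
  - apply RL_ext with (G := (fun z => RtoC (-1) *
      Hint (fun w => v w * / (w - z)) (gy o h (S n)) (gx o h m) (gx o h (S m)))%C).
    { intros. apply C_ext; simpl; ring. }
    apply RL_scal, RL_Hint; [easy|]. intros t Ht. apply H. split; simpl; lra.
  - apply RL_ext with (G := (fun z => RtoC (-1) *
      Vint (fun w => v w * / (w - z)) (gx o h m) (gy o h n) (gy o h (S n)))%C).
    { intros. apply C_ext; simpl; ring. }
    apply RL_scal, RL_Vint; [easy|]. intros t Ht. apply H. split; simpl; lra.
Qed.

End RationalClosure.

(** * Finite rank reduction of a family of functionals *)

Definition lin_closed (F : (C -> C) -> Prop) : Prop :=
  forall u v c, F u -> F v -> F (fun z => u z + c * v z)%C.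

Definition linear_on (W : (C -> C) -> Prop) (a : (C -> C) -> C) : Prop :=
  forall u v c, W u -> W v -> a (fun z => u z + c * v z)%C = (a u + c * a v)%C.

(** [osc u r] reads: the seminorm of [u] is at most [r]. A relation avoids suprema, which could be
    infinite. *)
Definition seminorm_like (osc : (C -> C) -> R -> Prop) : Prop :=
  (forall u v c r s, osc u r -> osc v s -> osc (fun z => u z + c * v z)%C (r + Cmod c * s)) /\
  (forall u r s, osc u r -> r <= s -> osc u s).

Definition reduce (lst : list (((C -> C) -> C) * (C -> C))) (v : C -> C) : C -> C :=
  fun z => (v z - Sum lst (fun cv => fst cv v * snd cv z))%C.

Lemma reduce_cons c w lst v :
  reduce ((c, w) :: lst) v = (fun z => reduce lst v z + (- c v) * w z)%C.
Proof. apply functional_extensionality. intros z. unfold reduce. simpl. ring. Qed.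

Lemma reduce_nil v : reduce nil v = v.
Proof. apply functional_extensionality. intros z. unfold reduce. simpl. ring. Qed.

Lemma reduce_closed F lst v : lin_closed F -> F v ->
  (forall c w, In (c, w) lst -> F w) -> F (reduce lst v).
Proof.
  intros HF Hv. induction lst as [|[c w] lst IH]; intros H.
  - now rewrite reduce_nil.
  - rewrite reduce_cons. apply HF.
    + apply IH. intros c' w' Hin. apply (H c'). now right.
    + apply (H c). now left.
Qed.

Lemma reduce_linear W lst u v c : W u -> W v ->
  (forall d w, In (d, w) lst -> linear_on W d) ->
  reduce lst (fun z => u z + c * v z)%C = (fun z => reduce lst u z + c * reduce lst v z)%C.
Proof.
  intros Hu Hv H. apply functional_extensionality. intros z. unfold reduce.
  rewrite (Sum_ext lst _ (fun cv => fst cv u * snd cv z + c * (fst cv v * snd cv z))%C).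
  - rewrite Sum_plus, Sum_scal. ring.
  - intros [d w] Hin. simpl. rewrite (H d w Hin u v c Hu Hv). ring.
Qed.

Lemma reduce_osc (W : (C -> C) -> Prop) (osc : (C -> C) -> R -> Prop) lst Lam u r :
  seminorm_like osc -> 0 <= r -> 0 <= Lam -> W u -> osc u r ->
  (forall c w, In (c, w) lst -> (forall u r, 0 <= r -> W u -> osc u r -> Cmod (c u) <= Lam * r) /\ osc w Lam) ->
  osc (reduce lst u) (r + INR (length lst) * (Lam * r * Lam)).
Proof.
  intros [Ho1 Ho2] Hr HL HW Hu. induction lst as [|[c w] lst IH]; intros H.
  - rewrite reduce_nil. eapply Ho2; [exact Hu|]. simpl. lra.
  - rewrite reduce_cons. destruct (H c w (or_introl eq_refl)) as [H1 H2].
    eapply Ho2; [apply Ho1; [apply IH|exact H2]|].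
    + intros c' w' Hin. apply H. now right.
    + rewrite Cmod_opp. specialize (H1 u r Hr HW Hu). cbn [length]. rewrite S_INR.
      pose proof (Rmult_le_compat_r Lam _ _ HL H1). lra.
Qed.

(** A substitute for the extremal vector in Auerbach's lemma: the supremum need not be attained, and
    half of it is enough. *)
Lemma near_maximizer {T : Type} (P : T -> Prop) (f : T -> R) (k B : R) : 0 < k ->
  (forall t, P t -> f t <= B) -> (exists t, P t /\ k < f t) ->
  exists t, P t /\ k < f t /\ forall s, P s -> f s <= 2 * f t.
Proof.
  intros Hk HB [t0 [Ht0 Hf0]].
  destruct (completeness (fun x => exists t, P t /\ x = f t)) as [m [Hub Hlub]].
  - exists B. intros x [t [Ht ->]]. auto.
  - exists (f t0), t0. auto.
  - assert (Hm : k < m). { eapply Rlt_le_trans; [exact Hf0|]. apply Hub. now exists t0. }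
    destruct (classic (exists t, P t /\ Rmax k (m / 2) < f t)) as [[t [Ht Hlt]]|Hno].
    + exists t. assert (k < f t) by (eapply Rle_lt_trans; [apply Rmax_l|exact Hlt]).
      assert (m / 2 < f t) by (eapply Rle_lt_trans; [apply Rmax_r|exact Hlt]).
      repeat split; auto. intros s Hs. assert (f s <= m) by (apply Hub; now exists s). lra.
    + exfalso. assert (m <= Rmax k (m / 2)).
      { apply Hlub. intros x [t [Ht ->]]. apply Rnot_lt_le. intros Hlt. apply Hno. eauto. }
      assert (Rmax k (m / 2) < m) by (apply Rmax_lub_lt; lra). lra.
Qed.

(* The bound [Lam] does not depend on the spaces: it stays fixed when the mesh of the grid,
   hence [V] and the functionals, change. Killing the functionals only up to [kap] is what
   makes this uniformity possible. *)
Lemma finite_rank_reduction (n : nat) (A kap : R) : 0 <= A -> 0 < kap ->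
  exists Lam, 0 <= Lam /\
  forall (W V : (C -> C) -> Prop) (osc : (C -> C) -> R -> Prop) (fs : list ((C -> C) -> C)),
    lin_closed W -> lin_closed V -> (forall v, V v -> W v) -> seminorm_like osc ->
    length fs = n ->
    (forall a, In a fs -> linear_on W a /\ forall u r, 0 <= r -> W u -> osc u r -> Cmod (a u) <= A * r) ->
    exists lst,
      (length lst <= n)%nat /\
      (forall c v, In (c, v) lst -> linear_on W c /\
         (forall u r, 0 <= r -> W u -> osc u r -> Cmod (c u) <= Lam * r) /\ V v /\ osc v Lam) /\
      (forall v, V v -> osc v 1 -> osc (reduce lst v) (3 ^ n) /\
         forall a, In a fs -> Cmod (a (reduce lst v)) <= 3 ^ n * kap).
Proof.
  intros HA Hk. induction n as [|n [Lam [HL IH]]].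
  - exists 0. split; [lra|]. intros W V osc fs HW HV HVW Ho Hlen Hfs.
    exists nil. split; [simpl; lia|]. split; [intros c v []|].
    intros v Hv Hov. rewrite reduce_nil. split.
    + eapply (proj2 Ho); [exact Hov|]. simpl. lra.
    + intros a Ha. destruct fs; [destruct Ha|discriminate].
  - set (B := A * (1 + INR n * (Lam * Lam))).
    assert (HB : 0 <= B). { unfold B. pose proof (pos_INR n). apply Rmult_le_pos; [easy|]. nra. }
    assert (H3 : 0 < 3 ^ n) by (apply pow_lt; lra).
    (* One constant for three needs: the old list, the new functional (its denominator exceeds
       [kap]), and the new vector, whose oscillation is at most 3 ^ n. *)
    exists (Lam + B / kap + 3 ^ n).
    assert (HBk : 0 <= B / kap) by (apply Rdiv_le_0_compat; lra).
    split; [lra|].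
    intros W V osc fs HW HV HVW Ho Hlen Hfs.
    destruct fs as [|a fs]; [discriminate|]. injection Hlen as Hlen.
    destruct (IH W V osc fs HW HV HVW Ho Hlen) as [lst [Hl1 [Hl2 Hl3]]].
    { intros b Hb. apply Hfs. now right. }
    destruct (Hfs a (or_introl eq_refl)) as [Halin Hab].
    assert (HPW : forall u, W u -> W (reduce lst u)).
    { intros u Hu. apply reduce_closed; auto. intros c w Hin. apply HVW. now apply (Hl2 c w). }
    assert (HPV : forall u, V u -> V (reduce lst u)).
    { intros u Hu. apply reduce_closed; auto. intros c w Hin. now apply (Hl2 c w). }
    assert (HaP : forall u r, 0 <= r -> W u -> osc u r -> Cmod (a (reduce lst u)) <= B * r).
    { intros u r Hr Hu Hou.
      apply Rle_trans with (A * (r + INR (length lst) * (Lam * r * Lam))).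
      - apply Hab; auto.
        + apply Rplus_le_le_0_compat; [easy|]. apply Rmult_le_pos; [apply pos_INR|].
          apply Rmult_le_pos; [|easy]. now apply Rmult_le_pos.
        + apply (reduce_osc W osc lst Lam u r); auto.
          intros c w Hin. destruct (Hl2 c w Hin) as [_ [K1 [_ K2]]]. auto.
      - unfold B. apply le_INR in Hl1.
        assert (INR (length lst) * (Lam * r * Lam) <= INR n * (Lam * r * Lam)).
        { apply Rmult_le_compat_r; [|easy]. apply Rmult_le_pos; [|easy]. now apply Rmult_le_pos. }
        nra. }
    assert (Hmono : forall c v, In (c, v) lst -> linear_on W c /\
         (forall u r, 0 <= r -> W u -> osc u r -> Cmod (c u) <= (Lam + B / kap + 3 ^ n) * r) /\
         V v /\ osc v (Lam + B / kap + 3 ^ n)).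
    { intros c v Hin. destruct (Hl2 c v Hin) as [K1 [K2 [K3 K4]]]. repeat split; auto.
      - intros u r Hr Hu Hou. eapply Rle_trans; [apply K2; eauto|].
        apply Rmult_le_compat_r; [easy|lra].
      - eapply (proj2 Ho); [exact K4|lra]. }
    assert (H3S : 3 ^ S n = 3 * 3 ^ n) by reflexivity.
    (* Either [a] is already below [kap] on the reduced unit ball and the list stays, or there is a
       vector [w] with |a w| > kap to divide by. *)
    destruct (classic (forall v, V v -> osc v 1 -> Cmod (a (reduce lst v)) <= kap)) as [Hsmall|Hbig].
    + exists lst. split; [lia|]. split; [exact Hmono|].
      intros v Hv Hov. destruct (Hl3 v Hv Hov) as [K1 K2]. rewrite H3S. split.
      * eapply (proj2 Ho); [exact K1|lra].
      * intros b [<-|Hb].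
        -- eapply Rle_trans; [now apply Hsmall|].
           assert (1 <= 3 ^ n) by (apply pow_R1_Rle; lra). nra.
        -- specialize (K2 b Hb). nra.
    + destruct (near_maximizer (fun v => V v /\ osc v 1) (fun v => Cmod (a (reduce lst v))) kap (B * 1))
        as [u [[Hu Hou] [Hku Hmax]]]; auto.
      { intros v [Hv Hov]. apply HaP; auto. lra. }
      { apply NNPP. intros Hno. apply Hbig. intros v Hv Hov. apply Rnot_lt_le. intros Hlt.
        apply Hno. exists v. auto. }
      set (w := reduce lst u) in *. set (m := Cmod (a w)) in *.
      assert (Ha0 : a w <> RtoC 0). { intros E. unfold m in Hku. rewrite E, Cmod_0 in Hku. lra. }
      destruct (Hl3 u Hu Hou) as [How Hsw]. fold w in How, Hsw.
      exists (((fun v => a (reduce lst v) * / a w)%C, w) :: lst).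
      (* Near maximality keeps the new coefficient at most 2, so one step multiplies the oscillation
         and the leftover values by at most 1 + 2. *)
      assert (Hc : forall v, V v -> osc v 1 -> Cmod (a (reduce lst v) * / a w)%C <= 2).
      { intros v Hv Hov. rewrite Cmod_mult, Cmod_inv by easy. fold m.
        apply (proj2 (Rle_div_l _ 2 m ltac:(lra))). now apply Hmax. }
      split; [simpl; lia|]. split.
      * intros c v [E|Hin]; [|now apply Hmono]. injection E as <- <-. split; [|split; [|split]].
        -- intros u1 v1 c1 Hu1 Hv1. rewrite (reduce_linear W) by (auto; intros d w' Hin; now apply (Hl2 d w')).
           rewrite Halin by auto. ring.
        -- intros u1 r Hr Hu1 Hou1. rewrite Cmod_mult, Cmod_inv by easy. fold m.
           specialize (HaP u1 r Hr Hu1 Hou1). apply (proj2 (Rle_div_l _ _ m ltac:(lra))).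
           assert (B * r <= B / kap * r * m).
           { replace (B * r) with (B / kap * r * kap) by (field; lra).
             apply Rmult_le_compat_l; [nra|lra]. }
           assert (0 <= (Lam + 3 ^ n) * r * m) by (apply Rmult_le_pos; nra). nra.
        -- now apply HPV.
        -- eapply (proj2 Ho); [exact How|lra].
      * intros v Hv Hov. rewrite reduce_cons. specialize (Hc v Hv Hov).
        destruct (Hl3 v Hv Hov) as [K1 K2]. rewrite H3S. split.
        -- eapply (proj2 Ho); [apply (proj1 Ho); [exact K1|exact How]|]. rewrite Cmod_opp. nra.
        -- intros b Hb. assert (Hlinb : linear_on W b) by now apply Hfs.
           rewrite Hlinb; [|now apply HPW, HVW|now apply HPW, HVW].
           destruct Hb as [<-|Hb].
           ++ replace (a (reduce lst v) + - (a (reduce lst v) * / a w) * a w)%C with (RtoC 0)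
                by (field; exact Ha0).
              rewrite Cmod_0. nra.
           ++ eapply Rle_trans; [apply Cmod_triangle|]. rewrite Cmod_mult, Cmod_opp.
              specialize (K2 b Hb). specialize (Hsw b Hb).
              pose proof (Cmod_ge_0 (b w)).
              assert (Cmod (a (reduce lst v) * / a w) * Cmod (b w) <= 2 * Cmod (b w))
                by (apply Rmult_le_compat_r; auto).
              lra.
Qed.

(** * Tent weights and kernel sums *)

Definition clamp (t : R) : R := Rmax 0 (Rmin 1 t).
(** This is max 0 (1 - |t|), written with clamps so that sums of integer translates telescope. *)
Definition tent (t : R) : R := clamp (t + 1) - clamp t.

Lemma clamp_cases t : (t <= 0 /\ clamp t = 0) \/ (0 <= t <= 1 /\ clamp t = t) \/ (1 <= t /\ clamp t = 1).
Proof.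
  unfold clamp, Rmin, Rmax. destruct (Rle_dec 1 t).
  - destruct (Rle_dec 0 1); lra.
  - destruct (Rle_dec 0 t); lra.
Qed.

Lemma clamp_lip s t : Rabs (clamp s - clamp t) <= Rabs (s - t).
Proof.
  destruct (clamp_cases s) as [[H1 ->]|[[H1 ->]|[H1 ->]]];
  destruct (clamp_cases t) as [[H2 ->]|[[H2 ->]|[H2 ->]]];
  unfold Rabs; repeat destruct Rcase_abs; lra.
Qed.

Lemma tent_lip s t : Rabs (tent s - tent t) <= 2 * Rabs (s - t).
Proof.
  unfold tent. pose proof (clamp_lip (s + 1) (t + 1)) as H1. pose proof (clamp_lip s t) as H2.
  replace (s + 1 - (t + 1)) with (s - t) in H1 by ring.
  replace (clamp (s + 1) - clamp s - (clamp (t + 1) - clamp t))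
    with ((clamp (s + 1) - clamp (t + 1)) - (clamp s - clamp t)) by ring.
  unfold Rminus at 1. eapply Rle_trans; [apply Rabs_triang|]. rewrite Rabs_Ropp. lra.
Qed.

Lemma tent_range t : 0 <= tent t <= 1.
Proof.
  unfold tent. destruct (clamp_cases (t + 1)) as [[H1 ->]|[[H1 ->]|[H1 ->]]];
  destruct (clamp_cases t) as [[H2 ->]|[[H2 ->]|[H2 ->]]]; lra.
Qed.

Lemma tent_support t : tent t <> 0 -> Rabs t < 1.
Proof.
  intros H. apply Rnot_le_lt. intros Hle. apply H. unfold tent.
  unfold Rabs in Hle. destruct (Rcase_abs t);
  destruct (clamp_cases (t + 1)) as [[H1 ->]|[[H1 ->]|[H1 ->]]];
  destruct (clamp_cases t) as [[H2 ->]|[[H2 ->]|[H2 ->]]]; lra.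
Qed.

Lemma tent_partition (P : nat) t : 1 <= t -> t <= INR P - 1 ->
  RSum (seq 1 (P - 1)) (fun p => tent (t - INR p)) = 1.
Proof.
  intros H1 H2.
  assert (E : forall k, RSum (seq 1 k) (fun p => tent (t - INR p)) = clamp t - clamp (t - INR k)).
  { induction k as [|k IH].
    - simpl. rewrite Rminus_0_r. ring.
    - rewrite seq_S, RSum_app, IH. replace (1 + k)%nat with (S k) by lia. cbn [RSum]. unfold tent.
      rewrite !S_INR. replace (t - (INR k + 1) + 1) with (t - INR k) by ring. ring. }
  rewrite E. assert (HP : (1 <= P)%nat).
  { destruct P; [|lia]. simpl in H2. lra. }
  rewrite minus_INR by easy. simpl (INR 1).
  destruct (clamp_cases t) as [[K1 ->]|[[K1 ->]|[K1 ->]]];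
  destruct (clamp_cases (t - (INR P - 1))) as [[K2 ->]|[[K2 ->]|[K2 ->]]]; lra.
Qed.

(** A discrete integral test: [Th] plays the part of a bounded primitive in the three sums below. *)
Lemma RSum_potential (M : nat) (f Th : nat -> R) :
  (forall m, f m <= Th (S m) - Th m) -> RSum (seq 0 M) f <= Th M - Th 0%nat.
Proof.
  intros H. rewrite <- RSum_telescope. apply RSum_le. auto.
Qed.

Lemma RSum_mult (l k : list nat) (f g : nat -> R) :
  RSum l (fun m => RSum k (fun n => f m * g n)) = RSum l f * RSum k g.
Proof.
  rewrite (RSum_ext _ _ (fun m => RSum k g * f m)).
  - rewrite RSum_scal. ring.
  - intros. rewrite RSum_scal. ring.
Qed.

Definition inwin (c r : R) (m : nat) : bool :=
  if Rle_dec (Rabs (INR m - c)) r then true else false.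

Lemma inwin_true c r m : Rabs (INR m - c) <= r -> inwin c r m = true.
Proof. intros H. unfold inwin. now destruct Rle_dec. Qed.

Lemma window_sum (M : nat) (c r : R) : 0 <= r ->
  RSum (seq 0 M) (fun m => if inwin c r m then 1 else 0) <= 2 * r + 1.
Proof.
  intros Hr. set (Th := fun m : nat => Rmax (c - r) (Rmin (c + r + 1) (INR m))).
  eapply Rle_trans; [apply (RSum_potential M _ Th)|].
  - intros m. unfold inwin, Th. rewrite S_INR. destruct Rle_dec as [Hd|Hd].
    + apply Rabs_le_between in Hd. rewrite !Rmin_right, !Rmax_right; lra.
    + unfold Rmax, Rmin. repeat destruct Rle_dec; lra.
  - unfold Th, Rmax, Rmin. repeat destruct Rle_dec; lra.
Qed.

Lemma sqrt_step y : 0 <= y -> / sqrt (1 + y) <= 2 * (sqrt (y + 1) - sqrt y).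
Proof.
  intros Hy. rewrite (Rplus_comm 1 y).
  assert (P : 0 < sqrt (y + 1)) by (apply sqrt_lt_R0; lra).
  pose proof (sqrt_pos y). pose proof (sqrt_sqrt y Hy). pose proof (sqrt_sqrt (y + 1) ltac:(lra)).
  assert (sqrt y <= sqrt (y + 1)) by (apply sqrt_le_1_alt; lra).
  apply Rmult_le_reg_l with (sqrt (y + 1)); [easy|]. rewrite Rinv_r by lra. nra.
Qed.

(** Away from [c] this is [sqrt_step]; when the unit step crosses [c], it rests on sqrt (1 - y) +
    sqrt y >= 1. *)
Lemma sroot_step c x : / sqrt (1 + Rabs (x - c)) <= 2 * (sroot c (x + 1) - sroot c x).
Proof.
  unfold sroot. destruct (Rle_dec c x) as [H|H].
  - destruct (Rle_dec c (x + 1)); [|lra]. rewrite Rabs_pos_eq by lra.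
    replace (x + 1 - c) with (x - c + 1) by ring. apply sqrt_step. lra.
  - rewrite Rabs_left by lra. destruct (Rle_dec c (x + 1)) as [H1|H1].
    + set (y := c - x). replace (- (x - c)) with y by (unfold y; ring).
      replace (x + 1 - c) with (1 - y) by (unfold y; ring).
      assert (0 < y <= 1) by (unfold y; lra).
      assert (A : 1 <= sqrt (1 + y)). { rewrite <- sqrt_1 at 1. apply sqrt_le_1_alt. lra. }
      assert (B : / sqrt (1 + y) <= 1). { apply Rle_trans with (/ 1); [apply Rinv_le_contravar; lra|lra]. }
      assert (1 <= sqrt (1 - y) + sqrt y); [|lra].
      pose proof (sqrt_pos (1 - y)). pose proof (sqrt_pos y).
      pose proof (sqrt_sqrt y ltac:(lra)). pose proof (sqrt_sqrt (1 - y) ltac:(lra)). nra.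
    + set (y := c - x - 1). replace (- (x - c)) with (1 + y) by (unfold y; ring).
      replace (c - (x + 1)) with y by (unfold y; ring). replace (c - x) with (y + 1) by (unfold y; ring).
      assert (0 <= y) by (unfold y; lra). pose proof (sqrt_step y H0) as H2.
      assert (/ sqrt (1 + (1 + y)) <= / sqrt (1 + y)).
      { apply Rinv_le_contravar; [apply sqrt_lt_R0; lra|apply sqrt_le_1_alt; lra]. }
      lra.
Qed.

Lemma sroot_bound c x r : 0 <= r -> Rabs (x - c) <= r -> Rabs (sroot c x) <= sqrt r.
Proof.
  intros Hr H. apply Rabs_le_between in H. unfold sroot. destruct (Rle_dec c x).
  - rewrite Rabs_pos_eq by apply sqrt_pos. apply sqrt_le_1_alt. lra.
  - rewrite Rabs_Ropp, Rabs_pos_eq by apply sqrt_pos. apply sqrt_le_1_alt. lra.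
Qed.

(** The growth sqrt r is what matters: the product of two such sums is of order r, which the slope 1
    / N of a tent compensates in [near_estimate]. *)
Lemma sqrt_window_sum (M : nat) (c r : R) : 0 <= r ->
  RSum (seq 0 M) (fun m => if inwin c r m then / sqrt (1 + Rabs (INR m - c)) else 0)
  <= 4 * sqrt (r + 1).
Proof.
  intros Hr. set (s := sqrt (r + 1)). pose proof (sqrt_pos (r + 1)) as Hs. fold s in Hs.
  set (Th := fun m : nat => 2 * Rmax (- s) (Rmin s (sroot c (INR m)))).
  eapply Rle_trans; [apply (RSum_potential M _ Th)|].
  - intros m. unfold inwin, Th. rewrite S_INR. destruct Rle_dec as [Hd|Hd].
    + assert (B1 : Rabs (sroot c (INR m)) <= s) by (apply sroot_bound; lra).
      assert (B2 : Rabs (sroot c (INR m + 1)) <= s).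
      { apply sroot_bound; [lra|]. apply Rabs_le_between in Hd. apply Rabs_le. lra. }
      apply Rabs_le_between in B1. apply Rabs_le_between in B2.
      rewrite !Rmin_right, !Rmax_right by lra. pose proof (sroot_step c (INR m)). lra.
    + pose proof (sroot_mono c (INR m) (INR m + 1) ltac:(lra)).
      unfold Rmax, Rmin. repeat destruct Rle_dec; lra.
  - unfold Th, Rmax, Rmin. repeat destruct Rle_dec; lra.
Qed.

Lemma square_sum (n : nat) (al : R) :
  RSum (seq 0 n) (fun p => / (1 + Rabs (al - INR p)) ^ 2) <= 4.
Proof.
  (* A bounded primitive of 2 / (1 + |x|)^2; the factor 2 pays for comparing a unit increment with
     the summand at its left end. *)
  set (th := fun x : R => 2 * (x / (1 + Rabs x))).
  assert (Hb : forall x, -2 <= th x <= 2).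
  { intros x. unfold th. pose proof (Rabs_pos x).
    assert (-1 <= x / (1 + Rabs x) <= 1); [|lra]. split.
    - apply (proj1 (Rle_div_r _ _ (1 + Rabs x) ltac:(lra))). pose proof (Rabs_maj2 x). lra.
    - apply (proj2 (Rle_div_l _ _ (1 + Rabs x) ltac:(lra))). pose proof (Rle_abs x). lra. }
  eapply Rle_trans; [apply (RSum_potential n _ (fun p => th (INR p - al)))|].
  - intros p. rewrite S_INR. replace (INR p + 1 - al) with (INR p - al + 1) by ring.
    rewrite Rabs_minus_sym. set (x := INR p - al). unfold th.
    unfold Rabs. destruct (Rcase_abs x) as [Hx|Hx].
    + destruct (Rcase_abs (x + 1)) as [Hx1|Hx1].
      * replace (2 * ((x + 1) / (1 + - (x + 1))) - 2 * (x / (1 + - x)))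
          with (2 / (x * (x - 1))) by (field; lra).
        unfold Rdiv. apply Rmult_le_reg_l with ((1 + - x) ^ 2 * (x * (x - 1))).
        { apply Rmult_lt_0_compat; nra. }
        replace ((1 + - x) ^ 2 * (x * (x - 1)) * / (1 + - x) ^ 2) with (x * (x - 1)) by (field; lra).
        replace ((1 + - x) ^ 2 * (x * (x - 1)) * (2 * / (x * (x - 1)))) with (2 * (1 + - x) ^ 2)
          by (field; lra). nra.
      * apply Rle_trans with 1.
        { apply Rle_trans with (/ 1); [apply Rinv_le_contravar; nra|lra]. }
        replace (2 * ((x + 1) / (1 + (x + 1))) - 2 * (x / (1 + - x)))
          with (2 * ((1 - 2 * x - 2 * (x * x)) / ((2 + x) * (1 - x)))) by (field; lra).
        assert (/ 2 <= (1 - 2 * x - 2 * (x * x)) / ((2 + x) * (1 - x))); [|lra].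
        apply (proj1 (Rle_div_r _ _ ((2 + x) * (1 - x)) ltac:(nra))). nra.
    + destruct (Rcase_abs (x + 1)) as [Hx1|Hx1]; [lra|].
      replace (2 * ((x + 1) / (1 + (x + 1))) - 2 * (x / (1 + x)))
        with (2 / ((x + 1) * (x + 2))) by (field; lra).
      unfold Rdiv. apply Rmult_le_reg_l with ((1 + x) ^ 2 * (x + 2)).
      { apply Rmult_lt_0_compat; nra. }
      replace ((1 + x) ^ 2 * (x + 2) * / (1 + x) ^ 2) with (x + 2) by (field; lra).
      replace ((1 + x) ^ 2 * (x + 2) * (2 * / ((x + 1) * (x + 2)))) with (2 * (1 + x))
        by (field; lra). nra.
  - pose proof (Hb (INR n - al)). pose proof (Hb (INR 0 - al)). lra.
Qed.

(** * Difference quotients and localized Cauchy integrals *)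

Definition vderiv (v : C -> C) (z : C) : C :=
  match excluded_middle_informative (exists l, cderiv v z l) with
  | left H => proj1_sig (constructive_indefinite_description _ H)
  | right _ => RtoC 0
  end.

(** Filling in the derivative at [z] makes the quotient continuous there, so Goursat's theorem with
    one exceptional point applies. *)
Definition dq (v : C -> C) (z w : C) : C :=
  if excluded_middle_informative (w = z) then vderiv v z else ((v w - v z) * / (w - z))%C.

Lemma vderiv_spec v z : C_differentiable_at v z -> cderiv v z (vderiv v z).
Proof.
  intros H. apply differentiable_cderiv in H. unfold vderiv.
  destruct excluded_middle_informative as [E|E]; [|easy].
  now destruct constructive_indefinite_description.
Qed.

Lemma dq_neq v z w : w <> z -> dq v z w = ((v w - v z) * / (w - z))%C.
Proof. intros H. unfold dq. now destruct excluded_middle_informative. Qed.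

Lemma dq_eq v z : dq v z z = vderiv v z.
Proof. unfold dq. now destruct excluded_middle_informative. Qed.

Lemma dq_ccont v z w : ccont v w -> C_differentiable_at v z -> ccont (dq v z) w.
Proof.
  intros Hv Hd. destruct (classic (w = z)) as [->|Hw].
  - intros e He. destruct (vderiv_spec v z Hd (e / 2)) as [d [Hd0 H]]; [lra|].
    exists d. split; [easy|]. intros w Hw. rewrite dq_eq.
    destruct (classic (w = z)) as [E|E].
    + rewrite E, dq_eq. replace (vderiv v z - vderiv v z)%C with (RtoC 0) by ring.
      rewrite Cmod_0. easy.
    + rewrite dq_neq by easy.
      specialize (H w Hw). assert (Hn : (w - z)%C <> RtoC 0) by now apply Cminus_neq_0.
      assert (Pw : 0 < Cmod (w - z)) by now apply Cmod_gt_0.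
      apply Rle_lt_trans with (e / 2); [|lra].
      apply Rmult_le_reg_r with (Cmod (w - z)); [easy|]. rewrite <- Cmod_mult.
      replace (((v w - v z) * / (w - z) - vderiv v z) * (w - z))%C
        with (v w - v z - vderiv v z * (w - z))%C by (field; easy). exact H.
  - apply ccont_ext with (f := (fun w => (v w - v z) * / (w - z))%C) (r := Cmod (w - z)).
    + now apply Cmod_gt_0, Cminus_neq_0.
    + intros u Hu. symmetry. apply dq_neq. intros ->. rewrite Cmod_minus_sym in Hu. lra.
    + apply (kernel_ccont (fun w => v w - v z)%C); [easy|].
      apply ccont_minus; [easy|apply ccont_const].
Qed.

Lemma dq_differentiable v z w : w <> z -> C_differentiable_at v w -> C_differentiable_at (dq v z) w.
Proof.
  intros Hw Hv. apply differentiable_cderiv in Hv. destruct Hv as [l Hl].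
  eapply cderiv_differentiable.
  apply cderiv_local with (f := (fun w => (v w - v z) * / (w - z))%C) (r := Cmod (w - z)).
  - now apply Cmod_gt_0, Cminus_neq_0.
  - intros u Hu. symmetry. apply dq_neq. intros ->. rewrite Cmod_minus_sym in Hu. lra.
  - apply cderiv_mult; [apply cderiv_minus_const; exact Hl|now apply cderiv_inv_sub].
Qed.

Lemma dq_bound v z w r : w <> z -> Cmod (v w - v z) <= r -> Cmod (dq v z w) <= r / Cmod (w - z).
Proof.
  intros Hw H. rewrite dq_neq, Cmod_mult, Cmod_inv by (auto; now apply Cminus_neq_0).
  apply Rmult_le_compat_r; [|easy]. left. apply Rinv_0_lt_compat. now apply Cmod_gt_0, Cminus_neq_0.
Qed.

Lemma inv_sub_differentiable z w : w <> z -> C_differentiable_at (fun w => / (w - z))%C w.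
Proof. intros H. eapply cderiv_differentiable, cderiv_inv_sub, H. Qed.

Lemma inv_sub_ccont z w : w <> z -> ccont (fun w => / (w - z))%C w.
Proof. intros H. now apply C_differentiable_ccont, inv_sub_differentiable. Qed.

Section Local.
Variables (o : C) (del : R) (P N : nat).
Hypothesis Hdel : 0 < del.
Hypothesis HN : (4 <= N)%nat.

(** Two scales: the tents have radius [del] and sit on a lattice of step [del]; each step is cut
    into [N] grid cells. Estimates must not depend on [N]. The coordinates [cx] and [cy] count
    cells. *)
Definition mesh : R := del / INR N.
Definition msize : nat := (P * N)%nat.

Definition cx (w : C) : R := (fst w - fst o) / mesh.
Definition cy (w : C) : R := (snd w - snd o) / mesh.

Lemma N_ge : 4 <= INR N.
Proof. apply le_INR in HN. simpl in HN. lra. Qed.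

Lemma mesh_pos : 0 < mesh.
Proof. pose proof N_ge. apply Rdiv_lt_0_compat; lra. Qed.

Lemma mesh_N : mesh * INR N = del.
Proof. pose proof N_ge. unfold mesh. field. lra. Qed.

Lemma cx_between w m : gx o mesh m <= fst w <= gx o mesh (S m) <-> INR m <= cx w <= INR m + 1.
Proof.
  pose proof mesh_pos. rewrite gx_S. unfold cx, gx.
  replace (fst w) with (fst o + (fst w - fst o) / mesh * mesh) at 1 2 by (field; lra).
  set (t := (fst w - fst o) / mesh). split; intros [H1 H2]; split; nra.
Qed.

Lemma cy_between w m : gy o mesh m <= snd w <= gy o mesh (S m) <-> INR m <= cy w <= INR m + 1.
Proof.
  pose proof mesh_pos. rewrite gy_S. unfold cy, gy.
  replace (snd w) with (snd o + (snd w - snd o) / mesh * mesh) at 1 2 by (field; lra).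
  set (t := (snd w - snd o) / mesh). split; intros [H1 H2]; split; nra.
Qed.

Lemma hedge_coord m n w : hedge o mesh m n w -> INR m <= cx w <= INR m + 1 /\ cy w = INR n.
Proof.
  pose proof mesh_pos. intros [H1 H2]. split; [now apply cx_between|].
  unfold cy. rewrite H2. unfold gy. field. lra.
Qed.

Lemma vedge_coord m n w : vedge o mesh m n w -> cx w = INR m /\ INR n <= cy w <= INR n + 1.
Proof.
  pose proof mesh_pos. intros [H1 H2]. split; [|now apply cy_between].
  unfold cx. rewrite H1. unfold gx. field. lra.
Qed.

Lemma square_coord m n w :
  square o mesh m n w <-> (INR m <= cx w <= INR m + 1 /\ INR n <= cy w <= INR n + 1).
Proof. unfold square, in_rect. now rewrite cx_between, cy_between. Qed.

Lemma cx_sub w z : fst w - fst z = mesh * (cx w - cx z).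
Proof. pose proof mesh_pos. unfold cx. field. lra. Qed.

Lemma cy_sub w z : snd w - snd z = mesh * (cy w - cy z).
Proof. pose proof mesh_pos. unfold cy. field. lra. Qed.

Lemma cx_Cmod w z : mesh * Rabs (cx w - cx z) <= Cmod (w - z).
Proof.
  pose proof mesh_pos. rewrite <- (Rabs_pos_eq mesh) at 1 by lra.
  rewrite <- Rabs_mult, <- cx_sub. apply (Re_le_Cmod (w - z)).
Qed.

Lemma cy_Cmod w z : mesh * Rabs (cy w - cy z) <= Cmod (w - z).
Proof.
  pose proof mesh_pos. rewrite <- (Rabs_pos_eq mesh) at 1 by lra.
  rewrite <- Rabs_mult, <- cy_sub. apply (Im_le_Cmod (w - z)).
Qed.

Lemma coord_Cmod w z r : Rabs (cx w - cx z) <= r -> Rabs (cy w - cy z) <= r ->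
  Cmod (w - z) <= 2 * (mesh * r).
Proof.
  pose proof mesh_pos. intros H1 H2. apply Cmod_le_parts; simpl.
  - change (Rabs (fst w - fst z) <= mesh * r). rewrite cx_sub, Rabs_mult, (Rabs_pos_eq mesh) by lra.
    now apply Rmult_le_compat_l; [lra|].
  - change (Rabs (snd w - snd z) <= mesh * r). rewrite cy_sub, Rabs_mult, (Rabs_pos_eq mesh) by lra.
    now apply Rmult_le_compat_l; [lra|].
Qed.

Lemma cell_exists t : 0 <= t -> exists m : nat, INR m <= t <= INR m + 1.
Proof. intros H. destruct (nfloor_ex t H) as [m Hm]. exists m. lra. Qed.

Section OneTent.
Variables (p q : nat).
Hypothesis Hp : (1 <= p < P)%nat.
Hypothesis Hq : (1 <= q < P)%nat.

Definition pN : R := INR p * INR N.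
Definition qN : R := INR q * INR N.

(** The tent is sampled at the lower left corner of the square (m, n). *)
Definition phi (m n : nat) : R := tent (INR m / INR N - INR p) * tent (INR n / INR N - INR q).

Definition center : C := (fst o + INR p * del, snd o + INR q * del).

Lemma cx_center : cx center = pN.
Proof. pose proof N_ge. unfold cx, center, mesh, pN. simpl. field. lra. Qed.

Lemma cy_center : cy center = qN.
Proof. pose proof N_ge. unfold cy, center, mesh, qN. simpl. field. lra. Qed.

Lemma tent_scaled_support (m k : nat) : tent (INR m / INR N - INR k) <> 0 ->
  Rabs (INR m - INR k * INR N) < INR N.
Proof.
  pose proof N_ge. intros H0. apply tent_support in H0.
  replace (INR m - INR k * INR N) with ((INR m / INR N - INR k) * INR N) by (field; lra).
  rewrite Rabs_mult, (Rabs_pos_eq (INR N)) by lra. nra.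
Qed.

Lemma phi_support m n : phi m n <> 0 -> Rabs (INR m - pN) < INR N /\ Rabs (INR n - qN) < INR N.
Proof.
  intros H. unfold phi in H.
  split; apply tent_scaled_support; intros E; apply H; rewrite E; ring.
Qed.

Lemma tent_scaled_lip (m m' k : nat) :
  Rabs (tent (INR m / INR N - INR k) - tent (INR m' / INR N - INR k)) <=
  2 / INR N * Rabs (INR m - INR m').
Proof.
  pose proof N_ge. eapply Rle_trans; [apply tent_lip|].
  replace (INR m / INR N - INR k - (INR m' / INR N - INR k)) with ((INR m - INR m') * / INR N)
    by (field; lra).
  rewrite Rabs_mult, (Rabs_pos_eq (/ INR N)) by (left; apply Rinv_0_lt_compat; lra).
  right. field. lra.
Qed.

Lemma phi_lip m n m' n' : Rabs (phi m n - phi m' n') <=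
  2 / INR N * (Rabs (INR m - INR m') + Rabs (INR n - INR n')).
Proof.
  unfold phi. pose proof (tent_scaled_lip m m' p) as H1. pose proof (tent_scaled_lip n n' q) as H2.
  set (a := tent (INR m / INR N - INR p)) in *. set (b := tent (INR n / INR N - INR q)) in *.
  set (a' := tent (INR m' / INR N - INR p)) in *. set (b' := tent (INR n' / INR N - INR q)) in *.
  assert (0 <= b <= 1) by apply tent_range. assert (0 <= a' <= 1) by apply tent_range.
  replace (a * b - a' * b') with ((a - a') * b + a' * (b - b')) by ring.
  eapply Rle_trans; [apply Rabs_triang|]. rewrite !Rabs_mult, (Rabs_pos_eq b), (Rabs_pos_eq a') by lra.
  pose proof (Rabs_pos (a - a')). pose proof (Rabs_pos (b - b')). nra.
Qed.

Lemma INR_succ_diff m : Rabs (INR (S m) - INR m) = 1.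
Proof. rewrite S_INR. replace (INR m + 1 - INR m) with 1 by ring. apply Rabs_R1. Qed.

Lemma phi_step_y m n : Rabs (phi m (S n) - phi m n) <= 2 / INR N.
Proof.
  eapply Rle_trans; [apply phi_lip|]. rewrite INR_succ_diff, Rminus_diag, Rabs_R0. lra.
Qed.

Lemma phi_step_x m n : Rabs (phi (S m) n - phi m n) <= 2 / INR N.
Proof.
  eapply Rle_trans; [apply phi_lip|]. rewrite INR_succ_diff, Rminus_diag, Rabs_R0. lra.
Qed.

Lemma tent_border k : (1 <= k < P)%nat ->
  tent (INR 0 / INR N - INR k) = 0 /\ tent (INR msize / INR N - INR k) = 0.
Proof.
  intros [H1 H2]. pose proof N_ge.
  assert (1 <= INR k) by (apply (le_INR 1); lia).
  assert (INR k + 1 <= INR P) by (rewrite <- S_INR; apply le_INR; lia).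
  split; apply NNPP; intros E; apply tent_support, Rabs_lt_between in E.
  - simpl in E. unfold Rdiv in E. lra.
  - unfold msize in E. rewrite mult_INR in E.
    replace (INR P * INR N / INR N) with (INR P) in E by (field; lra). lra.
Qed.

Lemma phi_border : border msize phi.
Proof.
  intros k. destruct (tent_border p Hp) as [A1 A2]. destruct (tent_border q Hq) as [B1 B2].
  unfold phi. rewrite A1, A2, B1, B2. repeat split; ring.
Qed.

Lemma phi_edge_y m n : phi m (S n) <> phi m n ->
  Rabs (INR m - pN) <= INR N + 1 /\ Rabs (INR n - qN) <= INR N + 1.
Proof.
  intros H. destruct (classic (phi m n = 0)) as [E|E].
  - assert (E' : phi m (S n) <> 0) by congruence. apply phi_support in E'.
    rewrite S_INR in E'. destruct E' as [E1 E2]. apply Rabs_lt_between in E1, E2.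
    split; apply Rabs_le; lra.
  - apply phi_support in E. destruct E as [E1 E2]. split; lra.
Qed.

Lemma phi_edge_x m n : phi (S m) n <> phi m n ->
  Rabs (INR m - pN) <= INR N + 1 /\ Rabs (INR n - qN) <= INR N + 1.
Proof.
  intros H. destruct (classic (phi m n = 0)) as [E|E].
  - assert (E' : phi (S m) n <> 0) by congruence. apply phi_support in E'.
    rewrite S_INR in E'. destruct E' as [E1 E2]. apply Rabs_lt_between in E1, E2.
    split; apply Rabs_le; lra.
  - apply phi_support in E. destruct E as [E1 E2]. split; lra.
Qed.

(** The half-side is [k] in units of [del]. Radius 2 contains the active edges, radius 3 separates
    near from far points [z], and radius 4 is where the oscillation is measured. *)
Definition box (k : R) (w : C) : Prop :=
  Rabs (cx w - pN) <= k * INR N /\ Rabs (cy w - qN) <= k * INR N.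

Lemma phi_active w : active o mesh msize phi w -> box 2 w.
Proof.
  pose proof N_ge. intros [m [n [_ [_ [[H1 H2]|[H1 H2]]]]]].
  - apply hedge_coord in H2. destruct (classic (phi m n = 0)) as [E|E].
    + assert (E' : phi m (S n) <> 0) by congruence. apply phi_support in E'.
      rewrite S_INR in *. destruct E' as [E1 E2]. apply Rabs_lt_between in E1, E2.
      split; apply Rabs_le; lra.
    + apply phi_support in E. rewrite S_INR in *.
      destruct E as [E1 E2]. apply Rabs_lt_between in E1, E2. split; apply Rabs_le; lra.
  - apply vedge_coord in H2. destruct (classic (phi m n = 0)) as [E|E].
    + assert (E' : phi (S m) n <> 0) by congruence. apply phi_support in E'.
      rewrite S_INR in *. destruct E' as [E1 E2]. apply Rabs_lt_between in E1, E2.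
      split; apply Rabs_le; lra.
    + apply phi_support in E. rewrite S_INR in *.
      destruct E as [E1 E2]. apply Rabs_lt_between in E1, E2. split; apply Rabs_le; lra.
Qed.

(** About N^2 active edges, each of length del / N and with a jump of order 1 / N: the total is of
    order del for every [N]. The windows have at most 2 N + 3 <= 3 N indices, so 72 would do for
    100. *)
Lemma EE_phi_bound g G : 0 <= G ->
  (forall w, active o mesh msize phi w -> ccont g w /\ Cmod (g w) <= G) ->
  Cmod (EE o mesh msize phi g) <= 100 * del * G.
Proof.
  intros HG Hg. pose proof N_ge. pose proof mesh_pos.
  set (b := fun (c : R) (m : nat) => if inwin c (INR N + 1) m then 1 else 0).
  assert (Hb : forall c m, 0 <= b c m). { intros. unfold b. destruct inwin; lra. }
  assert (HG2 : 0 <= 2 / INR N * G).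
  { apply Rmult_le_pos; [|easy]. apply Rdiv_le_0_compat; lra. }
  eapply Rle_trans; [apply EE_bound with (D := fun m n => 2 / INR N * G * b pN m * b qN n)|].
  - exact mesh_pos.
  - intros z Hz. now apply Hg.
  - intros m n _ _. apply Rmult_le_pos; [apply Rmult_le_pos|]; auto.
  - intros m n z Hm Hn E Hz. destruct (phi_edge_y m n E) as [W1 W2].
    unfold b. rewrite !inwin_true by easy. rewrite !Rmult_1_r.
    apply Rmult_le_compat; try apply Rabs_pos; try apply Cmod_ge_0; [apply phi_step_y|].
    apply Hg. exists m, n. auto.
  - intros m n z Hm Hn E Hz. destruct (phi_edge_x m n E) as [W1 W2].
    unfold b. rewrite !inwin_true by easy. rewrite !Rmult_1_r.
    apply Rmult_le_compat; try apply Rabs_pos; try apply Cmod_ge_0; [apply phi_step_x|].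
    apply Hg. exists m, n. auto.
  - rewrite (RSum_mult _ _ (fun m => 2 / INR N * G * b pN m) (b qN)), RSum_scal.
    pose proof (window_sum msize pN (INR N + 1) ltac:(lra)) as S1.
    pose proof (window_sum msize qN (INR N + 1) ltac:(lra)) as S2.
    fold (b pN) in S1. fold (b qN) in S2.
    assert (A1 : 0 <= RSum (seq 0 msize) (b pN)) by (apply RSum_nonneg; auto).
    assert (A2 : 0 <= RSum (seq 0 msize) (b qN)) by (apply RSum_nonneg; auto).
    set (s1 := RSum _ (b pN)) in *. set (s2 := RSum _ (b qN)) in *.
    assert (s1 * s2 <= 3 * INR N * (3 * INR N)) by (apply Rmult_le_compat; lra).
    rewrite <- mesh_N.
    replace (4 * mesh * (2 / INR N * G * s1 * s2)) with (8 * mesh / INR N * G * (s1 * s2)) by (field; lra).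
    replace (100 * (mesh * INR N) * G) with (8 * mesh / INR N * G * (25 / 2 * INR N * INR N)) by (field; lra).
    apply Rmult_le_compat_l; [|nra].
    apply Rmult_le_pos; [|easy]. apply Rdiv_le_0_compat; lra.
Qed.

End OneTent.
End Local.

(** * Near and far estimates of one localized piece *)

Section Estimates.
Variables (o : C) (del : R) (P N : nat) (X : C -> Prop).
Hypothesis Hdel : 0 < del.
Hypothesis HN : (4 <= N)%nat.
Hypothesis Hmargin : forall x, X x ->
  2 * INR N <= cx o del N x <= INR (msize P N) - 2 * INR N /\
  2 * INR N <= cy o del N x <= INR (msize P N) - 2 * INR N.

Let h := mesh del N.
Let M := msize P N.
Let X1 := cx o del N.
Let Y1 := cy o del N.

(** Two cells, so that for every point of [X] the three by three block around its cell lies in the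
    region of holomorphy. *)
Definition holo_near (v : C -> C) : Prop :=
  (forall w, ccont v w) /\
  forall x w, X x -> Rabs (X1 w - X1 x) <= 2 -> Rabs (Y1 w - Y1 x) <= 2 -> C_differentiable_at v w.

Lemma holo_near_at v z : holo_near v -> X z -> C_differentiable_at v z.
Proof.
  intros [_ H] Hz. apply (H z z Hz); rewrite Rminus_diag, Rabs_R0; lra.
Qed.

Lemma holo_near_closed : lin_closed holo_near.
Proof.
  intros u v c [Hu1 Hu2] [Hv1 Hv2]. split.
  - intros w. apply ccont_plus; [auto|]. apply ccont_mult; [apply ccont_const|auto].
  - intros x w Hx H1 H2. specialize (Hu2 x w Hx H1 H2). specialize (Hv2 x w Hx H1 H2).
    apply differentiable_cderiv in Hu2, Hv2. destruct Hu2 as [l Hl]. destruct Hv2 as [k Hk].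
    apply cderiv_differentiable with (l + c * k)%C. intros e He.
    pose proof (Cmod_ge_0 c) as Pc.
    destruct (Hl (e / 2)) as [d1 [Hd1 K1]]; [lra|].
    destruct (Hk (e / (2 * (Cmod c + 1)))) as [d2 [Hd2 K2]]; [apply Rdiv_lt_0_compat; lra|].
    exists (Rmin d1 d2). split; [now apply Rmin_glb_lt|]. intros w' Hw.
    assert (A1 : Cmod (w' - w) < d1) by (eapply Rlt_le_trans; [exact Hw|apply Rmin_l]).
    assert (A2 : Cmod (w' - w) < d2) by (eapply Rlt_le_trans; [exact Hw|apply Rmin_r]).
    specialize (K1 w' A1). specialize (K2 w' A2).
    replace (u w' + c * v w' - (u w + c * v w) - (l + c * k) * (w' - w))%C
      with ((u w' - u w - l * (w' - w)) + c * (v w' - v w - k * (w' - w)))%C by ring.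
    eapply Rle_trans; [apply Cmod_triangle|]. rewrite Cmod_mult.
    pose proof (Cmod_ge_0 (w' - w)).
    assert (Cmod c * Cmod (v w' - v w - k * (w' - w)) <= e / 2 * Cmod (w' - w)); [|lra].
    eapply Rle_trans; [apply Rmult_le_compat_l; [easy|exact K2]|].
    rewrite <- Rmult_assoc. apply Rmult_le_compat_r; [easy|].
    replace (e / 2) with ((Cmod c + 1) * (e / (2 * (Cmod c + 1)))) by (field; lra).
    apply Rmult_le_compat_r; [|lra]. apply Rdiv_le_0_compat; lra.
Qed.

Definition badw (f : nat -> nat -> R) (m n : nat) : R :=
  if excluded_middle_informative (exists x, X x /\ square o h m n x) then 0 else f m n.

(** Only squares missing [X] are kept. Hence [TT f v] is a Cauchy integral off [X] and lies in [RL]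
    for every continuous [v] ([RL_TT]), while for [v] holomorphic near [X] the dropped squares cost
    nothing ([TT_dq]). *)
Definition TT (f : nat -> nat -> R) (v : C -> C) (z : C) : C :=
  AA o h M (badw f) (fun w => v w * / (w - z))%C.

Lemma Sq_dq_zero v z m n : holo_near v -> X z ->
  (forall w, square o h m n w ->
     exists x, X x /\ Rabs (X1 w - X1 x) <= 2 /\ Rabs (Y1 w - Y1 x) <= 2) ->
  Sq o h (dq v z) m n = RtoC 0.
Proof.
  intros Hv Hz H. apply Sq_Goursat with z.
  - now apply mesh_pos.
  - intros w _. apply dq_ccont; [apply Hv|now apply holo_near_at].
  - intros w Hw Hn. apply dq_differentiable; [easy|]. destruct (H w Hw) as [x [Hx [A B]]].
    now apply (proj2 Hv x w).
Qed.

Lemma square_close m n w x : square o h m n w -> square o h m n x ->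
  Rabs (X1 w - X1 x) <= 1 /\ Rabs (Y1 w - Y1 x) <= 1.
Proof.
  intros H1 H2. apply square_coord in H1, H2; auto.
  unfold X1, Y1. split; apply Rabs_le; lra.
Qed.

(** On a square meeting [X] the difference quotient integrates to 0 by Goursat's theorem. On a
    square missing [X] the point [z] is outside, so the extra term v z / (w - z) integrates to 0. *)
Lemma TT_dq f v z : holo_near v -> X z -> TT f v z = AA o h M f (dq v z).
Proof.
  intros Hv Hz. unfold TT, AA. apply Sum_ext. intros m _. apply Sum_ext. intros n _.
  unfold badw. destruct excluded_middle_informative as [[x [Hx Hsq]]|Hno].
  - rewrite (Sq_dq_zero v z m n Hv Hz); [ring|].
    intros w Hw. exists x. destruct (square_close m n w x Hw Hsq). split; [easy|]. split; lra.
  - f_equal.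
    assert (Hne : forall w, square o h m n w -> w <> z).
    { intros w Hw ->. apply Hno. eauto. }
    pose proof (mesh_pos del N Hdel HN) as Hh. fold h in Hh.
    rewrite (Sq_ext o h Hh _ (fun w => dq v z w + v z * / (w - z))%C).
    2: { intros w Hw. rewrite dq_neq by auto. ring. }
    assert (Cd : forall w, ccont (dq v z) w).
    { intros w. apply dq_ccont; [apply Hv|now apply holo_near_at]. }
    assert (Ci : forall w, square o h m n w -> ccont (fun w => / (w - z))%C w).
    { intros w Hw. apply inv_sub_ccont. auto. }
    rewrite (Sq_plus o h Hh (dq v z) (fun w => v z * / (w - z))%C); [|auto|].
    2: { intros w Hw. apply ccont_mult; [apply ccont_const|auto]. }
    rewrite (Sq_scal o h Hh (v z) (fun w => / (w - z))%C) by auto.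
    rewrite (Sq_Goursat o h Hh (fun w => / (w - z))%C z m n Ci); [ring|].
    intros w Hw _. apply inv_sub_differentiable. auto.
Qed.

Lemma INR_dist_dichotomy (m k : nat) : Rabs (INR m - INR k) <= 1 \/ 2 <= Rabs (INR m - INR k).
Proof.
  destruct (Nat.le_gt_cases m k) as [H|H].
  - rewrite Rabs_minus_sym, <- minus_INR by easy. rewrite Rabs_pos_eq by apply pos_INR.
    destruct (Nat.le_gt_cases (k - m) 1) as [H1|H1].
    + left. now apply (le_INR _ 1).
    + right. now apply (le_INR 2).
  - rewrite <- minus_INR by lia. rewrite Rabs_pos_eq by apply pos_INR.
    destruct (Nat.le_gt_cases (m - k) 1) as [H1|H1].
    + left. now apply (le_INR _ 1).
    + right. now apply (le_INR 2).
Qed.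

(** The sup distance dominates the geometric mean of the coordinate distances. This separates the
    variables: the double sum of 1 / distance becomes a product of two sums of inverse square
    roots. *)
Lemma edge_distance (m n m0 n0 : nat) (x y a b : R) :
  INR m <= x <= INR m + 1 -> INR n <= y <= INR n + 1 ->
  INR m0 <= a <= INR m0 + 1 -> INR n0 <= b <= INR n0 + 1 ->
  1 <= Rmax (Rabs (x - a)) (Rabs (y - b)) ->
  sqrt (1 + Rabs (INR m - INR m0)) * sqrt (1 + Rabs (INR n - INR n0))
   <= 3 * Rmax (Rabs (x - a)) (Rabs (y - b)).
Proof.
  intros H1 H2 H3 H4 H5. set (d := Rmax _ _) in *.
  assert (A1 : Rabs (x - a) <= d) by apply Rmax_l. assert (A2 : Rabs (y - b) <= d) by apply Rmax_r.
  apply Rabs_le_between in A1, A2.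
  assert (B1 : Rabs (INR m - INR m0) <= d + 1) by (apply Rabs_le; lra).
  assert (B2 : Rabs (INR n - INR n0) <= d + 1) by (apply Rabs_le; lra).
  rewrite <- (sqrt_sqrt (3 * d)) by lra.
  apply Rmult_le_compat; try apply sqrt_pos; apply sqrt_le_1_alt; lra.
Qed.

Section OneTentEstimates.
Variables (p q : nat).
Hypothesis Hp : (1 <= p < P)%nat.
Hypothesis Hq : (1 <= q < P)%nat.

Let ph := phi N p q.
Let bx := box o del N p q.

Definition osc (u : C -> C) (r : R) : Prop :=
  forall w w', bx 4 w -> bx 4 w' -> Cmod (u w - u w') <= r.

Lemma osc_seminorm : seminorm_like osc.
Proof.
  split.
  - intros u v c r s Hu Hv w w' Hw Hw'.
    replace (u w + c * v w - (u w' + c * v w'))%C with ((u w - u w') + c * (v w - v w'))%C by ring.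
    eapply Rle_trans; [apply Cmod_triangle|]. rewrite Cmod_mult. apply Rplus_le_compat; [auto|].
    apply Rmult_le_compat_l; [apply Cmod_ge_0|auto].
  - intros u r s Hu Hrs w w' Hw Hw'. eapply Rle_trans; [now apply Hu|easy].
Qed.

(** The oscillation of [u] does not control [dq u z] close to [z]. So the weight is made constant on
    the three by three block around the cell of [z], where the square integrals vanish; the
    remaining active edges are at least one cell away from [z], and there |dq u z| <= r /
    distance. *)
Lemma near_estimate u z r : holo_near u -> X z -> bx 3 z -> 0 <= r -> osc u r ->
  Cmod (AA o h M ph (dq u z)) <= 10000 * r.
Proof.
  intros Hu Hz Hb Hr Ho. pose proof (N_ge N HN) as HN4. pose proof (mesh_pos del N Hdel HN) as Hh.
  fold h in Hh.
  destruct (Hmargin z Hz) as [Mx My]. fold M in Mx, My.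
  destruct (cell_exists (X1 z)) as [m0 Hm0]; [unfold X1; lra|].
  destruct (cell_exists (Y1 z)) as [n0 Hn0]; [unfold Y1; lra|].
  set (B := fun m n : nat => Rabs (INR m - INR m0) <= 1 /\ Rabs (INR n - INR n0) <= 1).
  set (ph' := fun m n => if excluded_middle_informative (B m n) then ph m0 n0 else ph m n).
  assert (HB : forall m n, B m n -> ph' m n = ph m0 n0).
  { intros m n H. unfold ph'. now destruct excluded_middle_informative. }
  assert (HnB : forall m n, ~ B m n -> ph' m n = ph m n).
  { intros m n H. unfold ph'. now destruct excluded_middle_informative. }
  assert (E1 : AA o h M ph (dq u z) = AA o h M ph' (dq u z)).
  { apply AA_ext_weights. intros m n _ _ Hne.
    destruct (classic (B m n)) as [[B1 B2]|Hn]; [|now rewrite HnB in Hne].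
    apply Sq_dq_zero; auto. intros w Hw. exists z. split; [easy|].
    apply square_coord in Hw; auto. fold (X1 w) (Y1 w) in Hw.
    apply Rabs_le_between in B1, B2. split; apply Rabs_le; lra. }
  assert (Hbd : border M ph').
  { intros k. destruct (phi_border P N HN p q Hp Hq k) as [K1 [K2 [K3 K4]]].
    fold M ph in K1, K2, K3, K4. unfold X1, Y1 in *.
    repeat split; rewrite HnB; auto; intros [B1 B2]; apply Rabs_le_between in B1, B2; simpl in *; lra. }
  rewrite E1, AA_EE by easy.
  (* Across the border of the block the new weight compares values of [ph] at lattice points at most
     3 apart in the sum norm; the bound allows 4. *)
  assert (Hlip : forall m n m' n', Rabs (INR m - INR m') + Rabs (INR n - INR n') <= 1 ->
    Rabs (ph' m n - ph' m' n') <= 8 / INR N).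
  { intros m n m' n' Hd.
    assert (Pos : 0 < 2 / INR N) by (apply Rdiv_lt_0_compat; lra).
    replace (8 / INR N) with (2 / INR N * 4) by (field; lra).
    assert (T : forall a b c : R, Rabs (a - c) <= Rabs (a - b) + Rabs (b - c)).
    { intros. replace (a - c) with ((a - b) + (b - c)) by ring. apply Rabs_triang. }
    destruct (classic (B m n)) as [H1|H1], (classic (B m' n')) as [H2|H2].
    - rewrite !HB, Rminus_diag, Rabs_R0 by easy. lra.
    - rewrite (HB m n), (HnB m' n') by easy. eapply Rle_trans; [apply phi_lip, HN|].
      apply Rmult_le_compat_l; [lra|]. destruct H1 as [H1 H1'].
      pose proof (T (INR m0) (INR m) (INR m')). pose proof (T (INR n0) (INR n) (INR n')).
      rewrite (Rabs_minus_sym (INR m0) (INR m)) in *. rewrite (Rabs_minus_sym (INR n0) (INR n)) in *. lra.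
    - rewrite (HB m' n'), (HnB m n) by easy. eapply Rle_trans; [apply phi_lip, HN|].
      apply Rmult_le_compat_l; [lra|]. destruct H2 as [H2 H2'].
      pose proof (T (INR m) (INR m') (INR m0)). pose proof (T (INR n) (INR n') (INR n0)). lra.
    - rewrite !HnB by easy. eapply Rle_trans; [apply phi_lip, HN|]. apply Rmult_le_compat_l; lra. }
  destruct Hb as [Hbx Hby]. fold (X1 z) in Hbx. fold (Y1 z) in Hby.
  apply Rabs_le_between in Hbx, Hby.
  (* Both kinds of edges at once: the last two premises place [w] on the upper edge (m' = m) or on
     the right edge (n' = n) of the square (m, n). *)
  assert (Hedge : forall m n m' n' w, ph' m' n' <> ph' m n ->
    (m' = m /\ n' = S n \/ m' = S m /\ n' = n) ->
    INR m <= X1 w <= INR m + 1 -> INR n <= Y1 w <= INR n + 1 ->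
    (m' = m -> Y1 w = INR n + 1) -> (n' = n -> X1 w = INR m + 1) ->
    inwin (INR m0) (4 * INR N + 4) m = true /\ inwin (INR n0) (4 * INR N + 4) n = true /\
    Rabs (ph' m' n' - ph' m n) <= 8 / INR N /\
    Cmod (dq u z w) <= 3 * r / h * (/ sqrt (1 + Rabs (INR m - INR m0)) * / sqrt (1 + Rabs (INR n - INR n0)))).
  { intros m n m' n' w Hne Hadj Hx Hy Ey Ex.
    assert (Hadj' : INR m <= INR m' <= INR m + 1 /\ INR n <= INR n' <= INR n + 1 /\
      Rabs (INR m' - INR m) + Rabs (INR n' - INR n) <= 1).
    { destruct Hadj as [[-> ->]|[-> ->]]; rewrite S_INR, Rminus_diag, Rabs_R0;
      match goal with |- context [Rabs (?t + 1 - ?t)] => replace (t + 1 - t) with 1 by ring end;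
      rewrite Rabs_R1; lra. }
    destruct Hadj' as [Am [An Ad]].
    assert (Hnot : ~ (B m n /\ B m' n')).
    { intros [H1 H2]. apply Hne. now rewrite !HB. }
    assert (Hloc : (Rabs (INR m - pN N p) <= INR N + 1 /\ Rabs (INR n - qN N q) <= INR N + 1) \/
      (Rabs (INR m - INR m0) <= 2 /\ Rabs (INR n - INR n0) <= 2)).
    { destruct (classic (B m n)) as [[K1 K2]|H1]; [right; lra|].
      destruct (classic (B m' n')) as [[K1 K2]|H2].
      - right. apply Rabs_le_between in K1, K2. split; apply Rabs_le; lra.
      - left. rewrite !HnB in Hne by easy.
        destruct Hadj as [[-> ->]|[-> ->]]; [now apply phi_edge_y|now apply phi_edge_x]. }
    assert (Hwin : Rabs (INR m - INR m0) <= 4 * INR N + 4 /\ Rabs (INR n - INR n0) <= 4 * INR N + 4).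
    { destruct Hloc as [[K1 K2]|[K1 K2]]; apply Rabs_le_between in K1, K2; split; apply Rabs_le; lra. }
    assert (Hbox : bx 4 w).
    { unfold bx, box. fold (X1 w) (Y1 w).
      destruct Hloc as [[K1 K2]|[K1 K2]]; apply Rabs_le_between in K1, K2; split; apply Rabs_le; lra. }
    assert (Hd1 : 1 <= Rmax (Rabs (X1 w - X1 z)) (Rabs (Y1 w - Y1 z))).
    { destruct (INR_dist_dichotomy m m0) as [D1|D1].
      2: { eapply Rle_trans; [|apply Rmax_l]. unfold Rabs in D1. destruct Rcase_abs in D1.
           - rewrite Rabs_minus_sym. eapply Rle_trans; [|apply Rle_abs]. lra.
           - eapply Rle_trans; [|apply Rle_abs]. lra. }
      destruct (INR_dist_dichotomy n n0) as [D2|D2].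
      2: { eapply Rle_trans; [|apply Rmax_r]. unfold Rabs in D2. destruct Rcase_abs in D2.
           - rewrite Rabs_minus_sym. eapply Rle_trans; [|apply Rle_abs]. lra.
           - eapply Rle_trans; [|apply Rle_abs]. lra. }
      assert (HBmn : B m n) by (split; auto).
      destruct Hadj as [[-> ->]|[-> ->]].
      - destruct (INR_dist_dichotomy (S n) n0) as [D3|D3].
        { exfalso. apply Hnot. split; split; auto. }
        rewrite S_INR in D3. apply Rabs_le_between in D2.
        eapply Rle_trans; [|apply Rmax_r]. eapply Rle_trans; [|apply Rle_abs].
        rewrite Ey by easy. unfold Rabs in D3. destruct Rcase_abs in D3; lra.
      - destruct (INR_dist_dichotomy (S m) m0) as [D3|D3].
        { exfalso. apply Hnot. split; split; auto. }
        rewrite S_INR in D3. apply Rabs_le_between in D1.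
        eapply Rle_trans; [|apply Rmax_l]. eapply Rle_trans; [|apply Rle_abs].
        rewrite Ex by easy. unfold Rabs in D3. destruct Rcase_abs in D3; lra. }
    split; [now apply inwin_true|]. split; [now apply inwin_true|]. split; [now apply Hlip|].
    pose proof (edge_distance m n m0 n0 (X1 w) (Y1 w) (X1 z) (Y1 z) Hx Hy Hm0 Hn0 Hd1) as Hdist.
    set (d := Rmax _ _) in *.
    assert (Hcm : h * d <= Cmod (w - z)).
    { unfold d, Rmax. destruct Rle_dec; [apply cy_Cmod|apply cx_Cmod]; auto. }
    assert (Hcp : 0 < Cmod (w - z)) by nra.
    assert (Hwz : w <> z).
    { intros ->. replace (z - z)%C with (RtoC 0) in Hcp by ring. rewrite Cmod_0 in Hcp. lra. }
    eapply Rle_trans.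
    { apply (dq_bound u z w r Hwz). apply Ho; [easy|]. split; apply Rabs_le; fold (X1 z) (Y1 z); lra. }
    set (s1 := sqrt _) in *. set (s2 := sqrt (1 + Rabs (INR n - INR n0))) in *.
    assert (P1 : 0 < s1) by (apply sqrt_lt_R0; pose proof (Rabs_pos (INR m - INR m0)); lra).
    assert (P2 : 0 < s2) by (apply sqrt_lt_R0; pose proof (Rabs_pos (INR n - INR n0)); lra).
    assert (P12 : 0 < s1 * s2) by nra.
    apply Rle_trans with (r / (h * d)).
    { apply Rmult_le_compat_l; [easy|]. apply Rinv_le_contravar; nra. }
    replace (3 * r / h * (/ s1 * / s2)) with (r / h * (3 / (s1 * s2))) by (field; lra).
    replace (r / (h * d)) with (r / h * (/ d)) by (field; lra).
    apply Rmult_le_compat_l; [apply Rdiv_le_0_compat; lra|].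
    apply Rmult_le_reg_l with (d * (s1 * s2)); [nra|].
    replace (d * (s1 * s2) * / d) with (s1 * s2) by (field; lra).
    replace (d * (s1 * s2) * (3 / (s1 * s2))) with (3 * d) by (field; lra). exact Hdist. }
  set (s := fun (c : nat) (m : nat) =>
    if inwin (INR c) (4 * INR N + 4) m then / sqrt (1 + Rabs (INR m - INR c)) else 0).
  assert (Hs : forall c m, 0 <= s c m).
  { intros c m. unfold s. destruct inwin; [|lra]. left. apply Rinv_0_lt_compat, sqrt_lt_R0.
    pose proof (Rabs_pos (INR m - INR c)). lra. }
  assert (K0 : 0 <= 8 / INR N * (3 * r / h)).
  { apply Rmult_le_pos; apply Rdiv_le_0_compat; lra. }
  assert (HD : forall a b c1 c2 : R, 0 <= a -> 0 <= b -> a <= 8 / INR N -> b <= 3 * r / h * (c1 * c2) ->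
    a * b <= 8 / INR N * (3 * r / h) * c1 * c2).
  { intros a b c1 c2 H1 H2 H3 H4.
    replace (8 / INR N * (3 * r / h) * c1 * c2) with (8 / INR N * (3 * r / h * (c1 * c2))) by ring.
    apply Rmult_le_compat; auto. }
  eapply Rle_trans; [apply EE_bound with (D := fun m n => 8 / INR N * (3 * r / h) * s m0 m * s n0 n)|].
  - exact Hh.
  - intros w _. apply dq_ccont; [apply Hu|now apply holo_near_at].
  - intros m n _ _. apply Rmult_le_pos; [apply Rmult_le_pos|]; auto.
  - intros m n w _ _ Hne Hw. apply hedge_coord in Hw; auto. fold (X1 w) (Y1 w) in Hw.
    rewrite S_INR in Hw. destruct Hw as [W1 W2].
    destruct (Hedge m n m (S n) w Hne) as [F1 [F2 [F3 F4]]]; auto; [lra|lia|].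
    unfold s. rewrite F1, F2. apply HD; auto using Rabs_pos, Cmod_ge_0.
  - intros m n w _ _ Hne Hw. apply vedge_coord in Hw; auto. fold (X1 w) (Y1 w) in Hw.
    rewrite S_INR in Hw. destruct Hw as [W1 W2].
    destruct (Hedge m n (S m) n w Hne) as [F1 [F2 [F3 F4]]]; auto; [lra|lia|].
    unfold s. rewrite F1, F2. apply HD; auto using Rabs_pos, Cmod_ge_0.
  - rewrite (RSum_mult _ _ (fun m => 8 / INR N * (3 * r / h) * s m0 m) (s n0)), RSum_scal.
    pose proof (sqrt_window_sum M (INR m0) (4 * INR N + 4) ltac:(lra)) as S1.
    pose proof (sqrt_window_sum M (INR n0) (4 * INR N + 4) ltac:(lra)) as S2.
    fold (s m0) in S1. fold (s n0) in S2.
    assert (A1 : 0 <= RSum (seq 0 M) (s m0)) by (apply RSum_nonneg; auto).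
    assert (A2 : 0 <= RSum (seq 0 M) (s n0)) by (apply RSum_nonneg; auto).
    set (s1 := RSum _ (s m0)) in *. set (s2 := RSum _ (s n0)) in *.
    pose proof (sqrt_pos (4 * INR N + 4 + 1)) as Q0.
    pose proof (sqrt_sqrt (4 * INR N + 4 + 1) ltac:(lra)) as Q.
    set (sq := sqrt (4 * INR N + 4 + 1)) in *.
    assert (Q2 : s1 * s2 <= (4 * sq) * (4 * sq)) by (apply Rmult_le_compat; lra).
    (* The mesh cancels: 96 r / N meets s1 * s2 <= 16 * (4 N + 5) <= 84 N. *)
    replace (4 * h * (8 / INR N * (3 * r / h) * s1 * s2)) with (96 * r / INR N * (s1 * s2))
      by (field; lra).
    replace (10000 * r) with (96 * r / INR N * (10000 / 96 * INR N)) by (field; lra).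
    apply Rmult_le_compat_l; [apply Rdiv_le_0_compat; lra|]. nra.
Qed.

(** The coefficients of the expansion of the piece at infinity. Subtracting the value at the center
    makes them bounded by the oscillation. *)
Definition moment (l : nat) (u : C -> C) : C :=
  EE o h M ph (fun w => (u w - u (center o del p q)) * (w - center o del p q) ^ l)%C.

Lemma box_center k : 0 <= k -> bx k (center o del p q).
Proof.
  intros Hk. pose proof (N_ge N HN). unfold bx, box. rewrite cx_center, cy_center by auto.
  rewrite !Rminus_diag, Rabs_R0. split; nra.
Qed.

Lemma box_mono k k' w : k <= k' -> bx k w -> bx k' w.
Proof.
  intros Hk [H1 H2]. pose proof (N_ge N HN).
  assert (k * INR N <= k' * INR N) by (apply Rmult_le_compat_r; lra). split; lra.
Qed.

Lemma box_center_dist w : bx 2 w -> Cmod (w - center o del p q) <= 4 * del.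
Proof.
  intros [H1 H2]. eapply Rle_trans.
  { apply (coord_Cmod o del N Hdel HN w (center o del p q) (2 * INR N)).
    - rewrite cx_center by auto. exact H1.
    - rewrite cy_center by auto. exact H2. }
  pose proof (mesh_N del N HN). nra.
Qed.

Lemma ccont_moment_integrand l u w : ccont u w ->
  ccont (fun w => (u w - u (center o del p q)) * (w - center o del p q) ^ l)%C w.
Proof.
  intros Hu. apply ccont_mult.
  - apply ccont_minus; [easy|apply ccont_const].
  - induction l as [|l IH]; simpl; [apply ccont_const|].
    apply ccont_mult; [|exact IH]. apply ccont_minus; [apply ccont_id|apply ccont_const].
Qed.

Lemma moment_linear l : linear_on (fun u => forall w, ccont u w) (moment l).
Proof.
  pose proof (mesh_pos del N Hdel HN) as Hh. fold h in Hh.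
  intros u v c Hu Hv. unfold moment. rewrite <- (EE_lin o h M Hh).
  - apply (EE_ext o h M Hh). intros w _. ring.
  - intros w _. now apply ccont_moment_integrand.
  - intros w _. now apply ccont_moment_integrand.
Qed.

Lemma moment_bound l u r : (l < 3)%nat -> 0 <= r -> (forall w, ccont u w) -> osc u r ->
  Cmod (moment l u) <= 100 * del * (1 + 4 * del) ^ 2 * r.
Proof.
  intros Hl Hr Hu Ho. replace (100 * del * (1 + 4 * del) ^ 2 * r)
    with (100 * del * ((1 + 4 * del) ^ 2 * r)) by ring.
  apply EE_phi_bound; auto.
  - apply Rmult_le_pos; [|easy]. apply pow2_ge_0.
  - intros w Hw. split; [now apply ccont_moment_integrand|].
    apply phi_active in Hw; auto. fold (bx 2 w) in Hw.
    rewrite Cmod_mult, Cmod_pow', Rmult_comm.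
    apply Rmult_le_compat; auto using Cmod_ge_0.
    + apply pow_le, Cmod_ge_0.
    (* The added 1 makes the square a common bound for the exponents 0, 1, 2. *)
    + apply Rle_trans with ((1 + 4 * del) ^ l).
      * apply pow_incr. split; [apply Cmod_ge_0|]. pose proof (box_center_dist w Hw). lra.
      * apply Rle_pow; [lra|lia].
    + apply Ho; [|apply box_center; lra]. apply box_mono with 2; [lra|easy].
Qed.

(** With t = w - zc, 1 / (w - z) = - 1/w0 - t/w0^2 - t^2/w0^3 + t^3 / (w0^3 (w - z)). The first
    three terms give the moments; the last is of order del^3 / rho^4, and [EE_phi_bound] adds a
    factor del. The constant c - u z integrates to 0 because [z] is off the support of the tent. *)
Lemma far_estimate u z r kap : holo_near u -> X z -> ~ bx 3 z -> 0 <= r -> 0 <= kap -> osc u r ->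
  (forall l, (l < 3)%nat -> Cmod (moment l u) <= kap) ->
  let rho := h * Rmax (Rabs (X1 z - pN N p)) (Rabs (Y1 z - qN N q)) in
  Cmod (AA o h M ph (dq u z)) <=
    kap * (/ rho + / rho ^ 2 + / rho ^ 3) + 20000 * r * (del / rho) ^ 4.
Proof.
  intros Hu Hz Hb Hr Hk Ho Hm. pose proof (N_ge N HN) as HN4.
  pose proof (mesh_pos del N Hdel HN) as Hh. fold h in Hh.
  set (mu := Rmax (Rabs (X1 z - pN N p)) (Rabs (Y1 z - qN N q))). intros rho.
  assert (Hmu : 3 * INR N < mu).
  { unfold mu. apply Rnot_le_lt. intros Hle. apply Hb. split.
    - eapply Rle_trans; [apply Rmax_l|exact Hle].
    - eapply Rle_trans; [apply Rmax_r|exact Hle]. }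
  set (zc := center o del p q). set (w0 := (z - zc)%C). set (c := u zc).
  assert (Hrho : 3 * del < rho).
  { unfold rho. pose proof (mesh_N del N HN) as E. fold h in E. nra. }
  assert (Hw0 : rho <= Cmod w0).
  { unfold rho, w0, mu, Rmax.
    pose proof (cx_Cmod o del N Hdel HN z zc) as K1. pose proof (cy_Cmod o del N Hdel HN z zc) as K2.
    unfold zc in K1, K2. rewrite cx_center in K1 by auto. rewrite cy_center in K2 by auto.
    destruct Rle_dec; [exact K2|exact K1]. }
  assert (Hn0 : w0 <> RtoC 0). { intros E. rewrite E, Cmod_0 in Hw0. lra. }
  assert (Hact : forall w, active o h M ph w -> bx 2 w) by (intros w Hw; now apply phi_active in Hw).
  (* [w] is within 2 N cells of the center and mu > 3 N, so mu - 2 N >= mu / 3. *)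
  assert (Hwz : forall w, bx 2 w -> rho / 3 <= Cmod (w - z)).
  { intros w [W1 W2]. apply Rle_trans with (h * (mu - 2 * INR N)).
    { unfold rho. replace (h * mu / 3) with (h * (mu / 3)) by field.
      apply Rmult_le_compat_l; lra. }
    fold (X1 w) in W1. fold (Y1 w) in W2. apply Rabs_le_between in W1, W2.
    unfold mu, Rmax. destruct Rle_dec.
    - eapply Rle_trans; [|apply (cy_Cmod o del N Hdel HN w z)]. fold h. apply Rmult_le_compat_l; [lra|].
      fold (Y1 w) (Y1 z). unfold Rabs; repeat destruct Rcase_abs; lra.
    - eapply Rle_trans; [|apply (cx_Cmod o del N Hdel HN w z)]. fold h. apply Rmult_le_compat_l; [lra|].
      fold (X1 w) (X1 z). unfold Rabs; repeat destruct Rcase_abs; lra. }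
  assert (Hne : forall w, bx 2 w -> w <> z).
  { intros w Hw ->. specialize (Hwz z Hw). replace (z - z)%C with (RtoC 0) in Hwz by ring.
    rewrite Cmod_0 in Hwz. lra. }
  rewrite AA_EE by now apply phi_border.
  set (f := fun (l : nat) w => ((u w - c) * (w - zc) ^ l)%C).
  set (k := fun w => (/ (w - z))%C).
  set (Rem := fun w => ((f 3%nat w * / (w - z)) * / (w0 * w0 * w0))%C).
  assert (Cf : forall l w, ccont (f l) w) by (intros; apply ccont_moment_integrand, Hu).
  assert (Ck : forall w, active o h M ph w -> ccont k w).
  { intros w Hw. apply inv_sub_ccont, Hne, Hact, Hw. }
  assert (CR : forall w, active o h M ph w -> ccont Rem w).
  { intros w Hw. apply ccont_mult; [|apply ccont_const]. apply ccont_mult; [apply Cf|now apply Ck]. }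
  rewrite (EE_ext o h M Hh ph (dq u z) (fun w => ((((Rem w + (- / w0) * f 0%nat w)
     + (- / (w0 * w0)) * f 1%nat w) + (- / (w0 * w0 * w0)) * f 2%nat w) + (c - u z) * k w))%C).
  2: { intros w Hw. assert (Hz' := Hne w (Hact w Hw)). rewrite dq_neq by easy.
       assert ((w - z)%C <> RtoC 0) by now apply Cminus_neq_0.
       unfold Rem, k, f. simpl. replace (w - zc)%C with ((w - z) + w0)%C by (unfold w0; ring).
       field. auto. }
  rewrite EE_lin; auto.
  2: { intros w Hw. repeat apply ccont_plus; auto; apply ccont_mult; auto using ccont_const. }
  rewrite EE_lin; auto.
  2: { intros w Hw. repeat apply ccont_plus; auto; apply ccont_mult; auto using ccont_const. }
  rewrite EE_lin; auto.
  2: { intros w Hw. repeat apply ccont_plus; auto; apply ccont_mult; auto using ccont_const. }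
  rewrite EE_lin; auto.
  assert (Ek : EE o h M ph k = RtoC 0).
  { rewrite <- AA_EE by now apply phi_border.
    unfold AA. apply Sum_zero. intros m _. apply Sum_zero. intros n _.
    destruct (classic (ph m n = 0)) as [E|E]; [rewrite E; ring|].
    apply phi_support in E; auto. destruct E as [E1 E2]. apply Rabs_lt_between in E1, E2.
    assert (Hin : forall w, square o h m n w -> bx 2 w).
    { intros w Hw. apply square_coord in Hw; auto. split; apply Rabs_le; lra. }
    rewrite (Sq_Goursat o h Hh k z); [ring| |].
    - intros w Hw. apply inv_sub_ccont. auto.
    - intros w Hw _. apply inv_sub_differentiable. auto. }
  rewrite Ek.
  change (EE o h M ph (f 0%nat)) with (moment 0 u). change (EE o h M ph (f 1%nat)) with (moment 1 u).
  change (EE o h M ph (f 2%nat)) with (moment 2 u).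
  assert (HR : Cmod (EE o h M ph Rem) <= 20000 * r * (del / rho) ^ 4).
  { eapply Rle_trans.
    - apply EE_phi_bound with (G := r * (4 * del) ^ 3 * (3 / rho) * / rho ^ 3); auto.
      + apply Rmult_le_pos; [apply Rmult_le_pos; [apply Rmult_le_pos|]|]; auto.
        * apply pow_le. lra.
        * apply Rdiv_le_0_compat; lra.
        * left. apply Rinv_0_lt_compat, pow_lt. lra.
      + intros w Hw. split; [now apply CR|]. apply Hact in Hw. unfold Rem, f.
        assert ((w - z)%C <> RtoC 0) by now apply Cminus_neq_0, Hne.
        rewrite !Cmod_mult, !Cmod_inv, !Cmod_mult, Cmod_pow' by (repeat apply Cmult_neq_0; auto).
        assert (D1 : Cmod (u w - c) <= r).
        { apply Ho; [|apply box_center; lra]. apply box_mono with 2; [lra|easy]. }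
        assert (D2 : Cmod (w - zc) ^ 3 <= (4 * del) ^ 3).
        { apply pow_incr. split; [apply Cmod_ge_0|now apply box_center_dist]. }
        assert (D3 : / Cmod (w - z) <= 3 / rho).
        { replace (3 / rho) with (/ (rho / 3)) by (field; lra). apply Rinv_le_contravar; [lra|auto]. }
        assert (D4 : / (Cmod w0 * Cmod w0 * Cmod w0) <= / rho ^ 3).
        { apply Rinv_le_contravar; [apply pow_lt; lra|]. simpl.
          replace (rho * (rho * (rho * 1))) with (rho * rho * rho) by ring.
          apply Rmult_le_compat; try lra; [nra|]. apply Rmult_le_compat; lra. }
        specialize (Hwz w Hw).
        apply Rmult_le_compat; auto.
        * apply Rmult_le_pos; [apply Rmult_le_pos; [apply Cmod_ge_0|apply pow_le, Cmod_ge_0]|].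
          left. apply Rinv_0_lt_compat. lra.
        * left. apply Rinv_0_lt_compat. apply Rmult_lt_0_compat; nra.
        * apply Rmult_le_compat; auto.
          -- apply Rmult_le_pos; [apply Cmod_ge_0|apply pow_le, Cmod_ge_0].
          -- left. apply Rinv_0_lt_compat. lra.
          -- apply Rmult_le_compat; auto using Cmod_ge_0. apply pow_le, Cmod_ge_0.
    - replace (100 * del * (r * (4 * del) ^ 3 * (3 / rho) * / rho ^ 3)) with (19200 * (r * (del / rho) ^ 4))
        by (field; lra).
      assert (0 <= r * (del / rho) ^ 4).
      { apply Rmult_le_pos; [easy|]. apply pow_le, Rdiv_le_0_compat; lra. }
      lra. }
  assert (HI : forall (a b : C) (t : R), 0 < t -> t <= Cmod b -> Cmod a <= kap ->
    Cmod (- / b * a)%C <= kap * / t).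
  { intros a b t Ht Hb' Ha. rewrite Cmod_mult, Cmod_opp, Cmod_inv by (apply Cmod_gt_0; lra).
    rewrite Rmult_comm. apply Rmult_le_compat; auto using Cmod_ge_0.
    - left. apply Rinv_0_lt_compat. lra.
    - apply Rinv_le_contravar; lra. }
  assert (I0 := HI (moment 0 u) w0 rho ltac:(lra) Hw0 (Hm 0%nat ltac:(lia))).
  assert (I1 : Cmod (- / (w0 * w0) * moment 1 u)%C <= kap * / rho ^ 2).
  { apply HI; [apply pow_lt; lra| |apply Hm; lia]. rewrite Cmod_mult. simpl. nra. }
  assert (I2 : Cmod (- / (w0 * w0 * w0) * moment 2 u)%C <= kap * / rho ^ 3).
  { apply HI; [apply pow_lt; lra| |apply Hm; lia]. rewrite !Cmod_mult. simpl.
    replace (rho * (rho * (rho * 1))) with (rho * rho * rho) by ring.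
    apply Rmult_le_compat; try lra; [nra|]. apply Rmult_le_compat; lra. }
  rewrite Cmult_0_r, Cplus_0_r.
  eapply Rle_trans; [apply Cmod_triangle|].
  eapply Rle_trans; [apply Rplus_le_compat_r, Cmod_triangle|].
  eapply Rle_trans; [apply Rplus_le_compat_r, Rplus_le_compat_r, Cmod_triangle|].
  lra.
Qed.

End OneTentEstimates.
End Estimates.

(** * A regularized Cauchy kernel *)

Lemma Rint_ext_boundary g k a b c d : a <= b -> c <= d ->
  (forall z, in_rect a b c d z -> fst z = a \/ fst z = b \/ snd z = c \/ snd z = d -> g z = k z) ->
  Rint g a b c d = Rint k a b c d.
Proof.
  intros Hab Hcd H. unfold Rint, Hint, Vint.
  rewrite (cint_ext a b Hab (fun t => g (t, c)) (fun t => k (t, c))),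
    (cint_ext a b Hab (fun t => g (t, d)) (fun t => k (t, d))),
    (cint_ext c d Hcd (fun t => g (a, t)) (fun t => k (a, t))),
    (cint_ext c d Hcd (fun t => g (b, t)) (fun t => k (b, t))); [easy|..];
  intros t Ht; apply H; try (split; simpl; lra); simpl; auto.
Qed.

(** The kernel is conj (w - z) / |w - z|^2; bounding the modulus from below by [rho] makes it
    continuous everywhere, as [AA_one] requires. *)
Definition reg_kernel (rho : R) (z w : C) : C :=
  (Cconj (w - z) * / (RtoC (Rmax (Cmod (w - z)) rho) * RtoC (Rmax (Cmod (w - z)) rho)))%C.

Lemma reg_kernel_eq rho z w : 0 < rho -> rho <= Cmod (w - z) -> reg_kernel rho z w = (/ (w - z))%C.
Proof.
  intros Hr H. unfold reg_kernel. rewrite Rmax_left by easy.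
  assert (Hn : (w - z)%C <> RtoC 0) by (apply Cmod_gt_0; lra).
  set (t := (w - z)%C) in *. rewrite <- RtoC_mult, Cmod_sqr.
  assert (E : RtoC (fst t * fst t + snd t * snd t) = (t * Cconj t)%C).
  { apply C_ext; simpl; ring. }
  assert (Hc : Cconj t <> RtoC 0).
  { intros E0. apply Hn. apply C_ext; [exact (f_equal fst E0)|].
    pose proof (f_equal snd E0) as E1. simpl in E1. simpl. lra. }
  rewrite E. field. auto.
Qed.

Lemma reg_kernel_ccont rho z w : 0 < rho -> ccont (reg_kernel rho z) w.
Proof.
  intros Hr. apply (ccont_mult (fun w => Cconj (w - z))).
  - intros e He. exists e. split; [easy|]. intros u Hu.
    replace (Cconj (u - z) - Cconj (w - z))%C with (Cconj (u - w)).
    + now rewrite Cmod_conj.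
    + apply C_ext; simpl; ring.
  - assert (Hm : ccont (fun w => RtoC (Rmax (Cmod (w - z)) rho)) w).
    { apply (ccont_R 2); [lra|]. intros u u'.
      assert (K : Rabs (Cmod (u - z) - Cmod (u' - z)) <= Cmod (u - u')).
      { pose proof (Cmod_dist_triangle u u' z). pose proof (Cmod_dist_triangle u' u z).
        rewrite (Cmod_minus_sym u' u) in H0. apply Rabs_le. lra. }
      pose proof (Cmod_ge_0 (u - u')).
      apply Rabs_le_between in K. apply Rabs_le. unfold Rmax. repeat destruct Rle_dec; lra. }
    apply (ccont_inv (fun w => RtoC (Rmax (Cmod (w - z)) rho) * RtoC (Rmax (Cmod (w - z)) rho))%C).
    + rewrite <- RtoC_mult. intros E. injection E as E.
      pose proof (Rmax_r (Cmod (w - z)) rho). nra.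
    + now apply ccont_mult.
Qed.

(** * The localization formula and the sum of the pieces *)

Section Localization.
Variables (o : C) (del : R) (P N : nat) (X : C -> Prop).
Hypothesis Hdel : 0 < del.
Hypothesis HN : (4 <= N)%nat.
Hypothesis Hmargin : forall x, X x ->
  2 * INR N <= cx o del N x <= INR (msize P N) - 2 * INR N /\
  2 * INR N <= cy o del N x <= INR (msize P N) - 2 * INR N.

Let h := mesh del N.
Let M := msize P N.
Let X1 := cx o del N.
Let Y1 := cy o del N.
Let holo := holo_near o del N X.
Let T := TT o del P N X.

(** Continuity suffices, because the squares that [TT] keeps do not contain [z]. *)
Lemma TT_lin f u v c z : X z -> (forall w, ccont u w) -> (forall w, ccont v w) ->
  T f (fun w => u w + c * v w)%C z = (T f u z + c * T f v z)%C.
Proof.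
  pose proof (mesh_pos del N Hdel HN) as Hh. fold h in Hh.
  intros Hz Hu Hv. unfold T, TT, AA. rewrite <- Sum_scal, <- Sum_plus. apply Sum_ext. intros m _.
  rewrite <- Sum_scal, <- Sum_plus. apply Sum_ext. intros n _.
  unfold badw. destruct excluded_middle_informative as [E|E]; [ring|].
  assert (Hne : forall w, square o h m n w -> w <> z) by (intros w Hw ->; eauto).
  fold h.
  rewrite (Sq_ext o h Hh _ (fun w => u w * / (w - z) + c * (v w * / (w - z)))%C) by (intros; ring).
  rewrite (Sq_plus o h Hh (fun w => u w * / (w - z))%C (fun w => c * (v w * / (w - z)))%C).
  - rewrite (Sq_scal o h Hh c (fun w => v w * / (w - z))%C); [ring|].
    intros w Hw. apply kernel_ccont; auto.
  - intros w Hw. apply kernel_ccont; auto.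
  - intros w Hw. apply ccont_mult; [apply ccont_const|]. apply kernel_ccont; auto.
Qed.

Lemma TT_Sum {A} f (l : list A) (c : A -> C) (v : A -> C -> C) u z : X z ->
  (forall w, ccont u w) -> (forall a w, In a l -> ccont (v a) w) ->
  T f (fun w => u w - Sum l (fun a => c a * v a w))%C z
  = (T f u z - Sum l (fun a => c a * T f (v a) z))%C.
Proof.
  intros Hz Hu. induction l as [|a l IH]; intros Hv; simpl.
  - replace (fun w => u w - 0)%C with u; [ring|]. apply functional_extensionality. intros; ring.
  - replace (fun w => u w - (c a * v a w + Sum l (fun b => c b * v b w)))%C
      with (fun w => (u w - Sum l (fun b => c b * v b w)) + (- c a) * v a w)%C
      by (apply functional_extensionality; intros; ring).
    rewrite TT_lin; auto.
    + rewrite IH; [ring|]. intros. apply Hv. now right.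
    + intros w. apply ccont_minus; [auto|]. apply (ccont_Sum l (fun b w => c b * v b w)%C).
      intros b Hb. apply ccont_mult; [apply ccont_const|]. apply Hv. now right.
    + intros w. apply Hv. now left.
Qed.

Lemma RL_TT L f v : Ccompact X -> (forall p, L p -> sphere_compl X p) ->
  (forall p, sphere_compl X p -> exists l, L l /\ same_component (sphere_compl X) p l) ->
  (forall w, ccont v w) -> RL X L (T f v).
Proof.
  pose proof (mesh_pos del N Hdel HN) as Hh. fold h in Hh.
  intros HX HL HLc Hv. unfold T, TT, AA. fold h.
  apply (RL_Sum X L (seq 0 (msize P N)) (fun m z => Sum (seq 0 (msize P N)) (fun n =>
    RtoC (badw o del N X f m n) * Sq o h (fun w => v w * / (w - z)) m n))%C).
  intros m _.
  apply (RL_Sum X L (seq 0 (msize P N)) (fun n z =>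
    RtoC (badw o del N X f m n) * Sq o h (fun w => v w * / (w - z)) m n)%C).
  intros n _. unfold badw. destruct excluded_middle_informative as [E|E].
  - apply RL_ext with (G := fun _ => RtoC 0); [intros; ring|apply RL_const].
  - apply RL_scal; auto. apply RL_Sq; auto. intros w Hw. split; [|auto].
    intros Hx. apply E. exists w. auto.
Qed.

(** Up to a constant this product dominates the decay (del / rho)^4 in the sup distance, and its sum
    over the lattice factors. *)
Definition weight (z : C) (j : nat * nat) : R :=
  / (1 + Rabs (X1 z / INR N - INR (fst j))) ^ 2 * / (1 + Rabs (Y1 z / INR N - INR (snd j))) ^ 2.

Lemma weight_pos z j : 0 < weight z j.
Proof.
  unfold weight. pose proof (Rabs_pos (X1 z / INR N - INR (fst j))).
  pose proof (Rabs_pos (Y1 z / INR N - INR (snd j))).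
  apply Rmult_lt_0_compat; apply Rinv_0_lt_compat, pow_lt; lra.
Qed.

Lemma inv_sq_lower t b : 0 <= t <= b -> / (1 + b) ^ 2 <= / (1 + t) ^ 2.
Proof.
  intros H. apply Rinv_le_contravar; [apply pow_lt; lra|]. apply pow_incr. lra.
Qed.

Lemma scaled_dist (x : R) (k : nat) : Rabs (x / INR N - INR k) = Rabs (x - INR k * INR N) / INR N.
Proof.
  pose proof (N_ge N HN). replace (x / INR N - INR k) with ((x - INR k * INR N) * / INR N) by (field; lra).
  rewrite Rabs_mult, (Rabs_pos_eq (/ INR N)); [easy|]. left. apply Rinv_0_lt_compat. lra.
Qed.

Definition Sdel : R := / del + / del ^ 2 + / del ^ 3.

(** In the box of radius 3 each factor of the weight is at least 1/16, whence 2560000 = 256 * 10000.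
    Outside, 20000 * t^(-4) fits under the same constant, and the leftover moments cost kap * Sdel
    since rho >= del. *)
Lemma TT_estimate p q u z r kap : (1 <= p < P)%nat -> (1 <= q < P)%nat ->
  holo u -> X z -> 0 <= r -> 0 <= kap -> osc o del N p q u r ->
  (forall l, (l < 3)%nat -> Cmod (moment o del P N p q l u) <= kap) ->
  Cmod (T (phi N p q) u z) <= 2560000 * r * weight z (p, q) + kap * Sdel.
Proof.
  intros Hp Hq Hu Hz Hr Hk Ho Hm. pose proof (N_ge N HN) as HN4.
  unfold T. rewrite TT_dq by auto.
  assert (HS : 0 < Sdel).
  { unfold Sdel. assert (0 < / del) by now apply Rinv_0_lt_compat.
    assert (0 < / del ^ 2) by (apply Rinv_0_lt_compat, pow_lt; lra).
    assert (0 < / del ^ 3) by (apply Rinv_0_lt_compat, pow_lt; lra). lra. }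
  unfold weight. simpl fst. simpl snd. rewrite !scaled_dist.
  fold (pN N p) (qN N q).
  set (A := Rabs (X1 z - pN N p)). set (B := Rabs (Y1 z - qN N q)).
  assert (HA : 0 <= A) by apply Rabs_pos. assert (HB : 0 <= B) by apply Rabs_pos.
  destruct (classic (box o del N p q 3 z)) as [Hb|Hb].
  - eapply Rle_trans; [apply (near_estimate o del P N X Hdel HN Hmargin p q Hp Hq u z r); auto|].
    destruct Hb as [H1 H2]. fold (X1 z) in H1. fold (Y1 z) in H2. fold A in H1. fold B in H2.
    assert (W1 : / (1 + 3) ^ 2 <= / (1 + A / INR N) ^ 2).
    { apply inv_sq_lower. split; [apply Rdiv_le_0_compat; lra|]. apply (proj2 (Rle_div_l A 3 (INR N) ltac:(lra))). lra. }
    assert (W2 : / (1 + 3) ^ 2 <= / (1 + B / INR N) ^ 2).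
    { apply inv_sq_lower. split; [apply Rdiv_le_0_compat; lra|]. apply (proj2 (Rle_div_l B 3 (INR N) ltac:(lra))). lra. }
    replace (/ (1 + 3) ^ 2) with (/ 16) in * by (field; lra).
    set (a := / (1 + A / INR N) ^ 2) in *. set (b := / (1 + B / INR N) ^ 2) in *.
    assert (/ 256 <= a * b) by nra.
    assert (0 <= kap * Sdel) by nra.
    assert (r * / 256 <= r * (a * b)) by (apply Rmult_le_compat_l; lra). lra.
  - eapply Rle_trans; [apply (far_estimate o del P N X Hdel HN p q Hp Hq u z r kap); auto|].
    cbv zeta. fold (X1 z) (Y1 z). fold A B. fold h. set (mu := Rmax A B).
    assert (Hmu : 3 * INR N < mu).
    { unfold mu. apply Rnot_le_lt. intros Hle. apply Hb. split.
      - eapply Rle_trans; [apply Rmax_l|exact Hle].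
      - eapply Rle_trans; [apply Rmax_r|exact Hle]. }
    pose proof (mesh_pos del N Hdel HN) as Hh. fold h in Hh.
    assert (Hrho : del <= h * mu).
    { pose proof (mesh_N del N HN) as E. fold h in E. nra. }
    apply Rle_trans with (20000 * r * (del / (h * mu)) ^ 4 + kap * Sdel).
    { rewrite Rplus_comm. apply Rplus_le_compat_l. apply Rmult_le_compat_l; [easy|].
      unfold Sdel. repeat apply Rplus_le_compat; apply Rinv_le_contravar; auto; try (apply pow_lt; lra);
      apply pow_incr; lra. }
    apply Rplus_le_compat_r.
    replace (del / (h * mu)) with (INR N / mu) by (rewrite <- (mesh_N del N HN); fold h; field; lra).
    set (t := mu / INR N).
    assert (Ht : 3 < t). { unfold t. apply (proj1 (Rlt_div_r 3 mu (INR N) ltac:(lra))). exact Hmu. }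
    replace (INR N / mu) with (/ t) by (unfold t; field; lra).
    assert (W1 : / (1 + t) ^ 2 <= / (1 + A / INR N) ^ 2).
    { apply inv_sq_lower. split; [apply Rdiv_le_0_compat; lra|]. unfold t, Rdiv.
      apply Rmult_le_compat_r; [left; apply Rinv_0_lt_compat; lra|apply Rmax_l]. }
    assert (W2 : / (1 + t) ^ 2 <= / (1 + B / INR N) ^ 2).
    { apply inv_sq_lower. split; [apply Rdiv_le_0_compat; lra|]. unfold t, Rdiv.
      apply Rmult_le_compat_r; [left; apply Rinv_0_lt_compat; lra|apply Rmax_r]. }
    set (a := / (1 + A / INR N) ^ 2) in *. set (b := / (1 + B / INR N) ^ 2) in *.
    assert (W0 : 9 / 16 * (/ t) ^ 2 <= / (1 + t) ^ 2).
    { apply Rmult_le_reg_l with ((1 + t) ^ 2 * t ^ 2); [apply Rmult_lt_0_compat; apply pow_lt; lra|].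
      replace ((1 + t) ^ 2 * t ^ 2 * (9 / 16 * (/ t) ^ 2)) with (9 / 16 * (1 + t) ^ 2) by (field; lra).
      replace ((1 + t) ^ 2 * t ^ 2 * / (1 + t) ^ 2) with (t ^ 2) by (field; lra). nra. }
    assert (P0 : 0 <= 9 / 16 * (/ t) ^ 2). { apply Rmult_le_pos; [lra|apply pow2_ge_0]. }
    assert (Wab : (9 / 16 * (/ t) ^ 2) * (9 / 16 * (/ t) ^ 2) <= a * b).
    { apply Rmult_le_compat; lra. }
    replace ((9 / 16 * (/ t) ^ 2) * (9 / 16 * (/ t) ^ 2)) with (81 / 256 * (/ t) ^ 4) in Wab by (field; lra).
    assert (P4 : 0 <= (/ t) ^ 4). { apply pow_le. left. apply Rinv_0_lt_compat. lra. }
    assert (r * (81 / 256 * (/ t) ^ 4) <= r * (a * b)) by (apply Rmult_le_compat_l; lra).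
    assert (0 <= r * (/ t) ^ 4) by nra. nra.
Qed.

Definition isnear (j : nat * nat) : bool :=
  if excluded_middle_informative (exists x, X x /\ box o del N (fst j) (snd j) 3 x) then true else false.

(** Only tents close to [X] enter, because the oscillation of an extension is controlled only
    there. *)
Definition nearlist : list (nat * nat) :=
  filter isnear (list_prod (seq 1 (P - 1)) (seq 1 (P - 1))).

Lemma nearlist_in p q : In (p, q) nearlist ->
  (1 <= p < P)%nat /\ (1 <= q < P)%nat /\ exists x, X x /\ box o del N p q 3 x.
Proof.
  intros H. apply filter_In in H. destruct H as [H1 H2]. apply in_prod_iff in H1.
  destruct H1 as [A B]. apply in_seq in A, B. unfold isnear in H2.
  destruct excluded_middle_informative as [E|E]; [|discriminate].
  repeat split; try lia. exact E.
Qed.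

Lemma RSum_list_prod (l k : list nat) (f : nat * nat -> R) :
  RSum (list_prod l k) f = RSum l (fun a => RSum k (fun b => f (a, b))).
Proof.
  induction l as [|a l IH]; simpl; [easy|]. rewrite RSum_app, IH. f_equal. clear IH.
  induction k as [|b k IHk]; simpl; [easy|]. now rewrite IHk.
Qed.

Lemma RSum_filter_le {A} (b : A -> bool) (l : list A) (f : A -> R) :
  (forall a, 0 <= f a) -> RSum (filter b l) f <= RSum l f.
Proof.
  intros Hf. induction l as [|a l IH]; simpl; [lra|]. specialize (Hf a).
  destruct (b a); simpl; lra.
Qed.

Lemma RSum_filter_eq {A} (b : A -> bool) (l : list A) (f : A -> R) :
  (forall a, In a l -> b a = false -> f a = 0) -> RSum (filter b l) f = RSum l f.
Proof.
  intros Hf. induction l as [|a l IH]; simpl; [easy|].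
  rewrite <- IH by (intros; apply Hf; auto; now right).
  destruct (b a) eqn:E; simpl; [easy|]. rewrite (Hf a) by (auto; now left). ring.
Qed.

Lemma weight_sum z : RSum nearlist (weight z) <= 16.
Proof.
  eapply Rle_trans; [apply RSum_filter_le; intros; left; apply weight_pos|].
  rewrite RSum_list_prod. unfold weight. simpl fst. simpl snd.
  rewrite (RSum_mult _ _ (fun a => / (1 + Rabs (X1 z / INR N - INR a)) ^ 2)
    (fun b => / (1 + Rabs (Y1 z / INR N - INR b)) ^ 2)).
  assert (K : forall t, 0 <= RSum (seq 1 (P - 1)) (fun a => / (1 + Rabs (t - INR a)) ^ 2) <= 4).
  { intros t. assert (Pos : forall a, 0 < / (1 + Rabs (t - INR a)) ^ 2).
    { intros a. pose proof (Rabs_pos (t - INR a)). apply Rinv_0_lt_compat, pow_lt. lra. }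
    split.
    - apply RSum_nonneg. intros. left. apply Pos.
    - eapply Rle_trans; [|apply (square_sum (S (P - 1)) t)].
      cbn [seq RSum]. specialize (Pos 0%nat). lra. }
  pose proof (K (X1 z / INR N)). pose proof (K (Y1 z / INR N)).
  replace 16 with (4 * 4) by ring. apply Rmult_le_compat; lra.
Qed.

Definition phitot (m n : nat) : R := RSum nearlist (fun j => phi N (fst j) (snd j) m n).

(** A tent that does not vanish at (m, n) is centered within 2 N cells of [x], hence is near; the
    filter loses nothing and the partition of unity applies. *)
Lemma phitot_one m n x : X x -> Rabs (INR m - X1 x) <= INR N -> Rabs (INR n - Y1 x) <= INR N ->
  phitot m n = 1.
Proof.
  pose proof (N_ge N HN) as HN4. intros Hx H1 H2.
  destruct (Hmargin x Hx) as [Mx My]. fold (X1 x) in Mx. fold (Y1 x) in My.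
  unfold msize in Mx, My. rewrite mult_INR in Mx, My.
  apply Rabs_le_between in H1, H2.
  unfold phitot, nearlist. rewrite RSum_filter_eq.
  - rewrite RSum_list_prod. unfold phi. simpl fst. simpl snd.
    rewrite (RSum_mult _ _ (fun a => tent (INR m / INR N - INR a)) (fun b => tent (INR n / INR N - INR b))).
    assert (B : forall t, INR N <= t -> t <= INR P * INR N - INR N -> 1 <= t / INR N /\ t / INR N <= INR P - 1).
    { intros t Ht1 Ht2. split.
      - apply (proj1 (Rle_div_r 1 t (INR N) ltac:(lra))). lra.
      - apply (proj2 (Rle_div_l t (INR P - 1) (INR N) ltac:(lra))). lra. }
    destruct (B (INR m)) as [B1 B2]; [lra|lra|]. destruct (B (INR n)) as [B3 B4]; [lra|lra|].
    rewrite !tent_partition by easy. ring.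
  - intros [a b] _ Hf. apply NNPP. intros Hne. simpl in Hne. apply phi_support in Hne; auto.
    destruct Hne as [E1 E2]. apply Rabs_lt_between in E1, E2.
    unfold isnear in Hf. destruct excluded_middle_informative as [E|E]; [discriminate|].
    apply E. exists x. split; [easy|]. simpl. split; apply Rabs_le; fold (X1 x) (Y1 x); lra.
Qed.

Lemma phitot_border : border M phitot.
Proof.
  intros k. unfold phitot.
  assert (Z : forall f : nat * nat -> R, (forall a b, In (a, b) nearlist -> f (a, b) = 0) -> RSum nearlist f = 0).
  { intros f Hf. rewrite (RSum_ext _ _ (fun _ => 0)); [rewrite RSum_const; ring|].
    intros [a b] Hab. now apply Hf. }
  repeat split; apply Z; intros a b Hab; apply nearlist_in in Hab; destruct Hab as [Ha [Hb _]];
  simpl; now apply (phi_border P N HN a b Ha Hb k).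
Qed.

Lemma far_of_coord w x : INR N - 2 <= Rabs (X1 w - X1 x) \/ INR N - 2 <= Rabs (Y1 w - Y1 x) ->
  del / 2 <= Cmod (w - x).
Proof.
  pose proof (N_ge N HN) as HN4. pose proof (mesh_pos del N Hdel HN) as Hh. fold h in Hh.
  pose proof (mesh_N del N HN) as E. fold h in E.
  intros [H|H]; eapply Rle_trans.
  2: apply (cx_Cmod o del N Hdel HN). 3: apply (cy_Cmod o del N Hdel HN).
  - fold h (X1 w) (X1 x). apply Rle_trans with (h * (INR N - 2)); [nra|apply Rmult_le_compat_l; lra].
  - fold h (Y1 w) (Y1 x). apply Rle_trans with (h * (INR N - 2)); [nra|apply Rmult_le_compat_l; lra].
Qed.

(** By [phitot_one] the weight jumps only at distance N - 2 cells or more from [x], and (N - 2) *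
    mesh >= del / 2 because N >= 4. *)
Lemma phitot_active w x : active o h M phitot w -> X x -> del / 2 <= Cmod (w - x).
Proof.
  pose proof (N_ge N HN) as HN4.
  intros [m [n [_ [_ H]]]] Hx. apply far_of_coord.
  apply NNPP. intros Hno. apply not_or_and in Hno. destruct Hno as [N1 N2].
  apply Rnot_le_lt, Rabs_lt_between in N1, N2.
  destruct H as [[H1 H2]|[H1 H2]].
  - apply hedge_coord in H2; auto. fold (X1 w) (Y1 w) in H2. rewrite S_INR in H2. apply H1.
    rewrite !(fun m n => phitot_one m n x); auto; try rewrite S_INR; apply Rabs_le; lra.
  - apply vedge_coord in H2; auto. fold (X1 w) (Y1 w) in H2. rewrite S_INR in H2. apply H1.
    rewrite !(fun m n => phitot_one m n x); auto; try rewrite S_INR; apply Rabs_le; lra.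
Qed.

(** The weights [phitot] and 1 differ only on squares away from [z], where the kernel integrates to
    0; with weight 1 there remains the boundary of the whole grid. The regularized kernel agrees
    with 1 / (w - z) on the active edges, on those squares and on the outer boundary. *)
Lemma phitot_winding z : X z -> EE o h M phitot (fun w => / (w - z))%C = (RtoC (2 * PI) * Ci)%C.
Proof.
  pose proof (N_ge N HN) as HN4. pose proof (mesh_pos del N Hdel HN) as Hh. fold h in Hh.
  pose proof (mesh_N del N HN) as Emesh. fold h in Emesh.
  intros Hz. destruct (Hmargin z Hz) as [Mx My]. fold (X1 z) in Mx. fold (Y1 z) in My. fold M in Mx, My.
  assert (Hkd : forall w, INR N - 2 <= Rabs (X1 w - X1 z) \/ INR N - 2 <= Rabs (Y1 w - Y1 z) ->
    h <= Cmod (w - z)).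
  { intros w Hw. apply far_of_coord in Hw. nra. }
  rewrite (EE_ext o h M Hh phitot _ (reg_kernel h z)).
  2: { intros w Hw. symmetry. apply reg_kernel_eq; [easy|].
       pose proof (phitot_active w z Hw Hz). nra. }
  rewrite <- AA_EE by apply phitot_border.
  rewrite (AA_ext_weights o h M phitot (fun _ _ => 1)).
  - rewrite AA_one by (auto; intros; now apply reg_kernel_ccont).
    assert (Gx0 : fst z = fst o + X1 z * h) by (unfold X1, cx; fold h; field; lra).
    assert (Gy0 : snd z = snd o + Y1 z * h) by (unfold Y1, cy; fold h; field; lra).
    assert (I1 : gx o h 0 < fst z < gx o h M).
    { unfold gx. rewrite Gx0. simpl (INR 0). split; nra. }
    assert (I2 : gy o h 0 < snd z < gy o h M).
    { unfold gy. rewrite Gy0. simpl (INR 0). split; nra. }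
    rewrite <- (Rint_winding z (gx o h 0) (gx o h M) (gy o h 0) (gy o h M) I1 I2).
    apply Rint_ext_boundary; [lra|lra|].
    intros w _ Hw. apply reg_kernel_eq; [easy|]. apply Hkd.
    assert (Fx : forall k, fst w = gx o h k -> X1 w = INR k).
    { intros k E. unfold X1, cx. fold h. rewrite E. unfold gx. field. lra. }
    assert (Fy : forall k, snd w = gy o h k -> Y1 w = INR k).
    { intros k E. unfold Y1, cy. fold h. rewrite E. unfold gy. field. lra. }
    destruct Hw as [E|[E|[E|E]]].
    + left. rewrite (Fx _ E). simpl (INR 0). rewrite Rabs_left1; lra.
    + left. rewrite (Fx _ E). rewrite Rabs_pos_eq; lra.
    + right. rewrite (Fy _ E). simpl (INR 0). rewrite Rabs_left1; lra.
    + right. rewrite (Fy _ E). rewrite Rabs_pos_eq; lra.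
  - intros m n _ _ Hne.
    assert (Hsq : forall w, square o h m n w -> h <= Cmod (w - z)).
    { intros w Hw. apply square_coord in Hw; auto. fold (X1 w) (Y1 w) in Hw. apply Hkd.
      apply NNPP. intros Hno. apply not_or_and in Hno. destruct Hno as [N1 N2].
      apply Rnot_le_lt, Rabs_lt_between in N1, N2. apply Hne.
      apply (phitot_one m n z Hz); apply Rabs_le; lra. }
    assert (Hwz : forall w, square o h m n w -> w <> z).
    { intros w Hw ->. specialize (Hsq z Hw). replace (z - z)%C with (RtoC 0) in Hsq by ring.
      rewrite Cmod_0 in Hsq. lra. }
    rewrite (Sq_ext o h Hh (reg_kernel h z) (fun w => / (w - z))%C).
    + apply (Sq_Goursat o h Hh (fun w => / (w - z))%C z).
      * intros w Hw. apply inv_sub_ccont. auto.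
      * intros w Hw _. apply inv_sub_differentiable. auto.
    + intros w Hw. apply reg_kernel_eq; auto.
Qed.

(** The pieces add up to the [phitot]-weighted integral of (u w - u z) / (w - z), and the part with
    u z is the winding number. *)
Lemma localization u z : holo u -> X z ->
  (RtoC (2 * PI) * Ci * u z)%C =
  (EE o h M phitot (fun w => u w * / (w - z)) - Sum nearlist (fun j => T (phi N (fst j) (snd j)) u z))%C.
Proof.
  pose proof (mesh_pos del N Hdel HN) as Hh. fold h in Hh.
  intros Hu Hz.
  rewrite (Sum_ext nearlist _ (fun j => EE o h M (phi N (fst j) (snd j)) (dq u z))).
  2: { intros [p q] Hj. apply nearlist_in in Hj. destruct Hj as [Hp [Hq _]]. simpl.
       unfold T. rewrite TT_dq by auto. apply AA_EE. now apply phi_border. }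
  rewrite <- (EE_Sum_weights o h M nearlist (fun j => phi N (fst j) (snd j))).
  change (fun m n => RSum nearlist (fun j => phi N (fst j) (snd j) m n)) with phitot.
  assert (Hne : forall w, active o h M phitot w -> w <> z).
  { intros w Hw ->. pose proof (phitot_active z z Hw Hz) as Hc.
    replace (z - z)%C with (RtoC 0) in Hc by ring. rewrite Cmod_0 in Hc. lra. }
  rewrite (EE_ext o h M Hh phitot (dq u z) (fun w => u w * / (w - z) + (- u z) * / (w - z))%C).
  2: { intros w Hw. rewrite dq_neq by auto. ring. }
  rewrite (EE_lin o h M Hh phitot (fun w => u w * / (w - z))%C (fun w => / (w - z))%C).
  - rewrite phitot_winding by easy. ring.
  - intros w Hw. apply kernel_ccont; [auto|apply Hu].
  - intros w Hw. apply inv_sub_ccont. auto.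
Qed.

Lemma RSum_diff {A} (l : list A) (f k : A -> R) (c : R) :
  (forall j, Rabs (f j - k j) <= c) -> Rabs (RSum l f - RSum l k) <= INR (length l) * c.
Proof.
  intros H. induction l as [|a l IH].
  - simpl. rewrite Rminus_diag, Rabs_R0. lra.
  - cbn [RSum length]. rewrite S_INR.
    replace (f a + RSum l f - (k a + RSum l k)) with ((f a - k a) + (RSum l f - RSum l k)) by ring.
    eapply Rle_trans; [apply Rabs_triang|]. specialize (H a). lra.
Qed.

(** Crude in [P] and in the number of tents, but free of [N]: it is applied only to the extension
    error, which is chosen after [P]. *)
Lemma EE_phitot_bound g G : 0 <= G ->
  (forall w, active o h M phitot w -> ccont g w /\ Cmod (g w) <= G) ->
  Cmod (EE o h M phitot g) <= 8 * INR P * INR P * INR (length nearlist) * del * G.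
Proof.
  pose proof (N_ge N HN) as HN4. pose proof (mesh_pos del N Hdel HN) as Hh. fold h in Hh.
  pose proof (mesh_N del N HN) as Emesh. fold h in Emesh.
  intros HG Hg. set (J := INR (length nearlist)).
  assert (HJ : 0 <= J) by apply pos_INR.
  assert (Hstep : forall f k : nat * nat -> R, (forall j, Rabs (f j - k j) <= 2 / INR N) ->
     Rabs (RSum nearlist f - RSum nearlist k) <= J * (2 / INR N)).
  { intros f k H. now apply RSum_diff. }
  assert (P2 : 0 <= J * (2 / INR N)). { apply Rmult_le_pos; [easy|]. apply Rdiv_le_0_compat; lra. }
  eapply Rle_trans; [apply EE_bound with (D := fun _ _ => J * (2 / INR N) * G)|].
  - exact Hh.
  - intros w Hw. now apply Hg.
  - intros. nra.
  - intros m n z Hm Hn E Hz. apply Rmult_le_compat; try apply Rabs_pos; try apply Cmod_ge_0.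
    + apply Hstep. intros j. now apply phi_step_y.
    + apply Hg. exists m, n. auto.
  - intros m n z Hm Hn E Hz. apply Rmult_le_compat; try apply Rabs_pos; try apply Cmod_ge_0.
    + apply Hstep. intros j. now apply phi_step_x.
    + apply Hg. exists m, n. auto.
  - rewrite (RSum_ext _ _ (fun _ => INR M * (J * (2 / INR N) * G))).
    2: { intros. rewrite RSum_const, length_seq. easy. }
    rewrite RSum_const, length_seq. unfold M, msize. rewrite mult_INR.
    right. rewrite <- Emesh. field. lra.
Qed.

End Localization.

(** * Extension operators *)

Section Extension.
Variables (x0 : C) (xs : list C) (eta : R).
Hypothesis Heta : 0 < eta.

Definition dmin (w : C) : R := fold_right (fun x m => Rmin (Cmod (w - x)) m) (Cmod (w - x0)) xs.

Lemma dmin_le w x : In x (x0 :: xs) -> dmin w <= Cmod (w - x).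
Proof.
  unfold dmin. induction xs as [|y l IH]; simpl.
  - intros [<-|[]]. lra.
  - intros H. destruct H as [H|[H|H]].
    + eapply Rle_trans; [apply Rmin_r|]. apply IH. now left.
    + subst y. apply Rmin_l.
    + eapply Rle_trans; [apply Rmin_r|]. apply IH. now right.
Qed.

Lemma dmin_attained w : exists x, In x (x0 :: xs) /\ dmin w = Cmod (w - x).
Proof.
  unfold dmin. induction xs as [|y l [x [Hx E]]]; simpl.
  - exists x0. auto.
  - unfold Rmin at 1. destruct Rle_dec.
    + exists y. auto.
    + exists x. split; [|exact E]. destruct Hx; auto.
Qed.

Lemma dmin_pos w : 0 <= dmin w.
Proof. destruct (dmin_attained w) as [x [_ ->]]. apply Cmod_ge_0. Qed.

Lemma dmin_lip w w' : Rabs (dmin w - dmin w') <= Cmod (w - w').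
Proof.
  assert (H : forall a b, dmin a - dmin b <= Cmod (a - b)).
  { intros a b. destruct (dmin_attained b) as [x [Hx ->]].
    pose proof (dmin_le a x Hx). pose proof (Cmod_dist_triangle a b x). lra. }
  apply Rabs_le. pose proof (H w w'). pose proof (H w' w). rewrite (Cmod_minus_sym w' w) in H1. lra.
Qed.

(** Positive only at nodes almost as close to [w] as the nearest one. The nearest node receives at
    least [eta], so the total is positive even at a node, where [dmin] is 0. *)
Definition rawpsi (x w : C) : R := Rmax 0 (2 * dmin w + eta - Cmod (w - x)).

Definition psitot (w : C) : R := RSum (x0 :: xs) (fun x => rawpsi x w).

Definition psi (x w : C) : R := rawpsi x w / psitot w.

Lemma rawpsi_pos x w : 0 <= rawpsi x w.
Proof. apply Rmax_l. Qed.

Lemma psitot_pos w : 0 < psitot w.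
Proof.
  destruct (dmin_attained w) as [x [Hx E]].
  assert (K : rawpsi x w <= psitot w).
  { unfold psitot. revert Hx. generalize (x0 :: xs). induction l as [|y l IH]; simpl; [easy|].
    assert (0 <= RSum l (fun x => rawpsi x w)) by (apply RSum_nonneg; intros; apply rawpsi_pos).
    pose proof (rawpsi_pos y w). intros [->|H1]; [lra|]. specialize (IH H1). lra. }
  assert (eta <= rawpsi x w).
  { unfold rawpsi. eapply Rle_trans; [|apply Rmax_r]. pose proof (dmin_pos w). lra. }
  lra.
Qed.

Lemma psi_pos x w : 0 <= psi x w.
Proof. apply Rdiv_le_0_compat; [apply rawpsi_pos|apply psitot_pos]. Qed.

Lemma psi_sum w : RSum (x0 :: xs) (fun x => psi x w) = 1.
Proof.
  pose proof (psitot_pos w).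
  rewrite (RSum_ext _ _ (fun x => / psitot w * rawpsi x w)) by (intros; unfold psi; field; lra).
  rewrite RSum_scal. fold (psitot w). field. lra.
Qed.

Lemma psi_support x w : psi x w <> 0 -> Cmod (w - x) < 2 * dmin w + eta.
Proof.
  intros H. apply Rnot_le_lt. intros Hle. apply H. unfold psi, rawpsi.
  rewrite Rmax_left by lra. unfold Rdiv. ring.
Qed.

Lemma psi_ccont x w : ccont (fun w => RtoC (psi x w)) w.
Proof.
  assert (Hraw : forall y, ccont (fun w => RtoC (rawpsi y w)) w).
  { intros y. apply (ccont_R 3); [lra|]. intros a b.
    pose proof (dmin_lip a b) as H1.
    pose proof (Cmod_dist_triangle a b y). pose proof (Cmod_dist_triangle b a y).
    rewrite (Cmod_minus_sym b a) in H0. pose proof (Cmod_ge_0 (a - b)).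
    apply Rabs_le_between in H1. apply Rabs_le. unfold rawpsi, Rmax. repeat destruct Rle_dec; lra. }
  apply ccont_ext with (f := (fun w => RtoC (rawpsi x w) *
    / Sum (x0 :: xs) (fun y => RtoC (rawpsi y w)))%C) (r := 1); [lra| |].
  - intros u _. rewrite Sum_RtoC. fold (psitot u). unfold psi. rewrite RtoC_div.
    + reflexivity.
    + pose proof (psitot_pos u). lra.
  - apply ccont_mult; [apply Hraw|].
    apply (ccont_inv (fun w => Sum (x0 :: xs) (fun y => RtoC (rawpsi y w)))).
    + rewrite Sum_RtoC. fold (psitot w). intros E. injection E as E. pose proof (psitot_pos w). lra.
    + apply (ccont_Sum (x0 :: xs) (fun y w => RtoC (rawpsi y w))). intros; apply Hraw.
Qed.

(** Linear in finitely many values of [f]: this is where the finite rank comes from. It is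
    continuous but in general not holomorphic near [X]. *)
Definition Ext (f : C -> C) (w : C) : C := Sum (x0 :: xs) (fun x => f x * RtoC (psi x w))%C.

Lemma Ext_ccont f w : ccont (Ext f) w.
Proof.
  apply (ccont_Sum (x0 :: xs) (fun x w => f x * RtoC (psi x w))%C). intros x _.
  apply ccont_mult; [apply ccont_const|apply psi_ccont].
Qed.

Lemma psi_average (f : C -> C) w r : 0 <= r ->
  (forall x, In x (x0 :: xs) -> psi x w <> 0 -> Cmod (f x) <= r) ->
  Cmod (Sum (x0 :: xs) (fun x => f x * RtoC (psi x w)))%C <= r.
Proof.
  intros Hr H. eapply Rle_trans; [apply Sum_mod|].
  apply Rle_trans with (RSum (x0 :: xs) (fun x => r * psi x w)).
  - apply RSum_le. intros x Hx. rewrite Cmod_mult, Cmod_R, (Rabs_pos_eq _ (psi_pos x w)).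
    destruct (classic (psi x w = 0)) as [->|E]; [lra|].
    apply Rmult_le_compat_r; [apply psi_pos|auto].
  - rewrite RSum_scal, psi_sum. lra.
Qed.

Lemma Ext_close f w a r : 0 <= r ->
  (forall x, In x (x0 :: xs) -> Cmod (w - x) < 2 * dmin w + eta -> Cmod (f x - a) <= r) ->
  Cmod (Ext f w - a) <= r.
Proof.
  intros Hr H.
  replace (Ext f w - a)%C with (Sum (x0 :: xs) (fun x => (f x - a) * RtoC (psi x w)))%C.
  - apply (psi_average (fun x => f x - a)%C); [easy|]. intros x Hx Hp. apply H; auto. now apply psi_support.
  - unfold Ext. rewrite (Sum_ext _ _ (fun x => f x * RtoC (psi x w) - a * RtoC (psi x w))%C) by (intros; ring).
    rewrite Sum_minus, Sum_scal, Sum_RtoC, psi_sum. ring.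
Qed.

Lemma Ext_diff f g w r : 0 <= r ->
  (forall x, In x (x0 :: xs) -> Cmod (f x - g x) <= r) -> Cmod (Ext f w - Ext g w) <= r.
Proof.
  intros Hr H. unfold Ext. rewrite <- Sum_minus.
  rewrite (Sum_ext _ _ (fun x => (f x - g x) * RtoC (psi x w))%C) by (intros; ring).
  apply (psi_average (fun x => f x - g x)%C); auto.
Qed.

End Extension.

(** [u] is F + chi * (g - F), equal to [g] near [X] and to [F] far away; 3 * eps bounds g - F
    wherever chi is nonzero. The radius [r] depends on [f] without any uniformity. *)
Lemma holomorphic_extension (X : C -> Prop) (f F : C -> C) (eps : R) :
  Ccompact X -> 0 < eps -> Obar X f -> (forall w, ccont F w) ->
  (forall x, X x -> Cmod (F x - f x) <= eps) ->
  exists u, (forall w, ccont u w) /\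
    (exists r, 0 < r /\ forall x w, X x -> Cmod (w - x) < r -> C_differentiable_at u w) /\
    (forall w, Cmod (u w - F w) <= 3 * eps) /\
    (forall x, X x -> Cmod (u x - f x) <= eps).
Proof.
  intros HX He [_ HO] HF HFf. destruct (HO eps He) as [U [g [HU [HXU [Hg Hfg]]]]].
  assert (Hgf : forall x, X x -> Cmod (g x - f x) < eps).
  { intros x Hx. rewrite Cmod_minus_sym, <- Cnorm_Cmod. exact (Hfg x Hx). }
  destruct (classic (exists x, X x)) as [[x1 Hx1]|Hempty].
  2: { exists F. split; [easy|]. split.
       - exists 1. split; [lra|]. intros x w Hx. exfalso. eauto.
       - split.
         + intros w. replace (F w - F w)%C with (RtoC 0) by ring. rewrite Cmod_0. lra.
         + intros x Hx. exfalso. eauto. }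
  destruct (compact_nbhd X (fun w => U w /\ Cmod (g w - F w) <= 3 * eps) HX) as [r [Hr Hnb]].
  { intros x Hx. destruct (HU x (HXU x Hx)) as [r1 [Hr1 HU1]].
    assert (Hcg : ccont g x) by (apply C_differentiable_ccont, Hg, HXU, Hx).
    destruct (ccont_minus g F x Hcg (HF x) eps He) as [r2 [Hr2 H2]].
    exists (Rmin r1 r2). split; [now apply Rmin_glb_lt|]. intros w Hw.
    assert (A1 : Cmod (w - x) < r1) by (eapply Rlt_le_trans; [exact Hw|apply Rmin_l]).
    assert (A2 : Cmod (w - x) < r2) by (eapply Rlt_le_trans; [exact Hw|apply Rmin_r]).
    split.
    - apply HU1. rewrite Cnorm_Cmod. exact A1.
    - specialize (H2 w A2). pose proof (Hgf x Hx). pose proof (HFf x Hx).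
      pose proof (Cmod_le_add (g w - F w) (g x - F x)).
      pose proof (Cmod_dist_triangle (g x) (f x) (F x)). rewrite (Cmod_minus_sym (f x)) in H3. lra. }
  destruct (compact_net X (r / 4) HX) as [xs [Hxs Hnet]]; [lra|].
  set (d := dmin x1 xs).
  assert (Hin : forall x, In x (x1 :: xs) -> X x) by (intros x [<-|H]; auto).
  assert (Hd : forall x w, X x -> d w <= Cmod (w - x) + r / 4).
  { intros x w Hx. destruct (Hnet x Hx) as [y [Hy Hlt]].
    assert (d w <= Cmod (w - y)) by (apply dmin_le; now right).
    pose proof (Cmod_dist_triangle w x y). lra. }
  assert (HdU : forall w, d w < r -> U w /\ Cmod (g w - F w) <= 3 * eps).
  { intros w Hw. destruct (dmin_attained x1 xs w) as [x [Hx E]]. fold (d w) in E.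
    apply (Hnb x w); auto. lra. }
  (* chi is 1 for d <= r / 2 and 0 for d >= 3 r / 4, inside the region d < r where [g] is
     holomorphic and close to [F]. *)
  set (chi := fun w => clamp (3 - 4 * d w / r)).
  assert (Hchi1 : forall w, d w <= r / 2 -> chi w = 1).
  { intros w Hw. unfold chi. assert (4 * d w / r <= 2).
    { apply (proj2 (Rle_div_l (4 * d w) 2 r Hr)). lra. }
    destruct (clamp_cases (3 - 4 * d w / r)) as [[K ->]|[[K ->]|[K ->]]]; lra. }
  assert (Hchi0 : forall w, 3 * r / 4 <= d w -> chi w = 0).
  { intros w Hw. unfold chi. assert (3 <= 4 * d w / r).
    { apply (proj1 (Rle_div_r 3 (4 * d w) r Hr)). lra. }
    destruct (clamp_cases (3 - 4 * d w / r)) as [[K ->]|[[K ->]|[K ->]]]; lra. }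
  assert (Hchi : forall w, 0 <= chi w <= 1).
  { intros w. unfold chi. destruct (clamp_cases (3 - 4 * d w / r)) as [[K ->]|[[K ->]|[K ->]]]; lra. }
  assert (Hchic : forall w, ccont (fun w => RtoC (chi w)) w).
  { intros w. apply (ccont_R (4 / r)); [apply Rdiv_lt_0_compat; lra|]. intros a b.
    unfold chi. eapply Rle_trans; [apply clamp_lip|].
    replace (3 - 4 * d a / r - (3 - 4 * d b / r)) with (4 / r * (d b - d a)) by (field; lra).
    rewrite Rabs_mult, (Rabs_pos_eq (4 / r)) by (apply Rdiv_le_0_compat; lra).
    apply Rmult_le_compat_l; [apply Rdiv_le_0_compat; lra|].
    rewrite Rabs_minus_sym. apply dmin_lip. }
  set (u := fun w => (F w + RtoC (chi w) * (g w - F w))%C).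
  assert (Hug : forall x w, X x -> Cmod (w - x) < r / 4 -> u w = g w).
  { intros x w Hx Hw. unfold u. rewrite Hchi1 by (specialize (Hd x w Hx); lra). ring. }
  exists u. split; [|split; [|split]].
  - intros w. destruct (Rlt_le_dec (d w) r) as [Hlt|Hge].
    + apply ccont_plus; [auto|]. apply ccont_mult; [auto|]. apply ccont_minus; [|auto].
      apply C_differentiable_ccont, Hg. now apply HdU.
    + apply ccont_ext with (f := F) (r := r / 4); [lra| |auto].
      intros w' Hw'. unfold u. rewrite Hchi0; [ring|].
      pose proof (dmin_lip x1 xs w' w) as K. fold (d w) (d w') in K. apply Rabs_le_between in K. lra.
  - exists (r / 8). split; [lra|]. intros x w Hx Hw.
    assert (HgD : C_differentiable_at g w).
    { apply Hg. apply HdU. specialize (Hd x w Hx). lra. }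
    apply differentiable_cderiv in HgD. destruct HgD as [l Hl].
    apply cderiv_differentiable with l. apply cderiv_local with (f := g) (r := r / 8); [lra| |exact Hl].
    intros w' Hw'. symmetry. apply (Hug x); [easy|].
    pose proof (Cmod_dist_triangle w' w x). lra.
  - intros w. unfold u.
    replace (F w + RtoC (chi w) * (g w - F w) - F w)%C with (RtoC (chi w) * (g w - F w))%C by ring.
    rewrite Cmod_mult, Cmod_R, Rabs_pos_eq by apply Hchi.
    destruct (Rlt_le_dec (d w) r) as [Hlt|Hge].
    + destruct (HdU w Hlt) as [_ K]. specialize (Hchi w). pose proof (Cmod_ge_0 (g w - F w)). nra.
    + rewrite Hchi0 by lra. lra.
  - intros x Hx. rewrite (Hug x x Hx).
    + left. auto.
    + replace (x - x)%C with (RtoC 0) by ring. rewrite Cmod_0. lra.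
Qed.

(** * Finite rank approximation on a planar compact set *)

Lemma choice_on_list {A B : Type} (l : list A) (b0 : B) (R : A -> B -> Prop) :
  (forall a, In a l -> exists b, R a b) -> exists F : A -> B, forall a, In a l -> R a (F a).
Proof.
  intros H. exists (fun a => epsilon (inhabits b0) (R a)). intros a Ha.
  apply epsilon_spec. auto.
Qed.

Definition everywhere_ccont (u : C -> C) : Prop := forall w, ccont u w.

Lemma everywhere_ccont_closed : lin_closed everywhere_ccont.
Proof.
  intros u v c Hu Hv w. apply ccont_plus; [auto|]. apply ccont_mult; [apply ccont_const|auto].
Qed.

Lemma linear_on_zero a : linear_on everywhere_ccont a -> a (fun _ => RtoC 0) = RtoC 0.
Proof.
  intros H. assert (W0 : everywhere_ccont (fun _ => RtoC 0)) by (intros w; apply ccont_const).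
  specialize (H _ _ (RtoC 1) W0 W0). cbv beta in H.
  replace (fun _ : C => 0 + 1 * 0)%C with (fun _ : C => RtoC 0) in H
    by (apply functional_extensionality; intros; ring).
  assert (K : forall t : C, t = (t + 1 * t)%C -> t = RtoC 0).
  { intros t Ht. transitivity ((t + 1 * t) - t)%C; [ring|]. rewrite <- Ht. ring. }
  apply K, H.
Qed.

Lemma linear_on_Sum {A} a (l : list A) (c : A -> C) (v : A -> C -> C) :
  linear_on everywhere_ccont a -> (forall b, everywhere_ccont (v b)) ->
  a (fun w => Sum l (fun b => c b * v b w))%C = Sum l (fun b => c b * a (v b))%C.
Proof.
  intros H Hv. induction l as [|b l IH]; simpl; [now apply linear_on_zero|].
  rewrite <- IH.
  replace (fun w => c b * v b w + Sum l (fun b => c b * v b w))%C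
    with (fun w => Sum l (fun b => c b * v b w) + c b * v b w)%C
    by (apply functional_extensionality; intros; ring).
  rewrite H; [ring| |apply Hv].
  intros w. apply (ccont_Sum l (fun b w => c b * v b w)%C). intros d _.
  apply ccont_mult; [apply ccont_const|apply Hv].
Qed.

Definition moment_const (del : R) : R := 100 * del * (1 + 4 * del) ^ 2.

(** * The finite rank operator at fixed mesh *)

Section Core.
Variables (o : C) (del : R) (P N : nat) (X : C -> Prop) (L : sphere -> Prop).
Hypothesis Hdel : 0 < del.
Hypothesis HN : (4 <= N)%nat.
Hypothesis Hmargin : forall x, X x ->
  2 * INR N <= cx o del N x <= INR (msize P N) - 2 * INR N /\
  2 * INR N <= cy o del N x <= INR (msize P N) - 2 * INR N.
Hypothesis HX : Ccompact X.
Hypothesis HLsub : forall p, L p -> sphere_compl X p.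
Hypothesis HLcomp : forall p, sphere_compl X p ->
  exists l, L l /\ same_component (sphere_compl X) p l.

Let h := mesh del N.
Let M := msize P N.
Let holo := holo_near o del N X.
Let T := TT o del P N X.
Let near := nearlist o del P N X.
Let A := moment_const del.

Variables (kap Lam : R).
Hypothesis Hkap : 0 < kap.
Hypothesis HLam : 0 <= Lam.
(** The conclusion of [finite_rank_reduction] for three functionals, taken as a hypothesis so that
    [Lam] can be fixed before [N]. *)
Hypothesis Hred : forall (W V : (C -> C) -> Prop) (osc : (C -> C) -> R -> Prop) (fs : list ((C -> C) -> C)),
    lin_closed W -> lin_closed V -> (forall v, V v -> W v) -> seminorm_like osc ->
    length fs = 3%nat ->
    (forall a, In a fs -> linear_on W a /\ forall u r, 0 <= r -> W u -> osc u r -> Cmod (a u) <= A * r) ->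
    exists lst,
      (length lst <= 3)%nat /\
      (forall c v, In (c, v) lst -> linear_on W c /\
         (forall u r, 0 <= r -> W u -> osc u r -> Cmod (c u) <= Lam * r) /\ V v /\ osc v Lam) /\
      (forall v, V v -> osc v 1 -> osc (reduce lst v) (3 ^ 3) /\
         forall a, In a fs -> Cmod (a (reduce lst v)) <= 3 ^ 3 * kap).

Lemma A_pos : 0 <= A.
Proof. unfold A, moment_const. apply Rmult_le_pos; [lra|apply pow2_ge_0]. Qed.

Lemma Sdel_pos : 0 < Sdel del.
Proof.
  unfold Sdel. assert (0 < / del) by now apply Rinv_0_lt_compat.
  assert (0 < / del ^ 2) by (apply Rinv_0_lt_compat, pow_lt; lra).
  assert (0 < / del ^ 3) by (apply Rinv_0_lt_compat, pow_lt; lra). lra.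
Qed.

Lemma holo_ccont v : holo v -> everywhere_ccont v.
Proof. intros H w. apply H. Qed.

Lemma local_reduction p q : (1 <= p < P)%nat -> (1 <= q < P)%nat -> exists lst,
  (length lst <= 3)%nat /\
  (forall c v, In (c, v) lst -> linear_on everywhere_ccont c /\
     (forall u r, 0 <= r -> everywhere_ccont u -> osc o del N p q u r -> Cmod (c u) <= Lam * r) /\
     holo v /\ osc o del N p q v Lam) /\
  (forall u r, 0 < r -> holo u -> osc o del N p q u r ->
     holo (reduce lst u) /\ osc o del N p q (reduce lst u) (27 * r) /\
     forall l, (l < 3)%nat -> Cmod (moment o del P N p q l (reduce lst u)) <= 27 * kap * r).
Proof.
  intros Hp Hq. set (mom := moment o del P N p q).
  destruct (Hred everywhere_ccont holo (osc o del N p q) (mom 0%nat :: mom 1%nat :: mom 2%nat :: nil))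
    as [lst [H1 [H2 H3]]]; auto.
  - apply everywhere_ccont_closed.
  - apply holo_near_closed.
  - apply holo_ccont.
  - apply osc_seminorm.
  - intros a Ha.
    assert (E : exists l, (l < 3)%nat /\ a = mom l).
    { destruct Ha as [<-|[<-|[<-|[]]]]; eexists; split; try reflexivity; lia. }
    destruct E as [l [Hl ->]]. split; [now apply moment_linear|].
    intros u r Hr Hu Ho. apply (moment_bound o del P N Hdel HN p q); assumption.
  - exists lst. split; [easy|]. split; [exact H2|].
    intros u r Hr Hu Ho.
    (* This is u / r, in the only form that [lin_closed] and [linear_on] handle. *)
    set (u' := fun z => (u z + RtoC (/ r - 1) * u z)%C).
    assert (Hu' : holo u') by (now apply holo_near_closed).
    assert (Ho' : osc o del N p q u' 1).
    { intros w w' Hw Hw'. unfold u'.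
      replace (u w + RtoC (/ r - 1) * u w - (u w' + RtoC (/ r - 1) * u w'))%C
        with (RtoC (/ r) * (u w - u w'))%C by (rewrite RtoC_minus; ring).
      assert (Hi : 0 < / r) by now apply Rinv_0_lt_compat.
      rewrite Cmod_mult, Cmod_R, Rabs_pos_eq by lra.
      specialize (Ho w w' Hw Hw').
      apply Rle_trans with (/ r * r); [apply Rmult_le_compat_l; lra|right; field; lra]. }
    destruct (H3 u' Hu' Ho') as [K1 K2].
    assert (Hlin : forall c v, In (c, v) lst -> linear_on everywhere_ccont c) by (intros c v Hin; now apply (H2 c v)).
    assert (HV : forall c v, In (c, v) lst -> holo v) by (intros c v Hin; now apply (H2 c v)).
    assert (Hru' : holo (reduce lst u')) by (exact (reduce_closed holo lst u' (holo_near_closed o del N X) Hu' HV)).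
    assert (E : reduce lst u = (fun z => reduce lst u' z + RtoC (r - 1) * reduce lst u' z)%C).
    { rewrite <- (reduce_linear everywhere_ccont lst u' u' (RtoC (r - 1))); auto using holo_ccont.
      f_equal. apply functional_extensionality. intros z. unfold u'.
      replace (u z + RtoC (/ r - 1) * u z + RtoC (r - 1) * (u z + RtoC (/ r - 1) * u z))%C
        with ((RtoC r * RtoC (/ r)) * u z)%C by (rewrite !RtoC_minus; ring).
      rewrite <- RtoC_mult, Rinv_r by lra. ring. }
    assert (Hscale : forall t : C, Cmod (t + RtoC (r - 1) * t) = r * Cmod t).
    { intros t. replace (t + RtoC (r - 1) * t)%C with (RtoC r * t)%C by (rewrite RtoC_minus; ring).
      rewrite Cmod_mult, Cmod_R, Rabs_pos_eq by lra. easy. }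
    rewrite E. split; [now apply holo_near_closed|]. split.
    + intros w w' Hw Hw'. specialize (K1 w w' Hw Hw').
      match goal with |- Cmod ?t <= _ =>
        replace t with ((reduce lst u' w - reduce lst u' w') + RtoC (r - 1) * (reduce lst u' w - reduce lst u' w'))%C
        by ring end.
      rewrite Hscale. simpl in K1. nra.
    + intros l Hl. assert (Hmem : In (mom l) (mom 0%nat :: mom 1%nat :: mom 2%nat :: nil)).
      { destruct l as [|[|[|l]]]; simpl; auto; lia. }
      specialize (K2 _ Hmem). fold mom.
      rewrite (moment_linear o del P N Hdel HN p q l); [|now apply holo_ccont|now apply holo_ccont].
      rewrite Hscale. fold (mom l). simpl in K2. nra.
Qed.

Lemma near_length : INR (length near) <= INR P * INR P.
Proof.
  rewrite <- mult_INR. apply le_INR. unfold near, nearlist.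
  eapply Nat.le_trans; [apply filter_length_le|]. rewrite length_prod, length_seq.
  apply Nat.mul_le_mono; lia.
Qed.

Variables (x0 : C) (xs : list C) (eta : R).
Hypothesis Heta : 0 < eta.

Let twopii : C := (RtoC (2 * PI) * Ci)%C.

(** The factor of the extension error [e]: J bounds the number of tents, and 6 is three functions
    per tent times the oscillation 2 e. *)
Definition core_const : R :=
  let J := INR P * INR P in
  16 * J * J + 6 * J * Lam * (Lam * (2560000 + A * Sdel del)).

(** The operator [op] is a Cauchy integral off [X] minus the pieces of the subtracted functions. Its
    functionals accept any continuous function, so it applies to the partition functions [psi x],
    which yields G; by linearity op F = 2 pi i times the sum of f x * G x. *)
Lemma core_approximation : exists G : C -> C -> C,
  (forall x, RL X L (G x)) /\
  forall f u om e, 0 < om -> 0 <= e -> holo u ->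
    (forall w, Cmod (u w - Ext x0 xs eta f w) <= e) ->
    (forall p q, In (p, q) near -> osc o del N p q u om) ->
    forall z, X z ->
    Cmod (twopii * u z - twopii * Sum (x0 :: xs) (fun x => f x * G x z)%C) <=
      432 * 2560000 * om + 27 * kap * om * (INR P * INR P * Sdel del) + e * core_const.
Proof.
  pose proof (mesh_pos del N Hdel HN) as Hh. fold h in Hh.
  pose proof A_pos as HA0. pose proof Sdel_pos as HS0.
  assert (Hpi : twopii <> RtoC 0).
  { unfold twopii. apply Cmult_neq_0.
    - intros E. injection E as E. pose proof PI_RGT_0. lra.
    - intros E. injection E as E. lra. }
  destruct (choice_on_list near nil (fun j lst =>
     (length lst <= 3)%nat /\
     (forall c v, In (c, v) lst -> linear_on everywhere_ccont c /\
       (forall u r, 0 <= r -> everywhere_ccont u -> osc o del N (fst j) (snd j) u r -> Cmod (c u) <= Lam * r) /\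
       holo v /\ osc o del N (fst j) (snd j) v Lam) /\
     (forall u r, 0 < r -> holo u -> osc o del N (fst j) (snd j) u r ->
       holo (reduce lst u) /\ osc o del N (fst j) (snd j) (reduce lst u) (27 * r) /\
       forall l, (l < 3)%nat -> Cmod (moment o del P N (fst j) (snd j) l (reduce lst u)) <= 27 * kap * r)))
    as [lst Hlst].
  { intros [p q] Hj. destruct (nearlist_in o del P N X HN p q Hj) as [Hp [Hq _]]. now apply local_reduction. }
  set (ps := fun (x : C) (w : C) => RtoC (psi x0 xs eta x w)).
  assert (Hps : forall x, everywhere_ccont (ps x)) by (intros x w; apply psi_ccont; auto).
  set (ph := fun j : nat * nat => phi N (fst j) (snd j)).
  set (pt := phitot o del P N X).
  set (op := fun (v : C -> C) (z : C) => (EE o h M pt (fun w => v w * / (w - z)) -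
     Sum near (fun j => Sum (lst j) (fun cv => fst cv v * T (ph j) (snd cv) z)))%C).
  assert (Hact : forall w, active o h M pt w -> ~ X w).
  { intros w Hw Hx. pose proof (phitot_active o del P N X Hdel HN Hmargin w w Hw Hx) as K.
    replace (w - w)%C with (RtoC 0) in K by ring. rewrite Cmod_0 in K. lra. }
  exists (fun x z => / twopii * op (ps x) z)%C. split.
  - intros x. apply RL_scal; auto. unfold op.
    apply RL_ext with (G := (fun z => EE o h M pt (fun w => ps x w * / (w - z)) + RtoC (-1) *
       Sum near (fun j => Sum (lst j) (fun cv => fst cv (ps x) * T (ph j) (snd cv) z)))%C).
    { intros. apply C_ext; simpl; ring. }
    apply RL_plus; [|apply RL_scal; auto].
    + apply RL_EE; auto. intros w Hw. split; [auto|apply Hps].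
    + apply (RL_Sum X L near (fun j z => Sum (lst j) (fun cv => fst cv (ps x) * T (ph j) (snd cv) z))%C).
      intros j Hj. apply (RL_Sum X L (lst j) (fun cv z => fst cv (ps x) * T (ph j) (snd cv) z)%C).
      intros [c v] Hcv. apply RL_scal; auto. apply RL_TT; auto.
      destruct (Hlst j Hj) as [_ [K _]]. destruct (K c v Hcv) as [_ [_ [Hv _]]].
      apply holo_ccont, Hv.
  - intros f u om e Hom He Hu Hue Hosc z Hz.
    set (F := Ext x0 xs eta f).
    assert (HF : everywhere_ccont F) by (intros w; apply Ext_ccont; auto).
    assert (Hzn : forall w, active o h M pt w -> w <> z) by (intros w Hw ->; now apply (Hact z)).
    assert (EF : (twopii * Sum (x0 :: xs) (fun x => f x * (/ twopii * op (ps x) z)))%C = op F z).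
    { rewrite <- Sum_scal.
      rewrite (Sum_ext (x0 :: xs) _ (fun x => f x * op (ps x) z)%C) by (intros; field; exact Hpi).
      unfold op.
      rewrite (Sum_ext (x0 :: xs) _ (fun x => f x * EE o h M pt (fun w => ps x w * / (w - z)) -
        Sum near (fun j => Sum (lst j) (fun cv => (f x * fst cv (ps x)) * T (ph j) (snd cv) z)))%C).
      2: { intros x _. unfold Cminus. rewrite Cmult_plus_distr_l. f_equal.
           transitivity (- (f x * Sum near (fun j => Sum (lst j) (fun cv => fst cv (ps x) * T (ph j) (snd cv) z))))%C; [ring|].
           f_equal. rewrite <- Sum_scal. apply Sum_ext. intros j _. rewrite <- Sum_scal.
           apply Sum_ext. intros; ring. }
      rewrite Sum_minus. f_equal; [|f_equal].
      - rewrite <- (EE_Sum o h M Hh pt (x0 :: xs) f (fun x w => ps x w * / (w - z))%C).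
        + apply (EE_ext o h M Hh). intros w _. unfold F, Ext. rewrite <- Sum_scal_r.
          apply Sum_ext. intros x _. unfold ps. ring.
        + intros x w _ Hw. apply kernel_ccont; [auto|apply Hps].
      - rewrite (Sum_swap (x0 :: xs) near). apply Sum_ext. intros j Hj.
        rewrite (Sum_swap (x0 :: xs) (lst j) (fun x cv => f x * fst cv (ps x) * T (ph j) (snd cv) z)%C).
        apply Sum_ext. intros [c v] Hcv. simpl fst. simpl snd. rewrite Sum_scal_r. f_equal.
        destruct (Hlst j Hj) as [_ [K _]]. destruct (K c v Hcv) as [Hc _].
        symmetry. apply (linear_on_Sum c (x0 :: xs) f ps Hc Hps). }
    rewrite EF. unfold twopii. rewrite (localization o del P N X Hdel HN Hmargin u z Hu Hz).
    fold h M pt near T ph.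
    set (dl := fun w => (u w + RtoC (-1) * F w)%C).
    assert (Hdl : everywhere_ccont dl) by (apply everywhere_ccont_closed; auto using holo_ccont).
    assert (Hdle : forall w, Cmod (dl w) <= e).
    { intros w. unfold dl. replace (u w + RtoC (-1) * F w)%C with (u w - F w)%C by (apply C_ext; simpl; ring).
      apply Hue. }
    assert (ET : forall j, In j near -> T (phi N (fst j) (snd j)) u z =
       (T (ph j) (reduce (lst j) u) z + Sum (lst j) (fun cv => fst cv u * T (ph j) (snd cv) z))%C).
    { intros j Hj. unfold reduce.
      pose proof (TT_Sum o del P N X Hdel HN (ph j) (lst j) (fun cv => fst cv u) (fun cv => snd cv) u z Hz) as K.
      fold T in K. rewrite K; [unfold ph; ring|now apply holo_ccont|].
      intros [c v] w Hcv. destruct (Hlst j Hj) as [_ [K2 _]]. destruct (K2 c v Hcv) as [_ [_ [Hv _]]].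
      apply holo_ccont, Hv. }
    (* Of the three terms only the middle one, the pieces of the reduced [u], is not of order [e];
       its size is governed by the oscillation alone. *)
    assert (ED : (EE o h M pt (fun w => u w * / (w - z)) - Sum near (fun j => T (phi N (fst j) (snd j)) u z) - op F z)%C =
      (EE o h M pt (fun w => dl w * / (w - z)) - Sum near (fun j => T (ph j) (reduce (lst j) u) z)
       - Sum near (fun j => Sum (lst j) (fun cv => fst cv dl * T (ph j) (snd cv) z)))%C).
    { rewrite (Sum_ext near _ _ ET), Sum_plus. unfold op.
      assert (E1 : EE o h M pt (fun w => dl w * / (w - z))%C =
        (EE o h M pt (fun w => u w * / (w - z)) - EE o h M pt (fun w => F w * / (w - z)))%C).
      { rewrite (EE_ext o h M Hh pt (fun w => dl w * / (w - z))%C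
          (fun w => u w * / (w - z) + RtoC (-1) * (F w * / (w - z)))%C).
        - rewrite (EE_lin o h M Hh pt (fun w => u w * / (w - z))%C (fun w => F w * / (w - z))%C).
          + apply C_ext; simpl; ring.
          + intros w Hw. apply kernel_ccont; [auto|apply holo_ccont, Hu].
          + intros w Hw. apply kernel_ccont; [auto|apply HF].
        - intros w _. unfold dl. ring. }
      assert (E2 : Sum near (fun j => Sum (lst j) (fun cv => fst cv dl * T (ph j) (snd cv) z))%C =
        (Sum near (fun j => Sum (lst j) (fun cv => fst cv u * T (ph j) (snd cv) z)) -
         Sum near (fun j => Sum (lst j) (fun cv => fst cv F * T (ph j) (snd cv) z)))%C).
      { rewrite <- Sum_minus. apply Sum_ext. intros j Hj. rewrite <- Sum_minus. apply Sum_ext.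
        intros [c v] Hcv. simpl. destruct (Hlst j Hj) as [_ [K _]]. destruct (K c v Hcv) as [Hc _].
        unfold dl. rewrite (Hc u F (RtoC (-1))); auto using holo_ccont. apply C_ext; simpl; ring. }
      rewrite E1, E2. ring. }
    rewrite ED.
    assert (B1 : Cmod (EE o h M pt (fun w => dl w * / (w - z))%C) <= 16 * (INR P * INR P) * (INR P * INR P) * e).
    { eapply Rle_trans.
      - apply (EE_phitot_bound o del P N X Hdel HN) with (G := e * (2 / del)).
        + apply Rmult_le_pos; [easy|]. apply Rdiv_le_0_compat; lra.
        + intros w Hw. split; [apply kernel_ccont; auto; apply Hdl|].
          assert (Hwz : (w - z)%C <> RtoC 0) by (apply Cminus_neq_0; auto).
          rewrite Cmod_mult, Cmod_inv by easy.
          pose proof (phitot_active o del P N X Hdel HN Hmargin w z Hw Hz) as K.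
          apply Rmult_le_compat; auto using Cmod_ge_0.
          * left. apply Rinv_0_lt_compat. lra.
          * replace (2 / del) with (/ (del / 2)) by (field; lra). apply Rinv_le_contravar; lra.
      - fold near. pose proof near_length as K. pose proof (pos_INR P).
        replace (8 * INR P * INR P * INR (length near) * del * (e * (2 / del)))
          with (16 * (INR P * INR P) * e * INR (length near)) by (field; lra).
        replace (16 * (INR P * INR P) * (INR P * INR P) * e) with (16 * (INR P * INR P) * e * (INR P * INR P)) by ring.
        apply Rmult_le_compat_l; [|easy]. apply Rmult_le_pos; [|easy]. nra. }
    (* 432 is 27 * 16: the oscillation factor of the reduction times the sum of the weights. *)
    assert (B2 : Cmod (Sum near (fun j => T (ph j) (reduce (lst j) u) z)) <=
      432 * 2560000 * om + 27 * kap * om * (INR P * INR P * Sdel del)).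
    { eapply Rle_trans; [apply Sum_mod|].
      apply Rle_trans with (RSum near (fun j => 2560000 * (27 * om) * weight o del N z j + (27 * kap * om) * Sdel del)).
      - apply RSum_le. intros [p q] Hj. destruct (nearlist_in o del P N X HN p q Hj) as [Hp [Hq _]].
        destruct (Hlst _ Hj) as [_ [_ K]]. simpl in K.
        destruct (K u om Hom Hu (Hosc p q Hj)) as [K1 [K2 K3]].
        apply TT_estimate; auto; try lra. apply Rmult_le_pos; lra.
      - rewrite RSum_plus, RSum_scal, RSum_const.
        pose proof (weight_sum o del P N X z) as K. fold near in K. pose proof near_length as K2.
        assert (0 <= 27 * kap * om * Sdel del).
        { apply Rmult_le_pos; [|lra]. apply Rmult_le_pos; lra. }
        assert (INR (length near) * (27 * kap * om * Sdel del) <= INR P * INR P * (27 * kap * om * Sdel del))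
          by (apply Rmult_le_compat_r; auto).
        assert (2560000 * (27 * om) * RSum near (weight o del N z) <= 2560000 * (27 * om) * 16)
          by (apply Rmult_le_compat_l; lra).
        lra. }
    assert (B3 : Cmod (Sum near (fun j => Sum (lst j) (fun cv => fst cv dl * T (ph j) (snd cv) z))%C) <=
      6 * (INR P * INR P) * Lam * (Lam * (2560000 + A * Sdel del)) * e).
    { set (Q := Lam * (2 * e) * (Lam * (2560000 + A * Sdel del))).
      assert (HQ : 0 <= Q).
      { unfold Q. apply Rmult_le_pos; [apply Rmult_le_pos; lra|]. apply Rmult_le_pos; [easy|]. nra. }
      eapply Rle_trans; [apply Sum_mod|].
      apply Rle_trans with (RSum near (fun _ => 3 * Q)).
      - apply RSum_le. intros [p q] Hj. destruct (nearlist_in o del P N X HN p q Hj) as [Hp [Hq _]].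
        destruct (Hlst _ Hj) as [Hlen [K _]]. simpl fst in K. simpl snd in K.
        eapply Rle_trans; [apply Sum_mod|].
        apply Rle_trans with (RSum (lst (p, q)) (fun _ => Q)).
        + apply RSum_le. intros [c v] Hcv. destruct (K c v Hcv) as [_ [Hc [Hv Hov]]].
          simpl fst. simpl snd. rewrite Cmod_mult. unfold Q.
          apply Rmult_le_compat; auto using Cmod_ge_0.
          * apply Hc; auto; [lra|]. intros w w' _ _.
            eapply Rle_trans; [apply Cmod_triangle|]. rewrite Cmod_opp.
            pose proof (Hdle w). pose proof (Hdle w'). lra.
          * assert (Hk0 : 0 <= A * Lam) by (apply Rmult_le_pos; auto).
            assert (Hmom : forall l, (l < 3)%nat -> Cmod (moment o del P N p q l v) <= A * Lam).
            { intros l Hl. apply (moment_bound o del P N Hdel HN p q); auto. apply Hv. }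
            eapply Rle_trans; [apply (TT_estimate o del P N X Hdel HN Hmargin p q v z Lam (A * Lam) Hp Hq Hv Hz HLam Hk0 Hov Hmom)|].
            assert (Hw1 : weight o del N z (p, q) <= 1).
            { unfold weight. assert (Hone : forall t, 0 <= t -> 0 < / (1 + t) ^ 2 <= 1).
              { intros t Ht. split; [apply Rinv_0_lt_compat, pow_lt; lra|].
                apply Rle_trans with (/ 1); [|lra]. apply Rinv_le_contravar; nra. }
              pose proof (Hone _ (Rabs_pos (cx o del N z / INR N - INR (fst (p, q))))).
              pose proof (Hone _ (Rabs_pos (cy o del N z / INR N - INR (snd (p, q))))). nra. }
            pose proof (weight_pos o del N z (p, q)). nra.
        + rewrite RSum_const. apply Rmult_le_compat_r; [easy|]. apply le_INR in Hlen. simpl in Hlen. lra.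
      - rewrite RSum_const. pose proof near_length as K2.
        apply Rle_trans with (INR P * INR P * (3 * Q)).
        + apply Rmult_le_compat_r; [lra|easy].
        + right. unfold Q. ring. }
    unfold core_const.
    eapply Rle_trans; [apply Cmod_triangle|]. rewrite Cmod_opp.
    eapply Rle_trans; [apply Rplus_le_compat_r, Cmod_triangle|]. rewrite Cmod_opp.
    cbv zeta. lra.
Qed.

End Core.

(** * Totally bounded families and the choice of the constants *)

Definition totally_bounded_on (X : C -> Prop) (S : (C -> C) -> Prop) : Prop :=
  forall eps, 0 < eps -> exists fs : list (C -> C), (forall g, In g fs -> S g) /\
    forall f, S f -> exists g, In g fs /\ forall z, X z -> Cmod (f z - g z) <= eps.

Lemma totally_bounded_equicontinuous (X : C -> Prop) (S : (C -> C) -> Prop) :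
  Ccompact X -> (forall f, S f -> continuous_on X f) -> totally_bounded_on X S ->
  forall eps, 0 < eps -> exists d, 0 < d /\
    forall f z w, S f -> X z -> X w -> Cmod (w - z) < d -> Cmod (f w - f z) <= eps.
Proof.
  intros HX HS HT e He. destruct (HT (e / 4)) as [fs [H1 H2]]; [lra|].
  destruct (choice_on_list fs 0 (fun g d => 0 < d /\ forall z w, X z -> X w -> Cmod (w - z) < d ->
     Cmod (g w - g z) < e / 4)) as [D HD].
  { intros g Hg. apply compact_unif_cont; auto; lra. }
  destruct (list_min_pos fs D) as [d [Hd Hm]]; [intros g Hg; now apply HD|].
  exists d. split; [easy|]. intros f z w Hf Hz Hw Hlt.
  destruct (H2 f Hf) as [g [Hg Hfg]]. destruct (HD g Hg) as [_ K]. specialize (Hm g Hg).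
  specialize (K z w Hz Hw ltac:(lra)). pose proof (Hfg z Hz) as A1. pose proof (Hfg w Hw) as A2.
  pose proof (Cmod_dist_triangle (f w) (g w) (f z)).
  pose proof (Cmod_dist_triangle (g w) (g z) (f z)). rewrite (Cmod_minus_sym (g z)) in H0. lra.
Qed.

Lemma nat_above (t : R) : exists n : nat, t <= INR n.
Proof.
  destruct (Rle_dec 0 t) as [H|H].
  - destruct (cell_exists t H) as [n Hn]. exists (S n). rewrite S_INR. lra.
  - exists 0%nat. simpl. lra.
Qed.

(** Order of the choices: [om] and [del] from equicontinuity, [P], [kap], [Lam], then the error
    [ep], the nodes with [eta], a finite net of [S] with its holomorphic extensions, and finally
    [N]. Total boundedness leaves finitely many extensions, hence a common radius [r] of holomorphy,
    to which the mesh is adapted. *)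
Theorem finite_rank_approximation (X : C -> Prop) (L : sphere -> Prop) (S : (C -> C) -> Prop) :
  Ccompact X -> (forall p, L p -> sphere_compl X p) ->
  (forall p, sphere_compl X p -> exists l, L l /\ same_component (sphere_compl X) p l) ->
  (forall f, A_of X f -> Obar X f) ->
  (forall f, S f -> A_of X f) -> totally_bounded_on X S ->
  forall eps, 0 < eps -> exists l : list (C * (C -> C)),
    (forall x G, In (x, G) l -> X x /\ RL X L G) /\
    forall f z, S f -> X z -> Cmod (f z - Sum l (fun xg => f (fst xg) * snd xg z)%C) < eps.
Proof.
  intros HX HLsub HLcomp HA HS HT eps Heps.
  destruct (classic (exists x, X x)) as [[x0 Hx0]|Hempty].
  2: { exists nil. split; [intros x G []|]. intros f z _ Hz. exfalso. eauto. }
  (* 432 * 2560000 is the factor of the main error in [core_approximation]; the added 1 absorbs the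
     leftover moments through the choice of [kap]. *)
  set (om := eps / (4 * (432 * 2560000 + 1))).
  assert (Hom : 0 < om) by (apply Rdiv_lt_0_compat; lra).
  assert (Eom : (432 * 2560000 + 1) * om = eps / 4) by (unfold om; field).
  assert (HSc : forall f, S f -> continuous_on X f) by (intros f Hf; apply (HS f Hf)).
  destruct (totally_bounded_equicontinuous X S HX HSc HT (om / 4)) as [d [Hd Heq]]; [lra|].
  (* Room to spare: the nodes used at a point [w] of a box of radius 4 are within 44 del of a point
     of [X] in the box of radius 3, namely 14 del to [w] and 30 del to the node. *)
  set (del := d / 100). assert (Hdel : 0 < del) by (unfold del; lra).
  destruct (compact_bounded X HX) as [B [HB HXB]].
  set (o := (- B - 2 * del, - B - 2 * del) : C).
  destruct (nat_above ((2 * B + 4 * del) / del)) as [P HP].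
  assert (HP' : 2 * B + 4 * del <= INR P * del) by (apply (Rle_div_l _ _ _ Hdel); exact HP).
  pose proof (Sdel_pos del Hdel) as HSd. pose proof (pos_INR P) as HP0.
  set (J := INR P * INR P). assert (HJ : 0 <= J) by (unfold J; nra).
  assert (HJS : 0 <= J * Sdel del) by nra.
  set (kap := / (27 * (J * Sdel del) + 1)).
  assert (Hkap : 0 < kap) by (apply Rinv_0_lt_compat; lra).
  assert (HkapJ : 27 * kap * (J * Sdel del) <= 1).
  { apply Rmult_le_reg_l with (27 * (J * Sdel del) + 1); [lra|].
    replace ((27 * (J * Sdel del) + 1) * (27 * kap * (J * Sdel del))) with (27 * (J * Sdel del))
      by (unfold kap; field; lra). lra. }
  destruct (finite_rank_reduction 3 (moment_const del) kap (A_pos del Hdel) Hkap) as [Lam [HLam Hred]].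
  set (K := core_const del P Lam).
  assert (HK : 0 <= K).
  { unfold K, core_const. fold J. pose proof (A_pos del Hdel).
    assert (0 <= moment_const del * Sdel del) by nra.
    assert (0 <= J * Lam) by nra. assert (0 <= Lam * (2560000 + moment_const del * Sdel del)) by nra.
    assert (0 <= J * J) by nra. nra. }
  (* The first bound keeps the oscillation of the extension below [om]; the second makes 4 * ep * K
     at most eps / 4. *)
  set (ep := Rmin (om / 12) (eps / (16 * (K + 1)))).
  assert (Hep : 0 < ep) by (apply Rmin_glb_lt; [lra|apply Rdiv_lt_0_compat; lra]).
  assert (Hep1 : ep <= om / 12) by apply Rmin_l.
  assert (Hep2 : 16 * (K + 1) * ep <= eps).
  { rewrite Rmult_comm. apply (proj2 (Rle_div_r ep eps (16 * (K + 1)) ltac:(lra))). apply Rmin_r. }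
  destruct (totally_bounded_equicontinuous X S HX HSc HT ep Hep) as [d' [Hd' Heq']].
  set (eta := Rmin del (d' / 2)).
  assert (Heta : 0 < eta) by (apply Rmin_glb_lt; lra).
  assert (Heta1 : eta <= del) by apply Rmin_l. assert (Heta2 : eta <= d' / 2) by apply Rmin_r.
  destruct (compact_net X (eta / 2) HX) as [xs [Hxs Hnet]]; [lra|].
  assert (Hnodes : forall y, In y (x0 :: xs) -> X y) by (intros y [<-|Hy]; auto).
  assert (Hdmin : forall w x, X x -> dmin x0 xs w <= Cmod (w - x) + eta / 2).
  { intros w x Hx. destruct (Hnet x Hx) as [y [Hy Hlt]].
    assert (dmin x0 xs w <= Cmod (w - y)) by (apply dmin_le; now right).
    pose proof (Cmod_dist_triangle w x y). lra. }
  destruct (HT ep Hep) as [fs [Hfs Hfnet]].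
  destruct (choice_on_list fs ((fun _ => RtoC 0), 0) (fun f ur =>
     (forall w, ccont (fst ur) w) /\
     (0 < snd ur /\ forall x w, X x -> Cmod (w - x) < snd ur -> C_differentiable_at (fst ur) w) /\
     (forall w, Cmod (fst ur w - Ext x0 xs eta f w) <= 3 * ep) /\
     (forall x, X x -> Cmod (fst ur x - f x) <= ep))) as [U HU].
  { intros f Hf.
    destruct (holomorphic_extension X f (Ext x0 xs eta f) ep HX Hep) as [u [K1 [[r [Hr K2]] [K3 K4]]]].
    - apply HA, HS, Hfs, Hf.
    - intros w. now apply Ext_ccont.
    - intros x Hx. apply Ext_close; auto; [lra|]. intros y Hy Hlt.
      apply Heq'; auto. specialize (Hdmin x x Hx).
      replace (x - x)%C with (RtoC 0) in Hdmin by ring. rewrite Cmod_0 in Hdmin.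
      rewrite Cmod_minus_sym. lra.
    - exists (u, r). simpl. auto. }
  destruct (list_min_pos fs (fun f => snd (U f))) as [r [Hr Hrm]].
  { intros f Hf. now apply HU. }
  destruct (nat_above (4 * del / r + 1)) as [n Hn].
  set (N := (n + 4)%nat).
  assert (HN : (4 <= N)%nat) by (unfold N; lia).
  assert (HN4 := N_ge N HN).
  assert (Hmesh : 4 * mesh del N < r).
  { unfold mesh. replace (4 * (del / INR N)) with (4 * del / INR N) by (field; lra).
    apply (proj2 (Rlt_div_l (4 * del) r (INR N) ltac:(lra))).
    assert (4 * del / r < INR N) by (unfold N; rewrite plus_INR; simpl; lra).
    apply (proj1 (Rlt_div_l (4 * del) (INR N) r Hr)) in H. lra. }
  assert (Hmargin : forall x, X x ->
    2 * INR N <= cx o del N x <= INR (msize P N) - 2 * INR N /\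
    2 * INR N <= cy o del N x <= INR (msize P N) - 2 * INR N).
  { intros x Hx. pose proof (HXB x Hx) as Hb.
    pose proof (Re_le_Cmod x) as Hre. pose proof (Im_le_Cmod x) as Him.
    assert (Gen : forall t, Rabs t <= B ->
      2 * INR N <= (t - (- B - 2 * del)) / mesh del N <= INR (msize P N) - 2 * INR N).
    { intros t Ht. apply Rabs_le_between in Ht. pose proof (mesh_pos del N Hdel HN) as Hh.
      pose proof (mesh_N del N HN) as E. unfold msize. rewrite mult_INR. split.
      - apply (proj1 (Rle_div_r _ _ _ Hh)). nra.
      - apply (proj2 (Rle_div_l _ _ _ Hh)). nra. }
    split; apply Gen; lra. }
  destruct (core_approximation o del P N X L Hdel HN Hmargin HX HLsub HLcomp kap Lam Hkap HLam Hred
    x0 xs eta Heta) as [G [HG Hmain]].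
  exists (map (fun x => (x, G x)) (x0 :: xs)). split.
  { intros x g Hin. apply in_map_iff in Hin. destruct Hin as [y [E Hy]]. injection E as <- <-.
    split; [now apply Hnodes|apply HG]. }
  intros f z Hf Hz. rewrite Sum_map. simpl fst. simpl snd.
  destruct (Hfnet f Hf) as [g [Hg Hfg]].
  destruct (HU g Hg) as [Uc [[_ Ud] [Ue Ug]]]. specialize (Hrm g Hg). simpl in Hrm.
  set (u := fst (U g)) in *.
  assert (Hmain' : Cmod ((RtoC (2 * PI) * Ci) * u z - (RtoC (2 * PI) * Ci) * Sum (x0 :: xs) (fun x => f x * G x z)%C)
     <= 432 * 2560000 * om + 27 * kap * om * (J * Sdel del) + 4 * ep * K).
  { apply Hmain; auto; try lra.
    - split; [easy|]. intros x w Hx H1 H2. apply (Ud x w Hx).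
      eapply Rle_lt_trans; [apply (coord_Cmod o del N Hdel HN w x 2 H1 H2)|]. lra.
    - intros w. pose proof (Ue w) as A1.
      assert (A2 : Cmod (Ext x0 xs eta g w - Ext x0 xs eta f w) <= ep).
      { apply Ext_diff; auto; [lra|]. intros x Hx. rewrite Cmod_minus_sym. apply Hfg. auto. }
      pose proof (Cmod_dist_triangle (u w) (Ext x0 xs eta g w) (Ext x0 xs eta f w)). lra.
    - intros p q Hpq. apply nearlist_in in Hpq; auto. destruct Hpq as [Hp [Hq [x [Hx Hbx]]]].
      assert (Hclose : forall w, box o del N p q 4 w -> Cmod (u w - g x) <= 3 * ep + om / 4).
      { intros w Hw.
        assert (Hwx : Cmod (w - x) <= 14 * del).
        { destruct Hw as [W1 W2]. destruct Hbx as [V1 V2].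
          apply Rabs_le_between in W1, W2, V1, V2.
          eapply Rle_trans; [apply (coord_Cmod o del N Hdel HN w x (7 * INR N)); apply Rabs_le; lra|].
          pose proof (mesh_N del N HN). nra. }
        assert (A2 : Cmod (Ext x0 xs eta g w - g x) <= om / 4).
        { apply Ext_close; auto; [lra|]. intros y Hy Hlt. apply Heq; auto.
          pose proof (Hdmin w x Hx). pose proof (Cmod_dist_triangle y w x).
          rewrite (Cmod_minus_sym y w) in H0. unfold del in *. lra. }
        pose proof (Ue w). pose proof (Cmod_dist_triangle (u w) (Ext x0 xs eta g w) (g x)). lra. }
      intros w w' Hw Hw'. pose proof (Hclose w Hw). pose proof (Hclose w' Hw') as H1.
      pose proof (Cmod_dist_triangle (u w) (g x) (u w')). rewrite (Cmod_minus_sym (g x)) in H0. lra. }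
  set (Sg := Sum (x0 :: xs) (fun x => f x * G x z)%C) in *.
  replace (RtoC (2 * PI) * Ci * u z - RtoC (2 * PI) * Ci * Sg)%C with (RtoC (2 * PI) * Ci * (u z - Sg))%C
    in Hmain' by ring.
  rewrite !Cmod_mult, Cmod_Ci, Cmod_R, Rabs_pos_eq in Hmain' by (pose proof PI_RGT_0; lra).
  assert (Hpi : 1 <= 2 * PI) by (pose proof PI2_1; lra).
  pose proof (Cmod_ge_0 (u z - Sg)) as P0.
  assert (F1 : Cmod (u z - Sg) <= 432 * 2560000 * om + 27 * kap * om * (J * Sdel del) + 4 * ep * K) by nra.
  assert (F2 : 27 * kap * om * (J * Sdel del) <= om).
  { replace (27 * kap * om * (J * Sdel del)) with (27 * kap * (J * Sdel del) * om) by ring. nra. }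
  pose proof (Cmod_dist_triangle (f z) (g z) Sg). pose proof (Cmod_dist_triangle (g z) (u z) Sg).
  pose proof (Hfg z Hz). pose proof (Ug z Hz) as Ugz. rewrite Cmod_minus_sym in Ugz. lra.
Qed.

(** * Infinite products *)

Section Product.
Variables (I : Type) (K : I -> C -> Prop).
Hypothesis hK : forall i, Ccompact (K i).

Definition agree_near (J : list I) (d : R) (x y : I -> C) : Prop :=
  forall j, In j J -> Cmod (y j - x j) < d.

(* If it failed, a maximal set of pairs (i, c) all of whose finite subsets are approximated by
   the first components of bad pairs (x, y) would contain the graph of a point of the product,
   at which f could not be continuous. *)
Lemma product_uniform_continuity (f : (I -> C) -> C) : prod_continuous_on K f ->
  forall eps, 0 < eps -> exists J d, 0 < d /\
    forall x y, in_product K x -> in_product K y -> agree_near J d x y ->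
      Cmod (f y - f x) < eps.
Proof.
  intros Hf eps Heps. apply NNPP. intros Hno.
  set (bad := fun J d x y => in_product K x /\ in_product K y /\ agree_near J d x y /\
    eps <= Cmod (f y - f x)).
  assert (Hbad : forall J d, 0 < d -> exists x y, bad J d x y).
  { intros J d Hd. apply NNPP. intros Hn. apply Hno. exists J, d. split; [easy|].
    intros x y Hx Hy Hxy. apply Rnot_le_lt. intros Hle. apply Hn. exists x, y. repeat split; auto. }
  set (fits := fun (l : list (I * C)) r (x : I -> C) =>
    forall i c, In (i, c) l -> Cmod (x i - c) < r).
  (* Finite parts of [G] are approximated by bad pairs at every scale. The condition concerns finite
     subsets only, so it passes to unions of chains. *)
  set (PP := fun G : I * C -> Prop => forall l, (forall p, In p l -> G p) ->
    forall r J d, 0 < r -> 0 < d -> exists x y, bad J d x y /\ fits l r x).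
  destruct (@classical_sets.Zorn_bigcup (I * C)%type PP) as [G [HG Hmax]].
  { intros F HF Htot l Hl r J d Hr Hd.
    assert (Hone : l = nil \/ exists Y, F Y /\ forall p, In p l -> Y p).
    { clear r J d Hr Hd. induction l as [|p l IH]; [now left|]. right.
      destruct (Hl p (or_introl eq_refl)) as [Y1 HY1 Hp].
      destruct IH as [->|[Y2 [HY2 Hl2]]]; [intros; apply Hl; now right| |].
      - exists Y1. split; [exact HY1|]. intros p' [<-|[]]. exact Hp.
      - destruct (Htot Y1 Y2 HY1 HY2) as [H12|H21].
        + exists Y2. split; [easy|]. intros p' [<-|Hp']; auto.
        + exists Y1. split; [easy|]. intros p' [<-|Hp']; auto. }
    destruct Hone as [->|[Y [HY HlY]]].
    - destruct (Hbad J d Hd) as [x [y Hxy]]. exists x, y. split; [easy|]. intros i c [].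
    - exact (HF Y HY l HlY r J d Hr Hd). }
  assert (Hpt : forall i, exists c, K i c /\ G (i, c)).
  { intros i. apply NNPP. intros Hn.
    (* By maximality no pair (i, c) can be added, so each [c] has a ball that bad pairs compatible
       with some finite part of [G] avoid. Pooling the data of a finite subcover contradicts
       [HG]. *)
    destruct (compact_balls (K i) (fun c r => exists l J d, (forall p, In p l -> G p) /\ 0 < d /\
      forall x y, bad J d x y -> fits l r x -> Cmod (x i - c) < r -> False) (hK i)) as [cs [Hcs Hcov]].
    { intros c Hc. assert (HGn : ~ G (i, c)) by (intros H; apply Hn; exists c; auto).
      assert (HnP : ~ PP (fun p => G p \/ p = (i, c))).
      { apply Hmax. split.
        - intros p Hp. now left.
        - intros Hsub. apply HGn, Hsub. now right. }
      unfold PP in HnP. apply not_all_ex_not in HnP. destruct HnP as [l HnP].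
      apply imply_to_and in HnP. destruct HnP as [Hl HnP].
      apply not_all_ex_not in HnP. destruct HnP as [r HnP].
      apply not_all_ex_not in HnP. destruct HnP as [J HnP].
      apply not_all_ex_not in HnP. destruct HnP as [d HnP].
      apply imply_to_and in HnP. destruct HnP as [Hr HnP].
      apply imply_to_and in HnP. destruct HnP as [Hd HnP].
      exists r. split; [easy|].
      exists (filter (fun p => if excluded_middle_informative (G p) then true else false) l), J, d.
      split; [|split; [easy|]].
      - intros p Hp. apply filter_In in Hp. destruct Hp as [_ Hp].
        now destruct excluded_middle_informative.
      - intros x y Hxy Hfit Hi. apply HnP. exists x, y. split; [easy|].
        intros i' c' Hin. destruct (Hl _ Hin) as [HGp|E].
        + apply Hfit. apply filter_In. split; [easy|]. now destruct excluded_middle_informative.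
        + injection E as -> ->. exact Hi. }
    destruct (choice_on_list cs (nil, nil, 0) (fun cr ljd =>
      (forall p, In p (fst (fst ljd)) -> G p) /\ 0 < snd ljd /\
      forall x y, bad (snd (fst ljd)) (snd ljd) x y -> fits (fst (fst ljd)) (snd cr) x ->
        Cmod (x i - fst cr) < snd cr -> False)) as [W HW].
    { intros [c r] Hin. destruct (Hcs c r Hin) as [_ [_ [l [J [d Hljd]]]]].
      exists (l, J, d). exact Hljd. }
    destruct (list_min_pos cs (fun cr => snd cr)) as [r [Hr Hrm]].
    { intros [c r] Hin. now apply (Hcs c r). }
    destruct (list_min_pos cs (fun cr => snd (W cr))) as [d [Hd Hdm]].
    { intros cr Hin. now apply HW. }
    destruct (HG (flat_map (fun cr => fst (fst (W cr))) cs)) with (r := r) (d := d)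
      (J := flat_map (fun cr => snd (fst (W cr))) cs) as [x [y [Hxy Hfit]]]; auto.
    { intros p Hp. apply in_flat_map in Hp. destruct Hp as [cr [Hcr Hp]]. now apply (HW cr Hcr). }
    destruct Hxy as [Hx [Hy [Hag Hfar]]].
    destruct (Hcov (x i) (Hx i)) as [c [rc [Hin Hlt]]].
    destruct (HW _ Hin) as [_ [_ Hcontra]]. apply (Hcontra x y); auto.
    - repeat split; auto. intros j Hj. specialize (Hdm _ Hin). simpl in Hdm.
      eapply Rlt_le_trans; [apply Hag|exact Hdm]. apply in_flat_map. eauto.
    - intros i' c' Hp. specialize (Hrm _ Hin). eapply Rlt_le_trans; [apply Hfit|exact Hrm].
      apply in_flat_map. eauto. }
  set (xs := fun i => proj1_sig (constructive_indefinite_description _ (Hpt i))).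
  assert (Hxs : forall i, K i (xs i) /\ G (i, xs i)).
  { intros i. unfold xs. now destruct constructive_indefinite_description. }
  (* Continuity at [xs]: a bad pair fitted to [xs] on [J] has both members close to [xs] there,
     which contradicts its gap eps. *)
  destruct (Hf xs (fun i => proj1 (Hxs i)) (eps / 2)) as [J [d [Hd Hcont]]]; [lra|].
  destruct (HG (map (fun j => (j, xs j)) J)) with (r := d / 2) (d := d / 2) (J := J)
    as [x [y [[Hx [Hy [Hag Hfar]]] Hfit]]]; try lra.
  { intros p Hp. apply in_map_iff in Hp. destruct Hp as [j [<- _]]. apply Hxs. }
  assert (Hxd : forall j, In j J -> Cmod (x j - xs j) < d / 2).
  { intros j Hj. apply Hfit. apply in_map_iff. eauto. }
  assert (Hcont' : forall u, in_product K u -> (forall j, In j J -> Cmod (u j - xs j) < d) ->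
    Cmod (f u - f xs) < eps / 2).
  { intros u Hu Hcl. rewrite <- Cnorm_Cmod. apply Hcont; [easy|]. intros j Hj.
    rewrite Cnorm_Cmod. now apply Hcl. }
  assert (A1 : Cmod (f x - f xs) < eps / 2).
  { apply Hcont'; auto. intros j Hj. specialize (Hxd j Hj). lra. }
  assert (A2 : Cmod (f y - f xs) < eps / 2).
  { apply Hcont'; auto. intros j Hj. specialize (Hxd j Hj). specialize (Hag j Hj).
    pose proof (Cmod_dist_triangle (y j) (x j) (xs j)). lra. }
  pose proof (Cmod_dist_triangle (f y) (f xs) (f x)) as A3.
  rewrite (Cmod_minus_sym (f xs)) in A3. lra.
Qed.

Lemma update_same (x : I -> C) i z : update x i z i = z.
Proof. unfold update. now destruct excluded_middle_informative. Qed.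

Lemma update_other (x : I -> C) i z j : j <> i -> update x i z j = x j.
Proof. intros H. unfold update. now destruct excluded_middle_informative. Qed.

Lemma update_in (x : I -> C) i z : in_product K x -> K i z -> in_product K (update x i z).
Proof.
  intros Hx Hz j. destruct (classic (j = i)) as [->|H].
  - now rewrite update_same.
  - now rewrite update_other.
Qed.

Lemma update_update (x : I -> C) i z z' : update (update x i z) i z' = update x i z'.
Proof.
  apply functional_extensionality. intros j. destruct (classic (j = i)) as [->|H].
  - now rewrite !update_same.
  - now rewrite !update_other.
Qed.

Lemma update_comm (x : I -> C) i j z z' : i <> j ->
  update (update x i z) j z' = update (update x j z') i z.
Proof.
  intros Hij. apply functional_extensionality. intros k.
  unfold update. repeat destruct excluded_middle_informative; congruence.
Qed.

Lemma update_id (x : I -> C) i : update x i (x i) = x.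
Proof.
  apply functional_extensionality. intros j. destruct (classic (j = i)) as [->|H].
  - now rewrite update_same.
  - now rewrite update_other.
Qed.

Lemma product_net (J : list I) (d : R) : 0 < d -> (exists w, in_product K w) ->
  exists lx : list (I -> C), (forall x, In x lx -> in_product K x) /\
    forall x, in_product K x -> exists x', In x' lx /\ agree_near J d x' x.
Proof.
  intros Hd [w Hw]. induction J as [|i J [lx [H1 H2]]].
  - exists (w :: nil). split; [now intros x [<-|[]]|]. intros x _. exists w. split; [now left|].
    intros j [].
  - destruct (compact_net (K i) d (hK i) Hd) as [cs [Hcs Hnet]].
    exists (flat_map (fun x => map (update x i) cs) lx). split.
    + intros x Hx. apply in_flat_map in Hx. destruct Hx as [x' [Hx' Hx]].
      apply in_map_iff in Hx. destruct Hx as [c [<- Hc]]. apply update_in; auto.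
    + intros x Hx. destruct (H2 x Hx) as [x' [Hx' Hag]].
      destruct (Hnet (x i) (Hx i)) as [c [Hc Hlt]].
      exists (update x' i c). split.
      * apply in_flat_map. exists x'. split; [easy|]. apply in_map_iff. eauto.
      * intros j Hj. destruct (classic (j = i)) as [->|Hji].
        -- rewrite update_same. exact Hlt.
        -- rewrite update_other by easy. apply Hag. destruct Hj; congruence.
Qed.

Lemma product_bounded (f : (I -> C) -> C) : prod_continuous_on K f ->
  exists B, 0 < B /\ forall x, in_product K x -> Cmod (f x) <= B.
Proof.
  intros Hf. destruct (classic (exists w, in_product K w)) as [Hw|Hw].
  2: { exists 1. split; [lra|]. intros x Hx. exfalso. eauto. }
  destruct (product_uniform_continuity f Hf 1) as [J [d [Hd Huc]]]; [lra|].
  destruct (product_net J d Hd Hw) as [lx [H1 H2]].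
  destruct (list_max lx (fun x => Cmod (f x))) as [m [Hm Hmax]].
  exists (m + 1). split; [lra|]. intros x Hx. destruct (H2 x Hx) as [x' [Hin Hag]].
  specialize (Huc x' x (H1 x' Hin) Hx Hag). specialize (Hmax x' Hin).
  pose proof (Cmod_le_add (f x) (f x')). lra.
Qed.

Lemma A_of_const (X : C -> Prop) (c : C) : A_of X (fun _ => c).
Proof.
  split.
  - intros z _ e He. exists 1. split; [lra|]. intros w _ _. rewrite Cnorm_Cmod.
    change (Cmod (c - c)%C < e). replace (c - c)%C with (RtoC 0) by ring. now rewrite Cmod_0.
  - intros z _. apply cderiv_differentiable with (RtoC 0). intros e He. exists 1. split; [lra|].
    intros w _. replace (c - c - 0 * (w - z))%C with (RtoC 0) by ring. rewrite Cmod_0.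
    pose proof (Cmod_ge_0 (w - z)). nra.
Qed.

Lemma A_D_freeze (f : (I -> C) -> C) i c : A_D_prod K f -> K i c ->
  A_D_prod K (fun x => f (update x i c)).
Proof.
  intros [Hf1 Hf2] Hc. split.
  - intros x Hx e He. destruct (Hf1 (update x i c) (update_in x i c Hx Hc) e He) as [J [d [Hd H]]].
    exists J, d. split; [easy|]. intros y Hy Hcl. apply H; [now apply update_in|].
    intros j Hj. destruct (classic (j = i)) as [->|Hji].
    + rewrite !update_same, Cnorm_Cmod. change (Cmod (c - c)%C < d).
      replace (c - c)%C with (RtoC 0) by ring. now rewrite Cmod_0.
    + rewrite !update_other by easy. auto.
  - intros i0 w Hw. destruct (classic (i0 = i)) as [->|Hi].
    + replace (fun z => f (update (update w i z) i c)) with (fun _ : C => f (update w i c)).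
      * apply A_of_const.
      * apply functional_extensionality. intros z. now rewrite update_update.
    + replace (fun z => f (update (update w i0 z) i c)) with (fun z => f (update (update w i c) i0 z)).
      * apply Hf2. now apply update_in.
      * apply functional_extensionality. intros z. now rewrite update_comm.
Qed.

Definition slices (f : (I -> C) -> C) (i : I) (g : C -> C) : Prop :=
  exists x, in_product K x /\ g = (fun z => f (update x i z)).

(** By uniform continuity, slices through points that are close on a finite set of coordinates are
    uniformly close, and [product_net] supplies finitely many such points. *)
Lemma slices_totally_bounded f i : prod_continuous_on K f ->
  totally_bounded_on (K i) (slices f i).
Proof.
  intros Hf e He. destruct (classic (exists w, in_product K w)) as [Hw|Hw].
  2: { exists nil. split; [intros g []|]. intros g [x [Hx _]]. exfalso. eauto. }
  destruct (product_uniform_continuity f Hf e He) as [J [d [Hd Huc]]].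
  destruct (product_net J d Hd Hw) as [lx [H1 H2]].
  exists (map (fun x z => f (update x i z)) lx). split.
  - intros g Hg. apply in_map_iff in Hg. destruct Hg as [x [<- Hx]]. exists x. auto.
  - intros g [x [Hx ->]]. destruct (H2 x Hx) as [x' [Hin Hag]].
    exists (fun z => f (update x' i z)). split; [apply in_map_iff; eauto|].
    intros z Hz. left. apply Huc; auto using update_in. intros j Hj.
    destruct (classic (j = i)) as [->|Hji].
    + rewrite !update_same. replace (z - z)%C with (RtoC 0) by ring. now rewrite Cmod_0.
    + rewrite !update_other by easy. auto.
Qed.

End Product.

(** * Sums of products with prescribed variables *)

Section SumProducts.
Variables (I : Type) (L : I -> sphere -> Prop).

(** Recording the variables makes F insensitive to coordinates outside [J] ([supported_depends]),
    which the induction exploits. *)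
Definition supported_sum (J : list I) (F : (I -> C) -> C) : Prop :=
  exists s : list (CC * list (I * (CC -> CC))),
    (forall c fac, In (c, fac) s -> forall i r, In (i, r) fac ->
        rational_poles_in (L i) r /\ In i J) /\
    (forall x, F x = sum_terms s x).

Lemma supported_sum_rational J F : supported_sum J F -> sum_prod_rational L F.
Proof.
  intros [s [H1 H2]]. exists s. split; [|easy]. intros c fac Hin i r Hir. now apply (H1 c fac Hin i r).
Qed.

Lemma supported_mono J J' F : (forall i, In i J -> In i J') -> supported_sum J F -> supported_sum J' F.
Proof.
  intros HJ [s [H1 H2]]. exists s. split; [|easy]. intros c fac Hin i r Hir.
  destruct (H1 c fac Hin i r Hir). auto.
Qed.

Lemma prod_fac_app (a b : list (I * (CC -> CC))) (x : I -> CC) :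
  prod_fac (a ++ b) x = Cmult (prod_fac a x) (prod_fac b x).
Proof.
  induction a as [|[i r] a IH]; simpl.
  - change C1 with (RtoC 1). now rewrite Cmult_1_l.
  - rewrite IH. apply Cmult_assoc.
Qed.

Lemma sum_terms_Sum (s : list (CC * list (I * (CC -> CC)))) (x : I -> CC) :
  sum_terms s x = Sum s (fun t => Cmult (fst t) (prod_fac (snd t) x)).
Proof.
  induction s as [|[c fac] s IH]; simpl; [reflexivity|]. rewrite IH. reflexivity.
Qed.

Lemma supported_depends J F x y : supported_sum J F -> (forall j, In j J -> x j = y j) -> F x = F y.
Proof.
  intros [s [H1 H2]] Hxy. rewrite !H2, !sum_terms_Sum. apply Sum_ext. intros [c fac] Hin.
  simpl. f_equal. specialize (H1 c fac Hin). clear Hin. induction fac as [|[i r] fac IH]; simpl; [easy|].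
  rewrite IH by (intros; apply H1; now right). rewrite Hxy; [easy|].
  apply (H1 i r). now left.
Qed.

Lemma supported_const J c : supported_sum J (fun _ => c).
Proof.
  exists ((c, nil) :: nil). split.
  - intros c' fac [E|[]] i r Hir. injection E as <- <-. destruct Hir.
  - intros x. rewrite sum_terms_Sum. simpl. change C1 with (RtoC 1). ring.
Qed.

Lemma supported_plus J F G : supported_sum J F -> supported_sum J G ->
  supported_sum J (fun x => F x + G x)%C.
Proof.
  intros [s [H1 H2]] [t [K1 K2]]. exists (s ++ t). split.
  - intros c fac Hin. apply in_app_or in Hin. destruct Hin; [now apply (H1 c)|now apply (K1 c)].
  - intros x. rewrite H2, K2, !sum_terms_Sum, Sum_app. reflexivity.
Qed.

Lemma supported_mult J F G : supported_sum J F -> supported_sum J G ->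
  supported_sum J (fun x => F x * G x)%C.
Proof.
  intros [s [H1 H2]] [t [K1 K2]].
  exists (flat_map (fun a => map (fun b => (Cmult (fst a) (fst b), snd a ++ snd b)) t) s). split.
  - intros c fac Hin i r Hir. apply in_flat_map in Hin. destruct Hin as [[c1 f1] [Hs Hin]].
    apply in_map_iff in Hin. destruct Hin as [[c2 f2] [E Ht]]. injection E as <- <-.
    apply in_app_or in Hir. destruct Hir; [now apply (H1 c1 f1 Hs)|now apply (K1 c2 f2 Ht)].
  - intros x. rewrite H2, K2, !sum_terms_Sum, Sum_flat_map, <- Sum_scal_r. apply Sum_ext.
    intros a _. rewrite Sum_map, <- Sum_scal. apply Sum_ext. intros b _. cbn [fst snd].
    rewrite prod_fac_app.
    enough (E : forall p q r s : C, (p * q * (r * s))%C = (p * r * (q * s))%C) by apply E. intros; ring.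
Qed.

Lemma supported_gen J i r : In i J -> rational_poles_in (L i) r -> supported_sum J (fun x => r (x i)).
Proof.
  intros Hi Hr. exists ((RtoC 1, (i, r) :: nil) :: nil). split.
  - intros c fac [E|[]] i' r' Hir. injection E as <- <-. destruct Hir as [E|[]].
    injection E as <- <-. auto.
  - intros x. rewrite sum_terms_Sum. simpl. change Cmul with Cmult. change C1 with (RtoC 1).
    enough (E : forall t : C, t = (1 * (t * 1) + 0)%C) by apply E. intros; ring.
Qed.

Lemma rational_pole (Li : sphere -> Prop) a : Li (Some a) ->
  rational_poles_in Li (fun z => / (z - a))%C.
Proof.
  intros Ha.
  assert (Eq : forall z : C, peval (Copp a :: RtoC 1 :: nil) z = (z - a)%C).
  { intros z. apply C_ext; simpl; ring. }
  assert (Ep : forall z : C, peval (RtoC 1 :: nil) z = RtoC 1).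
  { intros z. apply C_ext; simpl; ring. }
  exists (RtoC 1 :: nil), (Copp a :: RtoC 1 :: nil). split; [|split; [|split]].
  - exists (RtoC 1). split; [simpl; auto|]. intros E. injection E as E. lra.
  - intros z Hz. rewrite Eq. apply (Cminus_neq_0 z a). congruence.
  (* Beyond |a| + 1 the denominator has modulus above 1, so the quotient is bounded at infinity. *)
  - intros _. exists (Cmod a + 1), 1. intros z Hz. rewrite Eq, Ep, !Cnorm_Cmod in *.
    rewrite Cmod_1. pose proof (Cmod_le_add z a). lra.
  - intros z Hz. rewrite Eq, Ep. unfold Cdiv. rewrite Cinv_Complex. change Cmul with Cmult.
    now rewrite Cmult_1_l.
Qed.

Lemma rational_id (Li : sphere -> Prop) : Li None -> rational_poles_in Li (fun z => z).
Proof.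
  intros HN.
  assert (Ep : forall z : C, peval (RtoC 0 :: RtoC 1 :: nil) z = z).
  { intros z. apply C_ext; simpl; ring. }
  assert (Eq : forall z : C, peval (RtoC 1 :: nil) z = RtoC 1).
  { intros z. apply C_ext; simpl; ring. }
  assert (H1 : RtoC 1 <> RtoC 0) by (intros E; injection E as E; lra).
  exists (RtoC 0 :: RtoC 1 :: nil), (RtoC 1 :: nil). split; [|split; [|split]].
  - exists (RtoC 1). split; [simpl; auto|exact H1].
  - intros z _. rewrite Eq. exact H1.
  - intros H. now exfalso.
  - intros z _. rewrite Eq, Ep. unfold Cdiv. rewrite Cinv_Complex. change Cmul with Cmult.
    enough (E : forall t : C, t = (t * / 1)%C) by apply E. intros t. field.
Qed.

Lemma supported_ralg J i g : In i J -> ralg (L i) g -> supported_sum J (fun x => g (x i)).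
Proof.
  intros Hi Hg. induction Hg.
  - apply supported_const.
  - apply (supported_gen J i (fun z => / (z - a))%C); [easy|now apply rational_pole].
  - apply (supported_gen J i (fun z => z)); [easy|now apply rational_id].
  - now apply supported_plus.
  - now apply supported_mult.
Qed.

Lemma supported_approx_Sum {A} J (D : (I -> C) -> Prop) (l : list A) (k : A -> (I -> C) -> C) :
  (forall a, In a l -> forall e, 0 < e -> exists F, supported_sum J F /\
     forall x, D x -> Cmod (k a x - F x) < e) ->
  forall e, 0 < e -> exists F, supported_sum J F /\
    forall x, D x -> Cmod (Sum l (fun a => k a x) - F x) < e.
Proof.
  induction l as [|a l IH]; intros H e He.
  - exists (fun _ => RtoC 0). split; [apply supported_const|]. intros x _. simpl.
    replace (0 - 0)%C with (RtoC 0) by ring. now rewrite Cmod_0.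
  - destruct (H a (or_introl eq_refl) (e / 2)) as [F1 [HF1 D1]]; [lra|].
    destruct IH with (e := e / 2) as [F2 [HF2 D2]]; [intros; apply H; auto; now right|lra|].
    exists (fun x => F1 x + F2 x)%C. split; [now apply supported_plus|]. intros x Hx. simpl.
    specialize (D1 x Hx). specialize (D2 x Hx).
    replace (k a x + Sum l (fun a => k a x) - (F1 x + F2 x))%C
      with ((k a x - F1 x) + (Sum l (fun a => k a x) - F2 x))%C by ring.
    eapply Rle_lt_trans; [apply Cmod_triangle|]. lra.
Qed.

End SumProducts.

(** * Elimination of the variables one at a time *)

Section Induction.
Variables (I : Type) (K : I -> C -> Prop) (L : I -> sphere -> Prop).
Hypothesis hK : forall i, Ccompact (K i).
Hypothesis hOA : forall i (f : CC -> CC), Obar (K i) f <-> A_of (K i) f.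
Hypothesis hLsub : forall i p, L i p -> sphere_compl (K i) p.
Hypothesis hLcomp : forall i p, sphere_compl (K i) p ->
      exists l, L i l /\ same_component (sphere_compl (K i)) p l.

(** Coordinates outside [J] are frozen at [w]. Removing [i] turns f x into a sum of f (update x i c)
    * G (x i); the induction hypothesis applies to the first factor ([A_D_freeze]) and [RL] to the
    second. *)
Lemma finitely_many_variables (w : I -> C) (J : list I) : in_product K w ->
  forall f, A_D_prod K f -> forall eps, 0 < eps ->
  exists F, supported_sum I L J F /\
    forall x, in_product K x -> (forall j, ~ In j J -> x j = w j) -> Cmod (f x - F x) < eps.
Proof.
  intros Hw. induction J as [|i J IH]; intros f Hf eps Heps.
  - exists (fun _ => f w). split; [apply supported_const|]. intros x _ Hx.
    replace x with w by (apply functional_extensionality; intros; symmetry; auto).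
    replace (f w - f w)%C with (RtoC 0) by ring. now rewrite Cmod_0.
  - destruct (classic (In i J)) as [Hi|Hi].
    { destruct (IH f Hf eps Heps) as [F [HF HD]]. exists F. split.
      - apply supported_mono with J; auto. intros; now right.
      - intros x Hx Hag. apply HD; auto. intros j Hj. apply Hag. intros [<-|H]; auto. }
    destruct (finite_rank_approximation (K i) (L i) (slices I K f i) (hK i) (hLsub i) (hLcomp i))
      with (eps := eps / 2) as [l [Hl Happ]]; [| | |lra|].
    { intros g Hg. now apply hOA. }
    { intros g [x [Hx ->]]. now apply Hf. }
    { apply slices_totally_bounded; auto. apply Hf. }
    destruct (supported_approx_Sum I L (i :: J)
      (fun x => in_product K x /\ forall j, ~ In j (i :: J) -> x j = w j) l
      (fun xg x => f (update x i (fst xg)) * snd xg (x i))%C) with (e := eps / 2)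
      as [F [HF HD]]; [|lra|].
    + intros [c G] Hin e He. simpl. destruct (Hl c G Hin) as [Hc HG].
      destruct (product_bounded I K hK f (proj1 Hf)) as [B [HB HfB]].
      destruct (HG (e / (2 * B))) as [g [Hg Hgd]]; [apply Rdiv_lt_0_compat; lra|].
      destruct (ralg_bounded (K i) (L i) (hK i) (hLsub i) g Hg) as [B' [HB' HgB]].
      destruct (IH (fun x => f (update x i c)) (A_D_freeze I K f i c Hf Hc) (e / (2 * B')))
        as [F [HF HFd]]; [apply Rdiv_lt_0_compat; lra|].
      exists (fun x => F x * g (x i))%C. split.
      { apply supported_mult.
        - apply supported_mono with J; auto. intros; now right.
        - apply supported_ralg; [now left|easy]. }
      intros x [Hx Hag].
      assert (Ex : Cmod (f (update x i c) - F x) < e / (2 * B')).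
      (* The induction hypothesis wants coordinate [i] at [w i]. Resetting it changes neither F,
         which uses only [J], nor update x i c. *)
      { set (x' := update x i (w i)).
        assert (Hx' : in_product K x') by (apply update_in; auto).
        rewrite (supported_depends I L J F x x' HF).
        2: { intros j Hj. unfold x'. rewrite update_other; [easy|]. intros ->. auto. }
        replace (update x i c) with (update x' i c) by (unfold x'; apply update_update).
        apply HFd; auto. intros j Hj. unfold x'. destruct (classic (j = i)) as [->|Hji].
        - now rewrite update_same.
        - rewrite update_other by easy. apply Hag. intros [E|E]; auto. }
      assert (Eg : Cmod (G (x i) - g (x i)) < e / (2 * B)) by (apply Hgd, Hx).
      specialize (HgB (x i) (Hx i)). specialize (HfB (update x i c) (update_in I K x i c Hx Hc)).
      replace (f (update x i c) * G (x i) - F x * g (x i))%C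
        with (f (update x i c) * (G (x i) - g (x i)) + (f (update x i c) - F x) * g (x i))%C by ring.
      eapply Rle_lt_trans; [apply Cmod_triangle|]. rewrite !Cmod_mult.
      pose proof (Cmod_ge_0 (f (update x i c))). pose proof (Cmod_ge_0 (G (x i) - g (x i))).
      pose proof (Cmod_ge_0 (f (update x i c) - F x)). pose proof (Cmod_ge_0 (g (x i))).
      assert (T1 : Cmod (f (update x i c)) * Cmod (G (x i) - g (x i)) <= B * Cmod (G (x i) - g (x i))).
      { apply Rmult_le_compat_r; auto. }
      assert (T2 : Cmod (f (update x i c) - F x) * Cmod (g (x i)) <= Cmod (f (update x i c) - F x) * B').
      { apply Rmult_le_compat_l; auto. }
      assert (T3 : B * Cmod (G (x i) - g (x i)) < B * (e / (2 * B))) by (apply Rmult_lt_compat_l; auto).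
      assert (T4 : Cmod (f (update x i c) - F x) * B' < e / (2 * B') * B') by (apply Rmult_lt_compat_r; auto).
      replace (B * (e / (2 * B))) with (e / 2) in T3 by (field; lra).
      replace (e / (2 * B') * B') with (e / 2) in T4 by (field; lra). lra.
    + exists F. split; [easy|]. intros x Hx Hag. specialize (HD x (conj Hx Hag)).
      specialize (Happ (fun z => f (update x i z)) (x i)). cbv beta in Happ.
      rewrite update_id in Happ.
      assert (A1 := Happ (ex_intro _ x (conj Hx eq_refl)) (Hx i)).
      pose proof (Cmod_dist_triangle (f x)
        (Sum l (fun xg => f (update x i (fst xg)) * snd xg (x i))%C) (F x)). lra.
Qed.

End Induction.

Theorem mainTheorem16 (I : Type) (K : I -> CC -> Prop)
  (L : I -> sphere -> Prop)
  (hK : forall i, Ccompact (K i))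
  (hOA : forall i (f : CC -> CC), Obar (K i) f <-> A_of (K i) f)
  (hLsub : forall i p, L i p -> sphere_compl (K i) p)
  (hLcomp : forall i p, sphere_compl (K i) p ->
      exists l, L i l /\ same_component (sphere_compl (K i)) p l) :
  forall f : (I -> CC) -> CC, A_D_prod K f ->
  forall eps, 0 < eps ->
    exists F, sum_prod_rational L F /\
      forall x, in_product K x -> Cnorm (Csub (f x) (F x)) < eps.
Proof.
  intros f Hf eps Heps.
  destruct (classic (exists w, in_product K w)) as [[w Hw]|Hno].
  2: { exists (fun _ => RtoC 0). split.
       - apply (supported_sum_rational I L nil), supported_const.
       - intros x Hx. exfalso. eauto. }
  destruct (product_uniform_continuity I K hK f (proj1 Hf) (eps / 2)) as [J [d [Hd Huc]]]; [lra|].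
  destruct (finitely_many_variables I K L hK hOA hLsub hLcomp w J Hw f Hf (eps / 2)) as [F [HF HD]]; [lra|].
  exists F. split; [now apply (supported_sum_rational I L J)|]. intros x Hx.
  rewrite Cnorm_Cmod. change (Cmod (f x - F x)%C < eps).
  (* Replacing [x] by [w] outside [J] moves f by less than eps / 2 and leaves F unchanged. *)
  set (x' := fun j => if excluded_middle_informative (In j J) then x j else w j).
  assert (E1 : forall j, In j J -> x' j = x j).
  { intros j Hj. unfold x'. now destruct excluded_middle_informative. }
  assert (Hx' : in_product K x').
  { intros j. unfold x'. destruct excluded_middle_informative; auto. }
  rewrite (supported_depends I L J F x x' HF) by (intros; symmetry; auto).
  assert (A1 : Cmod (f x - f x') < eps / 2).
  { apply Huc; auto. intros j Hj. rewrite E1 by easy.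
    replace (x j - x j)%C with (RtoC 0) by ring. rewrite Cmod_0. easy. }
  assert (A2 : Cmod (f x' - F x') < eps / 2).
  { apply HD; auto. intros j Hj. unfold x'. now destruct excluded_middle_informative. }
  pose proof (Cmod_dist_triangle (f x) (f x') (F x')). lra.
Qed.
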